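(* Let $u>0$, $\rho\ge0$, $\lambda>0$, let $\{X_i\}_{i\ge1}$ be iid random variables with finite mean $\mu>0$, and let $$R^{\alpha_1,\alpha_2}(t)=u+\mu(1+\rho)\lambda Y_{\alpha_1,\alpha_2}(t)-\sum_{i=1}^{N^{\alpha_1,\alpha_2}(t)}X_i,\quad t\ge0,$$ be the mixed fractional risk process. For fixed $\delta>0$ let $Z_\delta^{\alpha_1,\alpha_2}(t)=R^{\alpha_1,\alpha_2}(t+\delta)-R^{\alpha_1,\alpha_2}(t)$, $t\ge0$ (the mixed fractional Poissonian noise risk process). Then $\{Z_\delta^{\alpha_1,\alpha_2}(t)\}_{t\ge0}$ has the short-range dependence (SRD) property.
   Context: Fix $0<\alpha_2<\alpha_1<1$ and $C_1,C_2\ge0$ with $C_1+C_2=1$. The mixed stable subordinator $\{D_{\alpha_1,\alpha_2}(t)\}_{t\ge0}$ is the subordinator (non-decreasing L\'evy process) with $\mathbb{E}(e^{-sD_{\alpha_1,\alpha_2}(t)})=e^{-t(C_1s^{\alpha_1}+C_2s^{\alpha_2})}$, $s\ge0$. Its inverse is $Y_{\alpha_1,\alpha_2}(t)=\inf\{s\ge0:D_{\alpha_1,\alpha_2}(s)>t\}$. The mixed fractional Poisson process (MFPP) is $N^{\alpha_1,\alpha_2}(t)=N(Y_{\alpha_1,\alpha_2}(t))$, where $\{N(t)\}_{t\ge0}$ is a homogeneous Poisson process with intensity $\lambda$ independent of $\{Y_{\alpha_1,\alpha_2}(t)\}_{t\ge0}$. The MFPP is assumed to be independent of the sequence $\{X_i\}_{i\ge1}$.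 LRD/SRD: Let $s>0$ be fixed and $t>s$. If the correlation function of a stochastic process $\{X(t)\}_{t\ge0}$ satisfies $\operatorname{Corr}(X(s),X(t))\sim d(s)t^{-\nu}$ as $t\to\infty$, where the constant $d(s)$ is independent of $t$, then $\{X(t)\}_{t\ge0}$ is said to exhibit the long-range dependence (LRD) property if $\nu\in(0,1)$ and the SRD property if $\nu\in(1,2)$.
   Formalization: The claims are also assumed to have finite second moment, since otherwise the correlation is undefined; the sequence X_i is independent of N and Y jointly; d(s) may be 0, as happens when rho = 0. *)

(* Defs.v *)
From HB Require Import structures.
From mathcomp Require Import all_boot all_order all_algebra finmap.
From mathcomp Require Import all_classical all_reals all_analysis.

Set Implicit Arguments.
Unset Strict Implicit.
Unset Printing Implicit Defensive.

Import Order.TTheory GRing.Theory Num.Theory.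
Import numFieldNormedType.Exports.

Local Open Scope classical_set_scope.
Local Open Scope ring_scope.

(* All processes are indexed by R, but only their values at times t >= 0 are
   constrained or used. *)

(* The Landau notations need a filter structure on the filter of
   neighbourhoods of +oo. *)
Definition at_infinity (R : realType) : filter_on R :=
  FilterType (pinfty_nbhs R) proper_pinfty_nbhs.

Section Independence.
Context {d : measure_display} {T : measurableType d} {R : realType}.
Variable P : probability T R.

Definition rv_events {d' : measure_display} {T' : measurableType d'}
    (X : T -> T') : set_system T :=
  preimage_set_system setT X measurable.

Definition process_events {I : Type} {d' : measure_display}
    {T' : measurableType d'} (A : set I) (X : I -> T -> T') : set_system T :=
  <<s \bigcup_(i in A) rv_events (X i) >>.

Definition independent_classes (F G : set_system T) : Prop :=
  forall A B, F A -> G B -> P (A `&` B) = (P A * P B)%E.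

Definition mutually_independent {I : choiceType} {d' : measure_display}
    {T' : measurableType d'} (X : I -> T -> T') : Prop :=
  forall (J : {fset I}) (E : I -> set T),
    (forall i, i \in J -> rv_events (X i) (E i)) ->
    P (\bigcap_(i in [set` J]) E i) = (\prod_(i <- J) P (E i))%E.

Definition same_law {d' : measure_display} {T' : measurableType d'}
    (X Y : T -> T') : Prop :=
  forall B, measurable B -> P (X @^-1` B) = P (Y @^-1` B).

Definition iid {d' : measure_display} {T' : measurableType d'}
    (X : nat -> T -> T') : Prop :=
  mutually_independent X /\ forall i, same_law (X i) (X 0%N).

End Independence.

Section Processes.
Context {d : measure_display} {T : measurableType d} {R : realType}.
Variable P : probability T R.

Definition nonneg_times : set R := [set t | 0 <= t].

Definition cadlag (f : R -> R) : Prop :=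
  (forall t, 0 <= t -> f x @[x --> t^'+] --> f t) /\
  (forall t, 0 < t -> cvg (f x @[x --> t^'-])).

(* Stochastic continuity is not listed: it follows from right-continuity of the
   paths and stationarity of the increments. *)
Record levy_process (L : R -> T -> R) : Prop := LevyProcess {
  levy_measurable : forall t, 0 <= t -> measurable_fun setT (L t) ;
  levy_start : forall w, L 0 w = 0 ;
  levy_cadlag : forall w, cadlag (L ^~ w) ;
  levy_indep_increments : forall t : nat -> R,
    0 <= t 0%N -> (forall i, t i <= t i.+1) ->
    mutually_independent P (fun i w => L (t i.+1) w - L (t i) w) ;
  levy_stationary_increments : forall s h, 0 <= s -> 0 <= h ->
    same_law P (fun w => L (s + h) w - L s w) (L h) }.

Definition subordinator (D : R -> T -> R) : Prop :=
  levy_process D /\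
  forall w s t, 0 <= s -> s <= t -> D s w <= D t w.

Definition mixed_stable_subordinator (C1 C2 a1 a2 : R) (D : R -> T -> R) :
    Prop :=
  subordinator D /\
  forall s t, 0 <= s -> 0 <= t ->
    'E_P[fun w => expR (- (s * D t w))]%E =
    (expR (- (t * (C1 * s `^ a1 + C2 * s `^ a2))))%:E.

(* The set is nonempty for almost every w; [inf] is 0 otherwise. *)
Definition inverse_subordinator (D : R -> T -> R) (t : R) (w : T) : R :=
  inf [set s | 0 <= s /\ t < D s w].

Record poisson_process (lam : R) (N : R -> T -> nat) : Prop :=
  PoissonProcess {
  poisson_levy : levy_process (fun t w => (N t w)%:R) ;
  poisson_nondecreasing :
    forall w s t, 0 <= s -> s <= t -> (N s w <= N t w)%N ;
  poisson_marginal : forall t k, 0 < t ->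
    P (N t @^-1` [set k]) = (poisson_pmf (lam * t) k)%:E }.

Definition time_changed {V : Type} (N : R -> T -> V) (Y : R -> T -> R)
    (t : R) (w : T) : V :=
  N (Y t w) w.

(* The claims X_1, X_2, ... are numbered from 0. *)
Definition mixed_fractional_risk_process (u mu rho lam : R)
    (Y : R -> T -> R) (N : R -> T -> nat) (X : nat -> T -> R)
    (t : R) (w : T) : R :=
  u + mu * (1 + rho) * lam * Y t w
    - \sum_(i < time_changed N Y t w) X i w.

Definition noise_process (delta : R) (S : R -> T -> R) (t : R) (w : T) : R :=
  S (t + delta) w - S t w.

Definition correlation (X Y : T -> R) : R :=
  fine (covariance P X Y) /
  (Num.sqrt (fine (variance P X)) * Num.sqrt (fine (variance P Y))).

(* Existence of the correlation function at positive times, as presupposed by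
   its use in the definition of short-range dependence. *)
Definition has_correlation (Z : R -> T -> R) : Prop :=
  forall t, 0 < t -> Z t \in Lfun P 2%:E /\ (0 < variance P (Z t))%E.

(* [f ~_F g] is the Landau equivalence f = g + o(g), which also makes sense
   when g = 0 (it then says that f vanishes eventually), so no sign condition
   on the constant c s is needed. *)
Definition correlation_decay (Z : R -> T -> R) (nu : R) : Prop :=
  exists c : R -> R, forall s, 0 < s ->
    (fun t : R => correlation (Z s) (Z t)) ~_(at_infinity R)
    (fun t : R => c s * t `^ (- nu)).

Definition short_range_dependent (Z : R -> T -> R) : Prop :=
  has_correlation Z /\ exists2 nu : R, 1 < nu < 2 & correlation_decay Z nu.

End Processes.

(* Main.v *)
Require Import Defs.
From HB Require Import structures.
From mathcomp Require Import all_boot all_order all_algebra finmap.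
From mathcomp Require Import all_classical all_reals all_analysis.
From mathcomp Require Import measurable_realfun.
From mathcomp Require Import ring lra.

(** Write [Y] for the inverse subordinator and [D_t = Y (t + delta) - Y t] for
    its increments (over windows of fixed length [delta]); put
    [kappa = rho mu lambda].

    _Reduction to the inverse subordinator._  Given the path of [Y], the claims
    that arrive in disjoint windows are disjoint blocks of the sequence [X_i],
    and the lengths of the blocks are independent Poisson variables with means
    [lambda D_t].  Averaging first over the claims and then over the jumps gives
    the second moment of every affine combination of the noise at two times
    ([surplus_second_moment]), and hence, for disjoint windows,
      [Var Z_t = kappa^2 Var D_t + lambda E(X^2) E D_t],
      [Cov (Z_s, Z_t) = kappa^2 Cov (D_s, D_t)].

    _Potential theory._  [D_t] is the time that the subordinator spends in the
    window [(t, t + delta]] ([inverse_increment]).  With [U] the potential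
    measure of the subordinator and [A = (s, s + delta]], its independent
    stationary increments give [E D_t = U (t, t + delta]] and
      [E (D_s D_t) = int_A U (t - a, t - a + delta] U(da)]
    for [t > s + delta], while [E D_t^2] is twice the integral of
    [U (t, t + delta - y]] over [y] in [[0, delta]] against [U(dy)]
    ([integral_occ_mul] and the lemmas after it).

    _The density of [U]._  [U] has the completely monotone density
      [u(t) = int_R exp (- e^x t) e^((1 - a2) x) phi(x) dx],
    where [phi] is positive, bounded and tends to a positive limit at minus
    infinity.  Up to elementary factors [phi] is the real part, on the line of
    imaginary part [pi], of [1 / (C1 e^(b1 z) + C2 e^(b2 z))] with
    [b_i = a_i - 1/2].  That the Laplace transform of [u] is
    [1 / (C1 s^a1 + C2 s^a2)] is a mean value property for a holomorphic
    function on a strip ([strip_mean_value]), proved by moving the line of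
    integration.  Since [e^(-D)] takes values in [[0, 1]], the values of the
    Laplace transform at the positive integers are moments, and Bernstein
    polynomials show that they determine the measure ([potential_cdf]).

    _Asymptotics._  The limit of [phi] makes [t^(1 - a2) u(t)] converge, and
    likewise [t^(2 - a2) w(t)], where [w = - u'] is the same integral with
    exponent [2 - a2].  Monotonicity of [u] and [w] turns the formulas above
    into two-sided bounds, so that [t^(1 - a2) Var Z_t] has a positive limit
    and [t^(2 - a2) Cov (Z_s, Z_t)] has a limit.  Therefore the correlation
    decays like [t^(- nu)] with
      [nu = (2 - a2) - (1 - a2) / 2 = (3 - a2) / 2],
    which lies between 1 and 3/2.  If [kappa = 0] the covariance vanishes as
    soon as the windows are disjoint.  If [C2 = 0] the subordinator is stable
    with index [a1], and the argument applies with [a1] as the smaller index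
    and weight 0 on any larger one. *)

Set Implicit Arguments.
Unset Strict Implicit.
Unset Printing Implicit Defensive.

Import Order.TTheory GRing.Theory Num.Theory.
Import numFieldNormedType.Exports.

Local Open Scope classical_set_scope.
Local Open Scope ring_scope.

(** * Integrals over the real line *)

Section tools.
Local Open Scope ereal_scope.

Lemma integral_gt0 d (T : measurableType d) (R : realType)
    (m : {measure set T -> \bar R}) (D : set T) (f : T -> \bar R) :
  measurable D -> measurable_fun D f -> (forall x, D x -> 0 < f x) ->
  0 < m D -> 0 < \int[m]_(x in D) f x.
Proof.
move=> mD mf f0 mD0; rewrite lt0e integral_ge0 ?andbT; last by move=> x /f0/ltW.
apply/eqP => i0.
have /(ae_eq_integral_abs _ mD mf)[N [mN N0 DN]] : \int[m]_(x in D) `|f x| = 0.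
  by rewrite -[RHS]i0; apply: eq_integral => x /set_mem/f0/ltW/gee0_abs.
have DN' : D `<=` N.
  move=> x Dx; apply: DN => /= /(_ Dx) f0'.
  by have := f0 _ Dx; rewrite f0' ltxx.
by move: mD0; rewrite ltNge -N0 le_measure ?inE.
Qed.

Context {R : realType}.
Notation mu := (@lebesgue_measure R).

Lemma lebesgue_measure_setT_gt0 : 0 < mu setT.
Proof.
apply: (@lt_le_trans _ _ (mu `[0%R, 1%R])); last by apply: le_measure; rewrite ?inE.
by rewrite lebesgue_measure_itv/= lte_fin ltr01 -EFinB subr0 lte_fin.
Qed.

(** Named so that it can carry the structure of a measurable function, over
    which integrals are transported. *)
Definition translate (c : R) (x : measurableTypeR R) : measurableTypeR R :=
  (x + c)%R.

Let measurable_translate (c : R) : measurable_fun setT (translate c).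
Proof. exact: measurable_funD. Qed.

HB.instance Definition _ c :=
  isMeasurableFun.Build _ _ _ _ (translate c) (measurable_translate c).

Lemma lebesgue_measure_translate (c : R) (A : set R) : measurable A ->
  pushforward mu (translate c) A = mu A.
Proof.
move=> mA; apply/esym/lebesgue_measure_unique => //= _ [[a b]] _ <-.
rewrite /pushforward.
rewrite [X in _ = lebesgue_measure X](_ : _ = `](a - c)%R, (b - c)%R]%classic); last first.
  by apply/seteqP; split => x; rewrite /= /translate !in_itv/= ltrBlDr lerBrDr.
rewrite !lebesgue_measure_itv/= !lte_fin ltrD2r.
by case: ifP => // _; rewrite -!EFinB; congr EFin; ring.
Qed.

Lemma ge0_integral_shift (c : R) (f : R -> \bar R) :
  measurable_fun [set: R] f -> (forall x, 0 <= f x) ->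
  \int[mu]_x f (x + c)%R = \int[mu]_x f x.
Proof.
move=> mf f0.
transitivity (\int[pushforward mu (translate c)]_x f x).
  by rewrite ge0_integral_pushforward//= preimage_setT.
by apply: eq_measure_integral => A mA _; exact: lebesgue_measure_translate.
Qed.

Lemma integral_expR_ge0 (r : R) : (0 < r)%R ->
  \int[mu]_(x in `[0%R, +oo[) (expR (- (r * x)))%:E = (r^-1)%:E.
Proof.
move=> r0.
have dF (x : R) : is_derive x 1%R (fun x : R => - (r^-1) * expR (- (r * x)))%R (expR (- (r * x))).
  have d1 : is_derive x 1%R (fun x : R => - (r * x))%R (- r)%R.
    by apply: is_derive_eq; rewrite /GRing.scale /= mulr1.
  by apply: is_derive_eq; rewrite /GRing.scale /= mulrCA mulrNN mulVf ?mulr1 ?gt_eqF.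
have cF : {for 0%R, continuous (fun x : R => - (r^-1) * expR (- (r * x)))%R}.
  apply: differentiable_continuous; apply/derivable1_diffP.
  by have [] := dF 0%R.
rewrite (@ge0_continuous_FTC2y _ _ (fun x : R => - (r^-1) * expR (- (r * x)))%R 0%R 0%R).
- by rewrite mulr0 oppr0 expR0 mulr1 EFinN sub0e oppeK.
- by move=> x _; exact: expR_ge0.
- apply: continuous_subspaceT => x.
  apply: (@continuous_comp _ _ _ (fun x => - (r * x))%R expR); last exact: continuous_expR.
  by apply: continuousN; apply: continuousM; [exact: cst_continuous|exact: cvg_id].
- rewrite -(mulr0 (- r^-1)%R); apply: cvgM; first exact: cvg_cst.
  apply: (cvg_comp _ _ _ (@cvgr_expR R)).
  by apply: gt0_cvgMry => //; exact: cvg_id.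
- by move=> x _; have [] := dF x.
- by apply: cvg_at_right_filter; exact: cF.
- by move=> x _; rewrite derive1E; have [] := dF x.
Qed.

Lemma integrable_expR_abs (r : R) : (0 < r)%R ->
  mu.-integrable setT (fun x => (expR (- (r * `|x|)))%:E).
Proof.
move=> r0.
have cf : continuous (fun x : R => expR (- (r * `|x|))).
  move=> x; apply: (@continuous_comp _ _ _ (fun x : R => - (r * `|x|))%R expR); last exact: continuous_expR.
  apply: continuousN; apply: continuousM; first exact: cst_continuous.
  exact: norm_continuous.
apply/integrableP; split.
  by apply/measurable_EFinP; exact: continuous_measurable_fun.
under eq_integral do rewrite gee0_abs ?lee_fin ?expR_ge0//.
rewrite ge0_symfun_integralT//=; last by move=> x; rewrite /= normrN.
rewrite (_ : [set x : R | (0 <= x)%R] = `[0%R, +oo[%classic); last first.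
  by apply/seteqP; split => x /=; rewrite in_itv/= andbT.
have -> : \int[mu]_(x in `[0%R, +oo[) (expR (- (r * `|x|)))%:E =
    \int[mu]_(x in `[0%R, +oo[) (expR (- (r * x)))%:E.
  apply: eq_integral => x /set_mem; rewrite /= in_itv/= andbT => x0.
  by rewrite ger0_norm.
by rewrite integral_expR_ge0// -EFinM ltry.
Qed.

End tools.

(** * Holomorphic functions in real coordinates *)

Section holomorphic.
Context {R : realType}.
Implicit Types (P Q : R -> R -> R) (x t : R).

(** The function [P + i Q] of [x + i t] is complex differentiable with derivative
    [P' + i Q'].  The joint continuity allows differentiation under the integral
    sign in [t] and integration of the derivative in [x]. *)
Record holo P Q P' Q' x t : Prop := Holo {
  holo_xP : is_derive x 1 (P ^~ t) (P' x t) ;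
  holo_xQ : is_derive x 1 (Q ^~ t) (Q' x t) ;
  holo_tP : is_derive t 1 (P x) (- Q' x t) ;
  holo_tQ : is_derive t 1 (Q x) (P' x t) ;
  holo_cP : {for (x, t), continuous (fun z => P z.1 z.2)} ;
  holo_cQ : {for (x, t), continuous (fun z => Q z.1 z.2)} ;
  holo_cP' : {for (x, t), continuous (fun z => P' z.1 z.2)} ;
  holo_cQ' : {for (x, t), continuous (fun z => Q' z.1 z.2)} }.

Lemma continuousX (T : topologicalType) (f : T -> R) (z : T) :
  {for z, continuous f} -> {for z, continuous (fun y => f y ^+ 2)}.
Proof. by move=> cf; exact: continuousM. Qed.

Lemma continuous_expR_comp (T : topologicalType) (f : T -> R) (z : T) :
  {for z, continuous f} -> {for z, continuous (fun y => expR (f y))}.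
Proof. by move=> cf; exact: continuous_comp cf (@continuous_expR R (f z)). Qed.

Lemma holo_add P1 Q1 P1' Q1' P2 Q2 P2' Q2' x t :
  holo P1 Q1 P1' Q1' x t -> holo P2 Q2 P2' Q2' x t ->
  holo (fun x t => P1 x t + P2 x t) (fun x t => Q1 x t + Q2 x t)
    (fun x t => P1' x t + P2' x t) (fun x t => Q1' x t + Q2' x t) x t.
Proof.
move=> [d1 d2 d3 d4 c1 c2 c3 c4] [e1 e2 e3 e4 f1 f2 f3 f4]; split.
- exact: is_deriveD.
- exact: is_deriveD.
- by rewrite opprD; exact: is_deriveD.
- exact: is_deriveD.
- exact: continuousD.
- exact: continuousD.
- exact: continuousD.
- exact: continuousD.
Qed.

Lemma holo_mul P1 Q1 P1' Q1' P2 Q2 P2' Q2' x t :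
  holo P1 Q1 P1' Q1' x t -> holo P2 Q2 P2' Q2' x t ->
  holo (fun x t => P1 x t * P2 x t - Q1 x t * Q2 x t)
    (fun x t => P1 x t * Q2 x t + Q1 x t * P2 x t)
    (fun x t => (P1' x t * P2 x t - Q1' x t * Q2 x t) +
      (P1 x t * P2' x t - Q1 x t * Q2' x t))
    (fun x t => (P1' x t * Q2 x t + Q1' x t * P2 x t) +
      (P1 x t * Q2' x t + Q1 x t * P2' x t)) x t.
Proof.
move=> [d1 d2 d3 d4 c1 c2 c3 c4] [e1 e2 e3 e4 f1 f2 f3 f4]; split.
- by apply: is_derive_eq; rewrite /GRing.scale /=; ring.
- by apply: is_derive_eq; rewrite /GRing.scale /=; ring.
- by apply: is_derive_eq; rewrite /GRing.scale /=; ring.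
- by apply: is_derive_eq; rewrite /GRing.scale /=; ring.
- by apply: continuousB; exact: continuousM.
- by apply: continuousD; exact: continuousM.
- by apply: continuousD; apply: continuousB; exact: continuousM.
- by apply: continuousD; apply: continuousD; exact: continuousM.
Qed.

(** Real and imaginary parts of [1 / (P + i Q)]. *)
Definition cinv_re P Q x t := P x t / (P x t ^+ 2 + Q x t ^+ 2).
Definition cinv_im P Q x t := - Q x t / (P x t ^+ 2 + Q x t ^+ 2).

Lemma holo_inv P Q P' Q' x t : holo P Q P' Q' x t ->
  P x t ^+ 2 + Q x t ^+ 2 != 0 ->
  holo (cinv_re P Q) (cinv_im P Q)
    (fun x t => - (P' x t * (cinv_re P Q x t ^+ 2 - cinv_im P Q x t ^+ 2)
       - Q' x t * (2 * cinv_re P Q x t * cinv_im P Q x t)))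
    (fun x t => - (P' x t * (2 * cinv_re P Q x t * cinv_im P Q x t)
       + Q' x t * (cinv_re P Q x t ^+ 2 - cinv_im P Q x t ^+ 2))) x t.
Proof.
move=> [d1 d2 d3 d4 c1 c2 c3 c4] n0.
have cn : {for (x, t), continuous (fun z => P z.1 z.2 ^+ 2 + Q z.1 z.2 ^+ 2)}.
  by apply: continuousD; exact: continuousX.
have cr : {for (x, t), continuous (fun z => cinv_re P Q z.1 z.2)}.
  by apply: continuousM => //; apply: continuousV.
have ci : {for (x, t), continuous (fun z => cinv_im P Q z.1 z.2)}.
  apply: continuousM => //; first exact: continuousN.
  by apply: continuousV.
have dx : is_derive x 1 (fun x => (P x t ^+ 2 + Q x t ^+ 2)^-1)
   (- (P x t ^+ 2 + Q x t ^+ 2) ^- 2 * (2 * P x t * P' x t + 2 * Q x t * Q' x t)).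
  have d : is_derive x 1 (fun x => P x t ^+ 2 + Q x t ^+ 2)
     (2 * P x t * P' x t + 2 * Q x t * Q' x t).
    by apply: is_derive_eq; rewrite /GRing.scale /=; ring.
  exact: is_deriveV.
have dt : is_derive t 1 (fun t => (P x t ^+ 2 + Q x t ^+ 2)^-1)
   (- (P x t ^+ 2 + Q x t ^+ 2) ^- 2 * (2 * P x t * - Q' x t + 2 * Q x t * P' x t)).
  have d : is_derive t 1 (fun t => P x t ^+ 2 + Q x t ^+ 2)
     (2 * P x t * - Q' x t + 2 * Q x t * P' x t).
    by apply: is_derive_eq; rewrite /GRing.scale /=; ring.
  exact: is_deriveV.
split => //.
- apply: (@is_derive_eq _ _ _ _ _ _ _ _ (is_deriveM _ _)).
  by rewrite /GRing.scale /= /cinv_re /cinv_im; field.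
- apply: (@is_derive_eq _ _ _ _ _ _ _ _ (is_deriveM _ _)).
  by rewrite /GRing.scale /= /cinv_re /cinv_im; field.
- apply: (@is_derive_eq _ _ _ _ _ _ _ _ (is_deriveM _ _)).
  by rewrite /GRing.scale /= /cinv_re /cinv_im; field.
- apply: (@is_derive_eq _ _ _ _ _ _ _ _ (is_deriveM _ _)).
  by rewrite /GRing.scale /= /cinv_re /cinv_im; field.
- apply: continuousN; apply: continuousB; apply: continuousM => //.
    by apply: continuousB; apply: continuousX.
  by apply: continuousM => //; apply: continuousM => //; exact: cst_continuous.
- apply: continuousN; apply: continuousD; apply: continuousM => //.
    by apply: continuousM => //; apply: continuousM => //; exact: cst_continuous.
  by apply: continuousB; apply: continuousX.
Qed.

Lemma holo_cst (c : R) x t :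
  holo (fun _ _ => c) (fun _ _ => 0) (fun _ _ => 0) (fun _ _ => 0) x t.
Proof. by split; rewrite ?oppr0; do ?[exact: is_derive_cst|exact: cst_continuous]. Qed.

(** Real and imaginary parts of [e^(b z)]. *)
Definition cexp_re (b : R) x t := expR (b * x) * cos (b * t).
Definition cexp_im (b : R) x t := expR (b * x) * sin (b * t).

Lemma holo_exp b x t : holo (cexp_re b) (cexp_im b)
  (fun x t => b * cexp_re b x t) (fun x t => b * cexp_im b x t) x t.
Proof.
have cr : {for (x, t), continuous (fun z => cexp_re b z.1 z.2)}.
  apply: continuousM.
    apply: continuous_comp; last exact: continuous_expR.
    by apply: continuousM; [exact: cst_continuous|exact: cvg_fst].
  apply: continuous_comp; last exact: continuous_cos.
  by apply: continuousM; [exact: cst_continuous|exact: cvg_snd].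
have ci : {for (x, t), continuous (fun z => cexp_im b z.1 z.2)}.
  apply: continuousM.
    apply: continuous_comp; last exact: continuous_expR.
    by apply: continuousM; [exact: cst_continuous|exact: cvg_fst].
  apply: continuous_comp; last exact: continuous_sin.
  by apply: continuousM; [exact: cst_continuous|exact: cvg_snd].
have db (y : R) : is_derive y (1 : R) (fun x : R => b * x) b.
  by apply: is_derive_eq; rewrite /GRing.scale /= mulr1.
split => //.
- rewrite /cexp_re; apply: is_derive_eq; rewrite /GRing.scale /=; ring.
- rewrite /cexp_im; apply: is_derive_eq; rewrite /GRing.scale /=; ring.
- rewrite /cexp_re; apply: is_derive_eq; rewrite /GRing.scale /= /cexp_im; ring.
- rewrite /cexp_im; apply: is_derive_eq; rewrite /GRing.scale /= /cexp_re; ring.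
- by apply: continuousM => //; exact: cst_continuous.
- by apply: continuousM => //; exact: cst_continuous.
Qed.

End holomorphic.

(** * Cauchy's theorem for rectangles *)

Section rect.
Context {R : realType}.
Notation mu := (@lebesgue_measure R).

Lemma holo_scale (c : R) P Q P' Q' x t : holo P Q P' Q' x t ->
  holo (fun x t => c * P x t) (fun x t => c * Q x t)
    (fun x t => c * P' x t) (fun x t => c * Q' x t) x t.
Proof.
move=> [d1 d2 d3 d4 c1 c2 c3 c4]; split.
- by apply: is_derive_eq; rewrite /GRing.scale /=; ring.
- by apply: is_derive_eq; rewrite /GRing.scale /=; ring.
- by apply: is_derive_eq; rewrite /GRing.scale /=; ring.
- by apply: is_derive_eq; rewrite /GRing.scale /=; ring.
- by apply: continuousM => //; exact: cst_continuous.
- by apply: continuousM => //; exact: cst_continuous.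
- by apply: continuousM => //; exact: cst_continuous.
- by apply: continuousM => //; exact: cst_continuous.
Qed.

Lemma continuous_slice1 (F : R -> R -> R) x t :
  {for (x, t), continuous (fun z : R * R => F z.1 z.2)} ->
  {for x, continuous (F ^~ t)}.
Proof.
move=> c; apply: (@continuous_comp _ _ _ (fun x => (x, t)) (fun z => F z.1 z.2)) => //.
by apply: (@cvg_pair _ _ _ _ (nbhs x) (nbhs t)); [exact: cvg_id|exact: cvg_cst].
Qed.

Lemma continuous_slice2 (F : R -> R -> R) x t :
  {for (x, t), continuous (fun z : R * R => F z.1 z.2)} ->
  {for t, continuous (F x)}.
Proof.
move=> c; apply: (@continuous_comp _ _ _ (fun t => (x, t)) (fun z => F z.1 z.2)) => //.
by apply: (@cvg_pair _ _ _ _ (nbhs x) (nbhs t)); [exact: cvg_cst|exact: cvg_id].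
Qed.

Lemma continuous_rect_bounded (F : R -> R -> R) (a b u v : R) :
  (forall x t, a <= x <= b -> u <= t <= v ->
    {for (x, t), continuous (fun z : R * R => F z.1 z.2)}) ->
  exists2 M, 0 <= M &
    forall x t, a <= x <= b -> u <= t <= v -> `|F x t| <= M.
Proof.
move=> cF.
have cK : compact (`[a, b]%classic `*` `[u, v]%classic : set (R * R)).
  by apply: compact_setX; exact: segment_compact.
have cF' : {within `[a, b] `*` `[u, v], continuous (fun z : R * R => F z.1 z.2)}.
  apply: continuous_in_subspaceT => -[x t] /set_mem [/=].
  by rewrite !in_itv/=; exact: cF.
have /compact_bounded [M [Mr HM]] := continuous_compact cF' cK.
exists (`|M| + 1) => [|x t xab tuv]; first by rewrite addr_ge0.
apply: (HM (`|M| + 1)) => /=.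
  by rewrite (le_lt_trans (ler_norm _))// ltrDl.
by exists (x, t) => //; split; rewrite /= in_itv.
Qed.

(** The Cauchy-Riemann equation for the imaginary part turns the derivative of
    the horizontal integral into an exact differential, so that it reduces to
    the values of the real part on the two vertical sides: Cauchy's theorem
    for rectangles, in differential form. *)
Lemma holo_integral_derive P Q P' Q' (a b u v t : R) : a < b -> u < t < v ->
  (forall x s, a <= x <= b -> u < s < v -> holo P Q P' Q' x s) ->
  is_derive t 1 (fun s => \int[mu]_(x in `[a, b]) Q x s) (P b t - P a t).
Proof.
move=> ab /andP[ut tv] H.
pose u' := (u + t) / 2; pose v' := (t + v) / 2.
have uu' : u < u' by rewrite /u'; lra.
have u't : u' < t by rewrite /u'; lra.
have tv' : t < v' by rewrite /v'; lra.
have vv' : v' < v by rewrite /v'; lra.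
have [M M0 HM] : exists2 M, 0 <= M &
    forall x s, a <= x <= b -> u' <= s <= v' -> `|P' x s| <= M.
  apply: continuous_rect_bounded => x s xab /andP[s1 s2].
  by apply: (holo_cP' (H _ _ xab _)); lra.
have It : `]u', v'[%classic t by rewrite /= in_itv/= u't tv'.
have intQ s : `]u', v'[%classic s -> mu.-integrable `[a, b] (EFin \o Q ^~ s).
  rewrite /= in_itv/= => /andP[us sv].
  apply: continuous_compact_integrable; first exact: segment_compact.
  apply: continuous_in_subspaceT => x /set_mem/=; rewrite in_itv/= => xab.
  by apply: continuous_slice1; apply: (holo_cQ (H _ _ xab _)); lra.
have dQ (s x : R) : `]u', v'[%classic s -> `[a, b]%classic x ->
    is_derive s 1 (Q x) (P' x s).
  rewrite /= !in_itv/= => /andP[us sv] xab.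
  by apply: (holo_tQ (H _ _ xab _)); lra.
have derQ (s x : R) : `]u', v'[%classic s -> `[a, b]%classic x ->
    derivable (Q x) s 1.
  by move=> Is Ix; have [] := dQ _ _ Is Ix.
have pQ (s x : R) : `]u', v'[%classic s -> `[a, b]%classic x ->
    partial1of2 (fun s x => Q x s) s x = P' x s.
  by move=> Is Ix; rewrite partial1of2E; have [_ ->] := dQ _ _ Is Ix.
have intM : mu.-integrable `[a, b] (EFin \o (fun=> M : R)).
  apply: continuous_compact_integrable; first exact: segment_compact.
  exact: continuous_subspaceT (@cst_continuous _ _ _).
have QM (s x : R) : `]u', v'[%classic s -> `[a, b]%classic x ->
    `|partial1of2 (fun s x => Q x s) s x| <= M.
  move=> Is Ix; rewrite pQ//; move: Is Ix; rewrite /= !in_itv/= => /andP[us sv] xab.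
  by apply: HM => //; rewrite !ltW.
have mab : measurable (`[a, b] : set R) by [].
have D1 := @derivable_under_integral R _ _ mu (fun s x => Q x s)
  `[a, b] mab t u' v' It intQ derQ (fun=> M) (fun=> M0) intM QM.
have D2 := @differentiation_under_integral R _ _ mu (fun s x => Q x s)
  `[a, b] mab t u' v' It intQ derQ (fun=> M) (fun=> M0) intM QM.
have J : \int[mu]_(y in `[a, b])
    partial1of2 (fun s x : R => Q x s) t y = P b t - P a t.
  transitivity (\int[mu]_(x in `[a, b]) P' x t).
    by apply: eq_Rintegral => x /set_mem Ix; rewrite pQ.
  have xH x : a <= x <= b -> holo P Q P' Q' x t.
    by move=> xab; apply: H => //; rewrite ut tv.
  have cP x : a <= x <= b -> {for x, continuous (P ^~ t)}.
    by move=> xab; apply: continuous_slice1; exact: (holo_cP (xH _ xab)).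
  rewrite /Rintegral (@continuous_FTC2 _ _ (P ^~ t))//.
  - apply: continuous_in_subspaceT => x /set_mem/=; rewrite in_itv/= => xab.
    by apply: continuous_slice1; exact: (holo_cP' (xH _ xab)).
  - split.
    + move=> x; rewrite in_itv/= => /andP[ax xb].
      by have [|[? _] _ _ _ _ _ _ _] := xH x; rewrite ?ltW.
    + by apply: cvg_at_right_filter; apply: cP; rewrite lexx ltW.
    + by apply: cvg_at_left_filter; apply: cP; rewrite lexx ltW.
  - move=> x; rewrite in_itv/= => /andP[ax xb].
    by have [|[_ ?] _ _ _ _ _ _ _] := xH x; rewrite ?ltW// derive1E.
apply: DeriveDef; first exact: D1.
by rewrite -derive1E D2 J.
Qed.

End rect.

(** * A mean value property on a strip *)

Section strip.
Context {R : realType}.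
Notation mu := (@lebesgue_measure R).
Variables (A B b1 b2 : R).
Hypotheses (A0 : 0 <= A) (B0 : 0 < B).
Hypotheses (hb1 : `|b1| < 2^-1) (hb2 : `|b2| < 2^-1).

(** In these names [z = x + i t]: the denominator [A e^(b1 z) + B e^(b2 z)], the
    function [2 sinh (z / 2)], and the quotient
    [Phi(z) = (1 / (A e^(b1 z) + B e^(b2 z)) - 1 / (A + B)) / (2 sinh (z / 2))].
    Subtracting the value at 0 removes the pole of the quotient there. *)
Definition den_re (x t : R) := A * cexp_re b1 x t + B * cexp_re b2 x t.
Definition den_im (x t : R) := A * cexp_im b1 x t + B * cexp_im b2 x t.
Definition sh_re (x t : R) := cexp_re (2^-1) x t + -1 * cexp_re (- 2^-1) x t.
Definition sh_im (x t : R) := cexp_im (2^-1) x t + -1 * cexp_im (- 2^-1) x t.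
Let G0 := (A + B)^-1.
Let gre x t := cinv_re den_re den_im x t + (- G0).
Let gim x t := cinv_im den_re den_im x t + 0.
Let ire x t := cinv_re sh_re sh_im x t.
Let iim x t := cinv_im sh_re sh_im x t.
Definition Phi_re x t := gre x t * ire x t - gim x t * iim x t.
Definition Phi_im x t := gre x t * iim x t + gim x t * ire x t.

(* Squared moduli of the denominator and of [2 sinh (z / 2)]. *)
Let n2 x t := den_re x t ^+ 2 + den_im x t ^+ 2.
Let s2 x t := sh_re x t ^+ 2 + sh_im x t ^+ 2.

Lemma holo_Phi : exists P' Q', forall x t, n2 x t != 0 -> s2 x t != 0 ->
  holo Phi_re Phi_im P' Q' x t.
Proof.
do 2 eexists; move=> x t nx sx.
have hd := holo_add (holo_scale A (holo_exp b1 x t)) (holo_scale B (holo_exp b2 x t)).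
have hs := holo_add (holo_exp 2^-1 x t) (holo_scale (-1) (holo_exp (- 2^-1) x t)).
exact: (holo_mul (holo_add (holo_inv hd nx) (holo_cst (- G0) x t)) (holo_inv hs sx)).
Qed.

Lemma s2E x t : s2 x t = (expR (x / 2) - expR (- (x / 2))) ^+ 2 + 2 * (1 - cos t).
Proof.
rewrite /s2 /sh_re /sh_im /cexp_re /cexp_im.
rewrite !mulNr cosN sinN ![2^-1 * _]mulrC.
have c1 : cos t = 2 * cos (t / 2) ^+ 2 - 1.
  by rewrite -{1}[t](@divfK _ 2)// mulr_natr cos_mulr2n mulr_natl.
have := cos2Dsin2 (t / 2); rewrite c1.
have := expRxMexpNx_1 (x / 2).
move: (expR (x / 2)) (expR (- (x / 2))) (cos (t / 2)) (sin (t / 2)) => e f c s ef cs.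
rewrite (_ : _ + _ = (e - f) ^+ 2 * c ^+ 2 + (e + f) ^+ 2 * s ^+ 2); last by ring.
have -> : s ^+ 2 = 1 - c ^+ 2 by rewrite -cs; ring.
have -> : (e + f) ^+ 2 = (e - f) ^+ 2 + 4 * (e * f) by ring.
rewrite ef; ring.
Qed.

(** The zeros of [sinh (z / 2)] are the multiples of [2 pi i]. *)
Lemma s2_gt0 x t : 0 <= t < pi *+ 2 -> x != 0 \/ 0 < t -> 0 < s2 x t.
Proof.
move=> /andP[t0 t2] h; rewrite s2E.
have c1 : 0 <= 1 - cos t by rewrite subr_ge0 cos_le1.
have [x0|x0] := eqVneq x 0; last first.
  apply: ltr_wpDr; first by rewrite mulr_ge0.
  rewrite exprn_even_gt0//= subr_eq0; apply/eqP => /expR_inj h2.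
  by move/eqP: x0; apply; lra.
have {h}t0' : 0 < t by case: h => //; rewrite x0 eqxx.
rewrite x0 mul0r oppr0 subrr expr0n/= add0r mulr_gt0// subr_gt0 lt_neqAle cos_le1 andbT.
have c2 : cos t = 1 - 2 * sin (t / 2) ^+ 2.
  rewrite -{1}[t](@divfK _ 2)// mulr_natr cos_mulr2n cos2sin2 mulr2n; ring.
have : 0 < sin (t / 2) by apply: sin_gt0_pi; rewrite divr_gt0//= ltr_pdivrMr// mulr_natr.
by move=> s0; rewrite c2 lt_eqF// ltrBlDr ltrDl mulr_gt0// exprn_gt0.
Qed.

Let beta : R := Num.max `|b1| `|b2|.
Let beta_ge0 : 0 <= beta. Proof. by rewrite le_max normr_ge0. Qed.
Let beta_lt : beta < 2^-1. Proof. by rewrite gt_max hb1. Qed.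

(* The strip on which the denominator has positive real part is a little wider
   than the closed strip of height pi, because the exponents stay below 1/2. *)
Let Tm : R := pi / (beta + 2^-1).

Let pi_lt_Tm : pi < Tm.
Proof.
have b0 := beta_ge0; have b1' := beta_lt; have p0 := @pi_gt0 R.
by rewrite /Tm ltr_pdivlMr; [nra|lra].
Qed.

Let Tm_le : Tm <= pi *+ 2.
Proof.
have b0 := beta_ge0; have b1' := beta_lt; have p0 := @pi_gt0 R.
rewrite /Tm ler_pdivrMr; last lra.
have h : 0 <= pi * beta :> R by rewrite mulr_ge0// ltW.
by rewrite mulr2n; lra.
Qed.

Let cos_gt0_strip (b t : R) : `|b| <= beta -> 0 <= t < Tm -> 0 < cos (b * t).
Proof.
move=> hb /andP[t0 tT]; apply: cos_gt0_pihalf.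
have b0 := beta_ge0; have b1' := beta_lt; have p0 := @pi_gt0 R.
have : `|b * t| < pi / 2.
  rewrite normrM (ger0_norm t0) (@le_lt_trans _ _ (beta * t))//.
    by rewrite ler_wpM2r.
  rewrite (@le_lt_trans _ _ ((beta) * Tm))//; first by rewrite ler_wpM2l// ltW.
  by rewrite /Tm mulrA ltr_pdivrMr; [nra|lra].
by rewrite ltr_norml.
Qed.

Let bb1 : `|b1| <= beta. Proof. by rewrite le_max lexx. Qed.
Let bb2 : `|b2| <= beta. Proof. by rewrite le_max lexx orbT. Qed.

Let cospi_le (b t : R) : `|b| <= beta -> 0 <= t <= pi -> cos (b * pi) <= cos (b * t).
Proof.
move=> hb /andP[t0 tp].
have b0 := beta_ge0; have b1' := beta_lt; have p0 := @pi_gt0 R.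
have nb : `|b| <= 1 by lra.
rewrite -cos_norm -[leRHS]cos_norm !normrM (ger0_norm t0) (ger0_norm (ltW p0)).
rewrite le_eqVlt; apply/orP.
have [->|htp] := eqVneq t pi; first by left.
have [->|hb0] := eqVneq b 0; first by left; rewrite normr0 !mul0r.
right; rewrite ltr_cos ?in_itv/=.
- by rewrite ltr_pM2l ?normr_gt0// lt_neqAle htp.
- by rewrite mulr_ge0//= (le_trans _ tp)// ler_piMl.
- by rewrite mulr_ge0//= ?(ltW p0)// ler_piMl// ltW.
Qed.

Let pipi : (0 : R) <= pi < Tm. Proof. by rewrite pi_ge0 pi_lt_Tm. Qed.

Let den_re_gt0 x t : 0 <= t < Tm -> 0 < den_re x t.
Proof.
move=> tT; rewrite /den_re /cexp_re ltr_wpDl//.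
  by rewrite mulr_ge0// mulr_ge0 ?expR_ge0// ltW// cos_gt0_strip.
by rewrite mulr_gt0// mulr_gt0 ?expR_gt0// cos_gt0_strip.
Qed.

Let n2_gt0 x t : 0 <= t < Tm -> 0 < n2 x t.
Proof.
by move=> tT; rewrite /n2 ltr_wpDr ?sqr_ge0// exprn_gt0// den_re_gt0.
Qed.

Let c2 := cos (b2 * pi).
Let c2_gt0 : 0 < c2. Proof. exact: cos_gt0_strip. Qed.

Let n2_ge x t : 0 <= t <= pi -> (B * expR (b2 * x) * c2) ^+ 2 <= n2 x t.
Proof.
move=> /andP[t0 tp]; rewrite /n2 -[leLHS]addr0 lerD ?sqr_ge0//.
have tT : 0 <= t < Tm by rewrite t0 (le_lt_trans tp).
rewrite lerXn2r// ?nnegrE ?(ltW (den_re_gt0 _ _))//.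
  by rewrite !mulr_ge0 ?expR_ge0// ltW.
rewrite /den_re -[leLHS]add0r lerD//.
  by rewrite mulr_ge0// mulr_ge0 ?expR_ge0// ltW// cos_gt0_strip.
rewrite -mulrA ler_wpM2l ?(ltW B0)// /cexp_re ler_wpM2l ?expR_ge0//.
by apply: cospi_le => //; rewrite t0.
Qed.

(* Squared modulus of the numerator of [Phi]. *)
Let g2 x t := gre x t ^+ 2 + gim x t ^+ 2.

Let PhiE x t : 0 < s2 x t -> Phi_re x t ^+ 2 + Phi_im x t ^+ 2 = g2 x t / s2 x t.
Proof.
move=> s0; rewrite /Phi_re /Phi_im /ire /iim /cinv_re /cinv_im -/(s2 x t).
rewrite /g2; move: (gre x t) (gim x t) => u v.
transitivity ((u ^+ 2 + v ^+ 2) * s2 x t / s2 x t ^+ 2).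
  by rewrite /s2; field; rewrite -/(s2 x t) gt_eqF.
by field; rewrite gt_eqF.
Qed.

Let G0_gt0 : 0 < G0. Proof. by rewrite invr_gt0 ltr_wpDl. Qed.

Let g2_le x t : 0 <= t <= pi ->
  g2 x t <= 2 / (B * expR (b2 * x) * c2) ^+ 2 + 2 * G0 ^+ 2.
Proof.
move=> tp.
have tT : 0 <= t < Tm.
  by case/andP: tp => -> /= tp; rewrite (le_lt_trans tp).
have n0 := n2_gt0 x tT.
have e : (gre x t + G0) ^+ 2 + gim x t ^+ 2 = (n2 x t)^-1.
  rewrite /gre /gim /cinv_re /cinv_im -/(n2 x t) subrK addr0.
  rewrite /n2; field; by rewrite -/(n2 x t) gt_eqF.
have le1 : (n2 x t)^-1 <= ((B * expR (b2 * x) * c2) ^+ 2)^-1.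
  by rewrite lef_pV2 ?n2_ge// posrE ?exprn_gt0// !mulr_gt0 ?expR_gt0.
rewrite /g2; move: (gre x t) (gim x t) e => u v e.
have v0 := sqr_ge0 v.
have : (u + 2 * G0) ^+ 2 >= 0 by rewrite sqr_ge0.
have -> : (u + 2 * G0) ^+ 2 = 2 * (u + G0) ^+ 2 + 2 * G0 ^+ 2 - u ^+ 2 by ring.
move: le1; rewrite -e; move: ((_)^-1) (G0 ^+ 2) (u ^+ 2) (v ^+ 2) v0 ((u + G0) ^+ 2) => *.
lra.
Qed.

(* |e^{b z} - 1|^2 <= e^{|x|} |2 sinh (z / 2)|^2 as soon as |b| <= 1/2. *)
Let exp_sh_le b x t : `|b| <= 2^-1 -> 0 <= t <= pi ->
  (cexp_re b x t - 1) ^+ 2 + cexp_im b x t ^+ 2 <= expR `|x| * s2 x t.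
Proof.
move=> hb /andP[t0 tp].
have e1 : (cexp_re b x t - 1) ^+ 2 + cexp_im b x t ^+ 2 =
    (expR (b * x) - 1) ^+ 2 + 2 * expR (b * x) * (1 - cos (b * t)).
  rewrite /cexp_re /cexp_im.
  have := cos2Dsin2 (b * t); move: (cos _) (sin _) (expR _) => c s e cs.
  rewrite (_ : _ + _ = e ^+ 2 * (c ^+ 2 + s ^+ 2) - 2 * e * c + 1); last by ring.
  by rewrite cs; ring.
rewrite e1 s2E [expR `|x| * _]mulrDr.
have hx : b * x <= `|x| / 2.
  by rewrite (le_trans (ler_norm _))// normrM mulrC ler_wpM2l.
have hx' : - (`|x| / 2) <= b * x.
  by rewrite lerNl (le_trans (ler_norm _))// normrN normrM mulrC ler_wpM2l.
have ebx : expR (b * x) <= expR `|x|.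
  by rewrite ler_expR (le_trans hx)// ler_pdivrMr// ler_peMr// lerDl.
have cc : cos t <= cos (b * t).
  rewrite -[leRHS]cos_norm normrM (ger0_norm t0).
  have : `|b| * t <= t by rewrite ler_piMl//; lra.
  rewrite le_eqVlt => /predU1P[->//|btt].
  apply: ltW; rewrite ltr_cos ?in_itv//= ?t0//=.
  by rewrite mulr_ge0//= (le_trans (ltW btt)).
have ee : (expR (b * x) - 1) ^+ 2 <= (expR (x / 2) - expR (- (x / 2))) ^+ 2.
  have -> : (expR (x / 2) - expR (- (x / 2))) ^+ 2 =
      (expR (`|x| / 2) - expR (- (`|x| / 2))) ^+ 2.
    have [x0|x0] := ger0P x => //; rewrite mulNr opprK; ring.
  have i1 : expR (b * x) <= expR (`|x| / 2) by rewrite ler_expR.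
  have i2 : expR (- (`|x| / 2)) <= expR (b * x) by rewrite ler_expR.
  have i3 : expR (- (`|x| / 2)) <= 1 by rewrite expR_le1 oppr_le0 divr_ge0.
  have i4 : 1 <= expR (`|x| / 2) by rewrite -expR0 ler_expR divr_ge0.
  rewrite -[leLHS]real_normK ?num_real// lerXn2r// ?nnegrE ?subr_ge0 ?(le_trans i3)//.
  by rewrite ler_norml; apply/andP; split; lra.
have x1 : 1 <= expR `|x| by rewrite -expR0 ler_expR.
have e0 := expR_gt0 (b * x).
have c1 := cos_le1 t.
apply: lerD.
  by rewrite (le_trans ee)// ler_peMl// sqr_ge0.
rewrite -mulrA [leRHS]mulrCA ler_wpM2l//.
by rewrite ler_pM ?subr_ge0 ?cos_le1 ?(ltW e0)// lerD2l lerN2.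
Qed.

(* The numerator of [Phi] is [A (1 - e^(b1 z)) + B (1 - e^(b2 z))] over nonvanishing
   factors, and [sinh (z / 2)] dominates each [e^(b z) - 1]: this gives a bound
   uniform up to the removable singularity. *)
Let Phi_bounded L x t : `|x| <= L -> 0 <= t <= pi -> 0 < s2 x t ->
  `|Phi_im x t| <= 1 + (2 * A ^+ 2 + 2 * B ^+ 2) * expR L
     / ((B * expR (- L) * c2) ^+ 2 * (A + B) ^+ 2).
Proof.
move=> xL tp s0.
have tT : 0 <= t < Tm.
  by case/andP: tp => -> /= tp; rewrite (le_lt_trans tp).
have n0 := n2_gt0 x tT.
have AB0 : 0 < A + B by rewrite ltr_wpDl.
set K := (X in _ <= _ + X).
have K0 : 0 <= K.
  apply: divr_ge0; apply: mulr_ge0; rewrite ?sqr_ge0 ?expR_ge0//.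
  by apply: addr_ge0; apply: mulr_ge0; rewrite ?sqr_ge0.
suff : Phi_im x t ^+ 2 <= K.
  move=> h; have : `|Phi_im x t| ^+ 2 <= (1 + K) ^+ 2.
    by rewrite real_normK ?num_real// (le_trans h)//; nra.
  by rewrite ler_pXn2r ?nnegrE//; apply: addr_ge0.
apply: (@le_trans _ _ (g2 x t / s2 x t)).
  by rewrite -PhiE// lerDr sqr_ge0.
rewrite ler_pdivrMr//.
have g2E : g2 x t * (n2 x t * (A + B) ^+ 2) =
  (A * (cexp_re b1 x t - 1) + B * (cexp_re b2 x t - 1)) ^+ 2 +
  (A * cexp_im b1 x t + B * cexp_im b2 x t) ^+ 2.
  have -> : A * (cexp_re b1 x t - 1) + B * (cexp_re b2 x t - 1) =
     den_re x t - (A + B) by rewrite /den_re; ring.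
  rewrite -/(den_im x t) /g2 /gre /gim /cinv_re /cinv_im -/(n2 x t) /G0.
  transitivity ((den_re x t ^+ 2 + den_im x t ^+ 2) / n2 x t * (A + B) ^+ 2
     - 2 * den_re x t * (A + B) + n2 x t).
    by field; rewrite (gt_eqF n0) (gt_eqF AB0).
  rewrite -/(n2 x t) divff ?gt_eqF// /n2; ring.
have le1 := @exp_sh_le b1 x t (ltW hb1) tp.
have le2 := @exp_sh_le b2 x t (ltW hb2) tp.
have le3 : g2 x t * (n2 x t * (A + B) ^+ 2) <=
    (2 * A ^+ 2 + 2 * B ^+ 2) * (expR L * s2 x t).
  rewrite g2E.
  have le4 : expR `|x| * s2 x t <= expR L * s2 x t.
    by rewrite ler_wpM2r ?(ltW s0)// ler_expR.
  apply: (@le_trans _ _ ((2 * A ^+ 2 + 2 * B ^+ 2) * (expR `|x| * s2 x t))).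
    move: le1 le2; set W := expR _ * _.
    move: (cexp_re b1 x t - 1) (cexp_re b2 x t - 1) (cexp_im b1 x t) (cexp_im b2 x t).
    move=> p q p' q' h1 h2.
    apply: (@le_trans _ _ (2 * A ^+ 2 * (p ^+ 2 + p' ^+ 2) + 2 * B ^+ 2 * (q ^+ 2 + q' ^+ 2))).
      rewrite -subr_ge0 (_ : _ - _ = (A * p - B * q) ^+ 2 + (A * p' - B * q') ^+ 2); last by ring.
      by rewrite addr_ge0// sqr_ge0.
    by rewrite [leRHS]mulrDl; apply: lerD; apply: ler_wpM2l => //; rewrite mulr_ge0// sqr_ge0.
  by rewrite ler_wpM2l// addr_ge0// mulr_ge0// sqr_ge0.
have eL : (B * expR (- L) * c2) ^+ 2 <= n2 x t.
  apply: le_trans (n2_ge x tp).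
  rewrite lerXn2r ?nnegrE ?mulr_ge0 ?expR_ge0 ?(ltW B0) ?(ltW c2_gt0)//.
  rewrite ler_wpM2r ?(ltW c2_gt0)// ler_wpM2l ?(ltW B0)// ler_expR.
  rewrite lerNl (le_trans (ler_norm _))// normrN normrM (le_trans _ xL)//.
  by rewrite ler_piMl// (le_trans (ltW hb2))//; lra.
have d0 : 0 < (B * expR (- L) * c2) ^+ 2 * (A + B) ^+ 2.
  by rewrite mulr_gt0 ?exprn_gt0// !mulr_gt0 ?expR_gt0.
rewrite /K mulrAC ler_pdivlMr// -[leRHS]mulrA.
apply: (le_trans _ le3); rewrite ler_wpM2l ?addr_ge0 ?sqr_ge0//.
by rewrite ler_wpM2r// sqr_ge0.
Qed.

(* Integral of [Im Phi] over the segment of height [t]: it tends to 0 with [t],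
   since [Phi] is real on the real line, and its derivative in [t] is the
   difference of [Re Phi] on the two vertical sides. *)
Let J L t := \int[mu]_(x in `[- L, L]) Phi_im x t.

(* On the vertical sides the denominator decays at most like [e^(- |b2| L)] while
   [sinh (z / 2)] grows like [e^(L / 2)]. *)
Let Phi_reL_le L x t : 1 <= L -> `|x| = L -> 0 <= t <= pi ->
  `|Phi_re x t| <=
  (1 + (8 / (B * c2) ^+ 2 + 8 * G0 ^+ 2)) * expR (- ((2^-1 - `|b2|) * L)).
Proof.
move=> L1 xL tp.
have L0 : 0 < L by rewrite (lt_le_trans _ L1).
set K1 := _ + 8 * _; set g := 2^-1 - _.
have K10 : 0 <= K1 by apply: addr_ge0; [apply: divr_ge0|apply: mulr_ge0]; rewrite ?sqr_ge0.
have eL2 : 2 <= expR L by have := expR_ge1Dx L; lra.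
have s2L : expR L / 4 <= s2 x t.
  rewrite s2E -[leLHS]addr0 lerD ?mulr_ge0 ?subr_ge0 ?cos_le1//.
  have -> : (expR (x / 2) - expR (- (x / 2))) ^+ 2 =
      (expR (L / 2) - expR (- (L / 2))) ^+ 2.
    by rewrite -xL; have [x0|x0] := ger0P x => //; rewrite mulNr opprK; ring.
  have e2 : expR L = expR (L / 2) ^+ 2 by rewrite -expRM_natl mulrC divfK.
  have := expRxMexpNx_1 (L / 2); rewrite e2 in eL2 *.
  have f0 := expR_gt0 (- (L / 2)).
  move: (expR (L / 2)) (expR (- (L / 2))) (expR_gt0 (L / 2)) f0 eL2 => e f e0 f0 eL2 ef.
  have fe : 2 * f <= e by nra.
  nra.
have s20 : 0 < s2 x t by rewrite (lt_le_trans _ s2L)// divr_gt0 ?expR_gt0.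
suff : Phi_re x t ^+ 2 <= K1 * expR (- (g * L)) ^+ 2.
  move=> h; have : `|Phi_re x t| ^+ 2 <= ((1 + K1) * expR (- (g * L))) ^+ 2.
    rewrite real_normK ?num_real// (le_trans h)// exprMn ler_wpM2r ?sqr_ge0//.
    by nra.
  by rewrite ler_pXn2r ?nnegrE//; rewrite mulr_ge0 ?expR_ge0// addr_ge0.
apply: (@le_trans _ _ (g2 x t / s2 x t)).
  by rewrite -PhiE// lerDl sqr_ge0.
rewrite ler_pdivrMr//; apply: (le_trans (g2_le x tp)).
apply: (@le_trans _ _ (K1 * expR (- (g * L)) ^+ 2 * (expR L / 4))); last first.
  by rewrite ler_wpM2l// mulr_ge0// sqr_ge0.
have -> : expR (- (g * L)) ^+ 2 = expR (`|b2| * L) ^+ 2 / expR L.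
  by rewrite -2!expRM_natl -expRB; congr expR; rewrite /g; field.
have eB : expR (- (`|b2| * L)) <= expR (b2 * x).
  by rewrite ler_expR lerNl (le_trans (ler_norm _))// normrN normrM xL.
have e1 : 1 <= expR (`|b2| * L) by rewrite -expR0 ler_expR mulr_ge0// ltW.
have -> : K1 * (expR (`|b2| * L) ^+ 2 / expR L) * (expR L / 4) =
   2 / (B * expR (- (`|b2| * L)) * c2) ^+ 2 + 2 * G0 ^+ 2 * expR (`|b2| * L) ^+ 2.
  rewrite /K1 [expR (- _)]expRN; field.
  by rewrite !gt_eqF ?expR_gt0.
apply: lerD.
  rewrite ler_wpM2l// lef_pV2 ?posrE ?exprn_gt0 ?mulr_gt0 ?expR_gt0//.
  rewrite lerXn2r ?nnegrE ?mulr_ge0 ?expR_ge0 ?(ltW B0) ?(ltW c2_gt0)//.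
  by rewrite ler_wpM2r ?(ltW c2_gt0)// ler_wpM2l ?(ltW B0).
apply: ler_peMr; first by rewrite mulr_ge0// sqr_ge0.
by rewrite exprn_ege1.
Qed.

Let Phi_im0 x : Phi_im x 0 = 0.
Proof.
have d0 : den_im x 0 = 0 by rewrite /den_im /cexp_im !mulr0 sin0 !mulr0 addr0.
have s0 : sh_im x 0 = 0 by rewrite /sh_im /cexp_im !mulr0 sin0 !mulr0 addr0.
by rewrite /Phi_im /gim /iim /cinv_im d0 s0 oppr0 !mul0r mulr0 !add0r mul0r.
Qed.

Let cvg_J0 L : 0 < L -> J L (pi / n.+1%:R) @[n --> \oo] --> 0.
Proof.
move=> L0.
have tn n : 0 < (pi : R) / n.+1%:R by rewrite divr_gt0 ?pi_gt0.
have tn1 n : (pi : R) / n.+1%:R <= pi.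
  by rewrite ler_pdivrMr// ler_peMr ?pi_ge0// ler1n.
have tnT n : (0 : R) <= pi / n.+1%:R < Tm.
  by rewrite (ltW (tn n)) (le_lt_trans (tn1 n)).
have [P' [Q' H]] := holo_Phi.
have s2n x t : 0 < t < Tm -> s2 x t != 0.
  move=> /andP[t0 tT]; rewrite gt_eqF// s2_gt0//; last by right.
  by rewrite (ltW t0) (lt_le_trans tT).
have mPhi n : measurable_fun `[- L, L] (fun x => Phi_im x (pi / n.+1%:R)).
  apply: subspace_continuous_measurable_fun => //.
  apply: continuous_in_subspaceT => x _; apply: continuous_slice1.
  by apply: (holo_cQ (H _ _ _ _)); [rewrite gt_eqF ?n2_gt0|apply: s2n; case/andP: (tnT n) => _ ->; rewrite tn].
pose K := 1 + (2 * A ^+ 2 + 2 * B ^+ 2) * expR L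
     / ((B * expR (- L) * c2) ^+ 2 * (A + B) ^+ 2).
have : (\int[mu]_(x in `[(- L)%R, L]) (Phi_im x (pi / n.+1%:R)%R)%:E)%E @[n --> \oo] -->
    (\int[mu]_(x in `[(- L)%R, L]) cst 0 x)%E.
  have [] // := @dominated_convergence _ _ R mu `[- L, L] _
    (fun n x => (Phi_im x (pi / n.+1%:R))%:E) (cst 0) (fun=> K%:E).
  - by move=> n; apply/measurable_EFinP; exact: mPhi.
  - exists [set 0]; split; [by []|exact: lebesgue_measure_set1|].
    move=> x /= /not_implyP[xL]; apply: contra_notP => /eqP x0.
    apply/fine_cvgP; split; [by apply: nearW|].
    have c : {for 0, continuous (Phi_im x)}.
      apply: continuous_slice2; apply: (holo_cQ (H _ _ _ _)).
        by rewrite gt_eqF ?n2_gt0// lexx (lt_trans (pi_gt0 _) pi_lt_Tm).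
      by rewrite gt_eqF// s2_gt0//; [rewrite lexx mulrn_wgt0 ?pi_gt0|left].
    rewrite -[X in _ --> X](Phi_im0 x); apply: (@cvg_comp _ _ _ (fun n => pi / n.+1%:R) (Phi_im x) _ (nbhs (0 : R))) c.
    have : pi * harmonic n @[n --> \oo] --> (pi : R) * 0.
      by apply: cvgM; [exact: cvg_cst|exact: cvg_harmonic].
    by rewrite mulr0.
  - apply: (@continuous_compact_integrable _ (fun=> K)); first exact: segment_compact.
    exact: continuous_subspaceT (@cst_continuous _ _ _).
  - apply: aeW => x n; rewrite /= in_itv/= => xL; rewrite lee_fin.
    apply: Phi_bounded; first by rewrite ler_norml.
      by rewrite (ltW (tn n)) tn1.
    rewrite s2_gt0//; last by right.
    by case/andP: (tnT n) => -> /lt_le_trans ->.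
rewrite integral0 => /fine_cvg; exact.
Qed.

(* The mean value theorem is applied on [[pi / (n + 2), pi]], away from the
   singular point on the real line, and [n] then goes to infinity. *)
Let J_le L : 1 <= L -> `|J L pi| <= 2 * pi *
  ((1 + (8 / (B * c2) ^+ 2 + 8 * G0 ^+ 2)) * expR (- ((2^-1 - `|b2|) * L))).
Proof.
move=> L1; set W := (X in _ <= _ * X).
have L0 : 0 < L by rewrite (lt_le_trans _ L1).
have [P' [Q' H]] := holo_Phi.
have dJ t : 0 < t < Tm -> is_derive t 1 (J L) (Phi_re L t - Phi_re (- L) t).
  move=> tT.
  have NL : - L < L by rewrite gtrN.
  have HL x s : - L <= x <= L -> 0 < s < Tm -> holo Phi_re Phi_im P' Q' x s.
    move=> xL /andP[s0 sT]; apply: H.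
      by rewrite gt_eqF// n2_gt0// (ltW s0).
    by rewrite gt_eqF// s2_gt0//; [rewrite (ltW s0) (lt_le_trans sT)|right].
  exact: (holo_integral_derive NL tT HL).
have step n : `|J L pi| <= `|J L (pi / n.+2%:R)| + 2 * pi * W.
  pose t0 : R := pi / n.+2%:R.
  have t00 : 0 < t0 by rewrite divr_gt0 ?pi_gt0.
  have t0p : t0 < pi by rewrite /t0 ltr_pdivrMr// ltr_pMr ?pi_gt0// ltr1n.
  have [|| c] := @MVT _ (J L) (fun t => Phi_re L t - Phi_re (- L) t) _ _ t0p.
  - move=> t; rewrite in_itv/= => /andP[t1 t2]; apply: dJ.
    by rewrite (lt_trans t00)//= (lt_trans t2).
  - apply: continuous_in_subspaceT => t /set_mem/=; rewrite in_itv/= => /andP[t1 t2].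
    apply: differentiable_continuous; apply/derivable1_diffP.
    by have [|] := dJ t; rewrite ?(lt_le_trans t00)//= ?(le_lt_trans t2).
  rewrite in_itv/= => /andP[c1' c2'] e.
  have cp : 0 <= c <= pi by rewrite (ltW (lt_trans t00 c1')) ltW.
  have -> : J L pi = J L t0 + (Phi_re L c - Phi_re (- L) c) * (pi - t0) by rewrite -e; ring.
  rewrite (le_trans (ler_normD _ _))// lerD2l normrM.
  have h1 : `|Phi_re L c| <= W by apply: Phi_reL_le => //; rewrite gtr0_norm.
  have h2 : `|Phi_re (- L) c| <= W by apply: Phi_reL_le => //; rewrite normrN gtr0_norm.
  have h3 : `|Phi_re L c - Phi_re (- L) c| <= 2 * W.
    by rewrite (le_trans (ler_normB _ _))// mulr_natl mulr2n lerD.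
  rewrite mulrAC; apply: ler_pM => //.
  by rewrite ger0_norm; lra.
have cJ : `|J L (pi / n.+2%:R)| @[n --> \oo] --> (0 : R).
  rewrite (cvg_shiftS (fun n => `|J L (pi / n.+1%:R)|)).
  have h : `|J L (pi / n.+1%:R)| @[n --> \oo] --> `|0 : R|.
    by apply: (cvg_comp _ _ (cvg_J0 L0)); exact: norm_continuous.
  by rewrite normr0 in h.
have cJW : `|J L (pi / n.+2%:R)| + 2 * pi * W @[n --> \oo] --> 0 + 2 * pi * W.
  by apply: cvgD => //; exact: cvg_cst.
rewrite -[leRHS]add0r.
apply: (ler_cvg_to (@cvg_cst _ `|J L pi| _ \oo _) cJW).
by apply: nearW => n; exact: step.
Qed.

(** Boundary values at height [pi]: there [2 sinh (z / 2)] equals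
    [2 i cosh (x / 2)], hence the weight [1 / (2 cosh (x / 2))]. *)
Definition hpi (x : R) := cinv_re den_re den_im x pi.
Definition sech2 (x : R) := (expR (x / 2) + expR (- (x / 2)))^-1.

Let PhipiE x : Phi_im x pi = - ((hpi x - G0) * sech2 x).
Proof.
rewrite /Phi_im /ire /iim /cinv_re /cinv_im.
have sr : sh_re x pi = 0.
  have cp : cos (2^-1 * pi) = 0 :> R by rewrite mulrC cos_pihalf.
  by rewrite /sh_re /cexp_re [- _ * pi]mulNr cosN cp !mulr0 addr0.
have si : sh_im x pi = expR (x / 2) + expR (- (x / 2)).
  have sp : sin (2^-1 * pi) = 1 :> R by rewrite mulrC sin_pihalf.
  rewrite /sh_im /cexp_im [- _ * pi]mulNr sinN sp [- _ * x]mulNr [2^-1 * x]mulrC.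
  ring.
rewrite sr si mul0r mulr0 addr0 expr0n add0r /sech2 -/(hpi x - G0).
have : 0 < expR (x / 2) + expR (- (x / 2)) by rewrite addr_gt0 ?expR_gt0.
rewrite -[gre x pi]/(hpi x - G0).
move: (hpi x - G0) (_ + _) => g e e0; field.
by rewrite gt_eqF.
Qed.

Lemma sech2_gt0 x : 0 < sech2 x.
Proof. by rewrite invr_gt0 addr_gt0 ?expR_gt0. Qed.

Lemma continuous_sech2 : continuous sech2.
Proof.
move=> x.
have c : {for x, continuous (fun x : R => expR (x / 2) + expR (- (x / 2)))}.
  apply: continuousD.
    apply: continuous_expR_comp.
    by apply: continuousM; [exact: cvg_id|exact: cst_continuous].
  apply: continuous_expR_comp.
  by apply: continuousN; apply: continuousM; [exact: cvg_id|exact: cst_continuous].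
by apply: (continuousV _ c); rewrite gt_eqF// addr_gt0 ?expR_gt0.
Qed.

Let integral_sech2 L : 0 < L -> \int[mu]_(x in `[- L, L]) sech2 x =
  2 * atan (expR (L / 2)) - 2 * atan (expR (- (L / 2))).
Proof.
move=> L0; rewrite -mulNr.
have dF (x : R) : is_derive x (1 : R) (fun x : R => 2 * atan (expR (x / 2))) (sech2 x).
  have d1 : is_derive x (1 : R) (fun x : R => x / 2) (2^-1).
    by apply: is_derive_eq; rewrite /GRing.scale /=; ring.
  have d2 : is_derive x (1 : R) (fun x : R => expR (x / 2)) (2^-1 * expR (x / 2)).
    by apply: is_derive_eq; rewrite /GRing.scale /= mulrC.
  apply: is_derive_eq; rewrite /GRing.scale /= /sech2 expRN.
  have := expR_gt0 (x / 2); move: (expR _) => e e0; field.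
  by rewrite gt_eqF ?gt_eqF//; nra.
rewrite /Rintegral (@continuous_FTC2 _ _ (fun x : R => 2 * atan (expR (x / 2)))).
- by rewrite /= mulNr mulNr.
- by rewrite gtrN.
- by apply: continuous_subspaceT; exact: continuous_sech2.
- have cF x : {for x, continuous (fun x : R => 2 * atan (expR (x / 2)))}.
    apply: differentiable_continuous; apply/derivable1_diffP.
    by have [] := dF x.
  split.
  + by move=> x _; have [] := dF x.
  + by apply: cvg_at_right_filter; exact: cF.
  + by apply: cvg_at_left_filter; exact: cF.
- by move=> x _; rewrite derive1E; have [] := dF x.
Qed.

Lemma continuous_hpi : continuous hpi.
Proof.
move=> x; apply: (@continuous_slice1 _ (cinv_re den_re den_im)).
have hd := holo_add (holo_scale A (holo_exp b1 x pi)) (holo_scale B (holo_exp b2 x pi)).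
apply: (holo_cP (holo_inv hd _)).
by rewrite gt_eqF// (n2_gt0 x pipi).
Qed.

Lemma hpi_gt0 x : 0 < hpi x.
Proof. by rewrite /hpi /cinv_re divr_gt0 ?den_re_gt0 ?n2_gt0. Qed.

Lemma cos_pi_gt0 : 0 < cos (b2 * pi). Proof. exact: c2_gt0. Qed.

Lemma hpi_le x : expR (b2 * x) * hpi x <= (B * cos (b2 * pi))^-1.
Proof.
have d0 := den_re_gt0 x pipi.
have le1 : B * expR (b2 * x) * c2 <= den_re x pi.
  rewrite /den_re -[leLHS]add0r lerD//; last by rewrite /cexp_re mulrA.
  by rewrite mulr_ge0// mulr_ge0 ?expR_ge0// ltW// cos_gt0_strip.
have le2 : hpi x <= (den_re x pi)^-1.
  rewrite /hpi /cinv_re ler_pdivrMr ?n2_gt0// ler_pdivlMl//.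
  by rewrite -expr2 lerDl sqr_ge0.
rewrite (@le_trans _ _ (expR (b2 * x) / (B * expR (b2 * x) * c2)))//.
  rewrite ler_wpM2l ?expR_ge0// (le_trans le2)// lef_pV2 ?posrE//.
  by rewrite !mulr_gt0 ?expR_gt0.
rewrite le_eqVlt; apply/orP; left; apply/eqP; rewrite /c2; field.
by rewrite !gt_eqF ?expR_gt0// c2_gt0.
Qed.

(** What remains of the boundary value once [e^(- b2 x)] is taken out.  It
    depends on [x] only through [E = e^((b1 - b2) x)], which vanishes at minus
    infinity when [b2 < b1]; this gives the limit of the spectral density. *)
Definition edge_ratio (E : R) :=
  (A * E * cos (b1 * pi) + B * cos (b2 * pi)) /
  ((A * E * cos (b1 * pi) + B * cos (b2 * pi)) ^+ 2 +
   (A * E * sin (b1 * pi) + B * sin (b2 * pi)) ^+ 2).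

Lemma hpiE x : expR (b2 * x) * hpi x = edge_ratio (expR ((b1 - b2) * x)).
Proof.
have d0 := n2_gt0 x pipi; move: d0.
rewrite /edge_ratio /hpi /cinv_re /n2 /den_re /den_im /cexp_re /cexp_im.
have -> : expR (b1 * x) = expR ((b1 - b2) * x) * expR (b2 * x).
  by rewrite -expRD; congr expR; ring.
have := expR_gt0 (b2 * x).
move: (expR (b2 * x)) (expR ((b1 - b2) * x)) => e E e0.
pose X := A * E * cos (b1 * pi) + B * cos (b2 * pi).
pose Y := A * E * sin (b1 * pi) + B * sin (b2 * pi).
rewrite -/X -/Y.
have -> : A * (E * e * cos (b1 * pi)) + B * (e * cos (b2 * pi)) = e * X.
  by rewrite /X; ring.
have -> : A * (E * e * sin (b1 * pi)) + B * (e * sin (b2 * pi)) = e * Y.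
  by rewrite /Y; ring.
move=> h; have h' : X ^+ 2 + Y ^+ 2 != 0.
  by apply/eqP => h0; move: h; rewrite !exprMn -mulrDr h0 mulr0 ltxx.
by field; rewrite h' gt_eqF//= !exprMn -mulrDr mulf_neq0// expf_neq0// gt_eqF.
Qed.

Lemma edge_ratio0 : edge_ratio 0 = cos (b2 * pi) / B.
Proof.
rewrite /edge_ratio !mulr0 !mul0r !add0r !exprMn -mulrDr cos2Dsin2 mulr1.
by field; rewrite gt_eqF.
Qed.

Lemma edge_ratio_continuous0 : {for 0, continuous edge_ratio}.
Proof.
have cl (u v : R) : {for 0, continuous (fun E => A * E * u + B * v)}.
  apply: continuousD; last exact: cst_continuous.
  apply: continuousM; last exact: cst_continuous.
  by apply: continuousM; [exact: cst_continuous|exact: cvg_id].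
apply: continuousM; first exact: cl.
apply: continuousV; last by apply: continuousD; apply: continuousX; exact: cl.
rewrite !mulr0 !mul0r !add0r !exprMn -mulrDr cos2Dsin2 mulr1.
by rewrite expf_neq0// gt_eqF.
Qed.

(** At height [pi] the imaginary part of [Phi] is
    [- (hpi - 1 / (A + B)) / (2 cosh (x / 2))].  Its integral over [[- L, L]] tends
    to 0 as [L] grows, so [hpi] has the same integral against the weight as the
    constant [1 / (A + B)], and the weight has total mass [pi]. *)
Lemma strip_mean_value :
  (\int[mu]_x (hpi x * sech2 x)%:E)%E = (pi / (A + B))%:E.
Proof.
pose F n := `[- n.+1%:R, n.+1%:R]%classic : set R.
have cs : continuous (fun x => hpi x * sech2 x).
  by move=> x; apply: continuousM; [exact: continuous_hpi|exact: continuous_sech2].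
have FT : \bigcup_n F n = setT.
  rewrite -subTset => x _; exists (Num.truncn `|x|) => //=.
  by rewrite /F/= in_itv/= -ler_norml ltW// truncnS_gt.
have mhs D : measurable D -> measurable_fun D (fun x => (hpi x * sech2 x)%:E).
  move=> mD; apply/measurable_EFinP; apply: measurable_funTS.
  exact: continuous_measurable_fun.
have lim1 : (\int[mu]_(x in F n) (hpi x * sech2 x)%:E)%E @[n --> \oo] -->
    (\int[mu]_x (hpi x * sech2 x)%:E)%E.
  rewrite -FT; apply: ge0_nondecreasing_set_cvg_integral.
  - move=> m n mn; apply/subsetPset => x; rewrite /F/= !in_itv/= => /andP[x1 x2].
    have mn' : m.+1%:R <= n.+1%:R :> R by rewrite ler_nat.
    by rewrite (le_trans x2)// (le_trans _ x1)// lerN2.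
  - by move=> n; exact: measurable_itv.
  - by move=> n; apply: mhs; exact: measurable_itv.
  - by move=> n x _; rewrite lee_fin ltW// mulr_gt0 ?hpi_gt0 ?sech2_gt0.
have intc (f : R -> R) n : continuous f -> mu.-integrable (F n) (EFin \o f).
  move=> cf; apply: continuous_compact_integrable; first exact: segment_compact.
  exact: continuous_subspaceT.
pose a n : R := G0 * (2 * atan (expR (n.+1%:R / 2)) - 2 * atan (expR (- (n.+1%:R / 2)))).
have eqn n : (\int[mu]_(x in F n) (hpi x * sech2 x)%:E)%E = (a n - J n.+1%:R pi)%:E.
  rewrite -[LHS]fineK; last first.
    by apply: integrable_fin_num; [exact: measurable_itv|exact: (intc _ _ cs)].
  congr EFin; rewrite -[LHS]/(\int[mu]_(x in F n) (hpi x * sech2 x)).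
  have -> : J n.+1%:R pi = \int[mu]_(x in F n) (G0 * sech2 x - hpi x * sech2 x).
    by apply: eq_Rintegral => x _; rewrite PhipiE; ring.
  have cg : continuous (fun x => G0 * sech2 x).
    by move=> x; apply: (@continuousM _ _ (fun=> G0) sech2 x); [exact: cst_continuous|exact: continuous_sech2].
  rewrite RintegralB; [|exact: measurable_itv|exact: (intc _ _ cg)|exact: (intc _ _ cs)].
  rewrite RintegralZl; [|exact: measurable_itv|exact: (intc _ _ continuous_sech2)].
  by rewrite integral_sech2// -/(a n); ring.
have limc (c : R) : 0 < c -> (c * n.+1%:R) @[n --> \oo] --> +oo%R.
  move=> c0; apply/cvgryPge => M; near=> n.
  rewrite -ler_pdivrMl// (@le_trans _ _ n%:R) ?ler_nat//.
  by near: n; exact: nbhs_infty_ger.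
have lime (c : R) : 0 < c -> expR (- (c * n.+1%:R)) @[n --> \oo] --> 0.
  by move=> c0; exact: (cvg_comp _ _ (limc c c0) (@cvgr_expR R)).
have lim2 : a n @[n --> \oo] --> G0 * pi.
  have -> : G0 * pi = G0 * (2 * (pi / 2) - 2 * atan 0) by rewrite atan0; field.
  have half0 : 0 < 2^-1 :> R by [].
  have ca : atan (expR (- (n.+1%:R / 2))) @[n --> \oo] --> atan (0 : R).
    have h : expR (- (n.+1%:R / 2)) @[n --> \oo] --> (0 : R).
      rewrite (_ : (fun n => _) = (fun n => expR (- (2^-1 * n.+1%:R)))); last first.
        by apply/funext => n; rewrite mulrC.
      exact: lime.
    exact: (cvg_comp _ _ h (@continuous_atan R 0)).
  have cb : atan (expR (n.+1%:R / 2)) @[n --> \oo] --> (pi / 2 : R).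
    apply: (cvg_comp _ _ _ (@cvgy_atan R)).
    apply/cvgryPge => M; near=> n.
    rewrite (@le_trans _ _ (2^-1 * n.+1%:R))//.
      by near: n; have /cvgryPge := limc _ half0; exact.
    by rewrite mulrC (le_trans _ (expR_ge1Dx _))// lerDr.
  apply: cvgM; first exact: cvg_cst.
  apply: cvgB; last by apply: cvgM => //; exact: cvg_cst.
  by apply: cvgM => //; exact: cvg_cst.
have lim3 : J n.+1%:R pi @[n --> \oo] --> 0.
  have g0 : 0 < 2^-1 - `|b2| by rewrite subr_gt0.
  apply: norm_cvg0.
  pose K : R := 2 * pi * (1 + (8 / (B * c2) ^+ 2 + 8 * G0 ^+ 2)).
  apply: (@squeeze_cvgr _ _ _ _ (cst 0) (fun n => K * expR (- ((2^-1 - `|b2|) * n.+1%:R)))).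
  - by apply: nearW => n; rewrite normr_ge0/= -mulrA J_le// ler1n.
  - exact: cvg_cst.
  - by rewrite -(mulr0 K); apply: cvgM; [exact: cvg_cst|exact: lime].
have lim4 : (a n - J n.+1%:R pi)%:E @[n --> \oo] --> (pi / (A + B))%:E.
  apply: cvg_EFin; first by apply: nearW.
  rewrite [pi / _]mulrC -[_ * pi]subr0.
  exact: cvgB.
rewrite (funext eqn) in lim1.
exact: (cvg_unique _ lim1 lim4).
Unshelve. all: by end_near. Qed.

End strip.

(** * Laplace transforms of spectral densities *)

Section weighted_laplace.
Context {R : realType}.
Notation mu := (@lebesgue_measure R).
Variables (p : R -> R) (K : R).
Hypotheses (cp : continuous p) (p_gt0 : forall x, 0 < p x).
Hypothesis p_le : forall x, p x <= K.

Let K_ge0 : 0 <= K. Proof. exact: le_trans (ltW (p_gt0 0)) (p_le 0). Qed.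

(** In the spectral variable [y = e^x] this is [e^(- y t) y^c], to be integrated
    against [p dy / y]. *)
Definition lap_kernel (c t x : R) := expR (- (expR x * t)) * expR (c * x).

Definition spec_laplace (c t : R) := \int[mu]_x (lap_kernel c t x * p x).

Lemma continuous_lap_kernel c t : continuous (lap_kernel c t).
Proof.
move=> x.
have h1 : {for x, continuous (fun x => expR (- (expR x * t)))}.
  apply: continuous_expR_comp; apply: continuousN; apply: continuousM.
    exact: continuous_expR.
  exact: cst_continuous.
have h2 : {for x, continuous (fun x => expR (c * x))}.
  by apply: continuous_expR_comp; apply: continuousM; [exact: cst_continuous|exact: cvg_id].
exact: (continuousM h1 h2).
Qed.

Lemma lap_kernel_gt0 c t x : 0 < lap_kernel c t x.
Proof. by rewrite mulr_gt0 ?expR_gt0. Qed.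

Lemma integrable_lap_kernel c t : 0 < c <= 3 -> 0 < t ->
  mu.-integrable setT (EFin \o lap_kernel c t).
Proof.
move=> /andP[c0 c3] t0.
pose r := Num.min c 1.
have r0 : 0 < r by rewrite lt_min c0/=.
pose K' := 1 + 24 / t ^+ 4.
have K0 : 0 <= K' by rewrite addr_ge0// divr_ge0// exprn_ge0// ltW.
apply: (@le_integrable _ _ _ mu setT measurableT _
  (fun x => (K'%:E * (expR (- (r * `|x|)))%:E)%E)) => //.
- by apply/measurable_EFinP; apply: continuous_measurable_fun; exact: continuous_lap_kernel.
- move=> x _; rewrite /= lee_fin.
  rewrite ger0_norm ?(ltW (lap_kernel_gt0 _ _ _))// ger0_norm ?mulr_ge0 ?expR_ge0//.
  rewrite /lap_kernel; have [x0|x0] := leP 0 x.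
    rewrite ger0_norm//.
    have e1 : expR (- (expR x * t)) <= 24 / t ^+ 4 * expR (- (4 * x)).
      rewrite expRN.
      have q0 : 0 < expR x * t by rewrite mulr_gt0 ?expR_gt0.
      (* The fourth Taylor term of the exponential beats every [e^(c x)], [c <= 3]. *)
      have := expR_ge1Dxn 3 (ltW q0); rewrite (_ : 4`!%:R = 24)// => h.
      have p4 : 0 < (expR x * t) ^+ 4 / 24 by rewrite divr_gt0// exprn_gt0.
      apply: (@le_trans _ _ ((expR x * t) ^+ 4 / 24)^-1).
        by rewrite lef_pV2 ?posrE ?expR_gt0// (le_trans _ h)// lerDr.
      rewrite le_eqVlt; apply/orP; left; apply/eqP.
      rewrite expRN expRM_natl; field.
      by rewrite !gt_eqF ?expR_gt0.
    apply: (@le_trans _ _ (24 / t ^+ 4 * expR (- (4 * x)) * expR (c * x))).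
      by rewrite ler_wpM2r ?expR_ge0.
    rewrite -mulrA -expRD ler_pM ?expR_ge0//.
    - by rewrite divr_ge0// exprn_ge0// ltW.
    - by rewrite /K' lerDr.
    - rewrite ler_expR.
      have h1 : c * x <= 3 * x by rewrite ler_wpM2r.
      have h2 : r * x <= 1 * x by rewrite ler_wpM2r// ge_min lexx orbT.
      lra.
  rewrite ltr0_norm// mulrN opprK ler_pM ?expR_ge0//.
  - rewrite /K' (@le_trans _ _ 1)//.
      by rewrite expR_le1 oppr_le0 mulr_ge0 ?expR_ge0// ltW.
    by rewrite lerDl divr_ge0// exprn_ge0// ltW.
  - rewrite ler_expR.
    have rc : r <= c by rewrite ge_min lexx.
    by rewrite ler_wnM2r// ltW.
- by apply: integrableZl => //; exact: integrable_expR_abs.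
Qed.

Lemma integrable_spec c t : 0 < c <= 3 -> 0 < t ->
  mu.-integrable setT (EFin \o (fun x => lap_kernel c t x * p x)).
Proof.
move=> c03 t0.
apply: (@le_integrable _ _ _ mu setT measurableT _
  (fun x => (K%:E * (lap_kernel c t x)%:E)%E)) => //.
- apply/measurable_EFinP; apply: continuous_measurable_fun => x.
  exact: (continuousM (@continuous_lap_kernel c t x) (@cp x)).
- move=> x _; rewrite /= lee_fin mulrC.
  have l0 := lap_kernel_gt0 c t x; have p0 := p_gt0 x.
  rewrite (ger0_norm (mulr_ge0 (ltW p0) (ltW l0))).
  rewrite (ger0_norm (mulr_ge0 K_ge0 (ltW l0))).
  by rewrite ler_wpM2r ?p_le ?(ltW l0).
- exact: (integrableZl measurableT K (integrable_lap_kernel c03 t0)).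
Qed.

Lemma spec_laplace_fin c t : 0 < c <= 3 -> 0 < t ->
  (\int[mu]_x (lap_kernel c t x * p x)%:E)%E = (spec_laplace c t)%:E.
Proof.
move=> c03 t0; rewrite /spec_laplace /Rintegral fineK//.
by apply: integrable_fin_num => //; exact: integrable_spec.
Qed.

Lemma spec_laplace_gt0 c t : 0 < c <= 3 -> 0 < t -> 0 < spec_laplace c t.
Proof.
move=> c03 t0; rewrite -lte_fin -spec_laplace_fin//; apply: integral_gt0 => //.
- exact: (measurable_int _ (integrable_spec c03 t0)).
- by move=> x _; rewrite lte_fin mulr_gt0 ?lap_kernel_gt0 ?p_gt0.
- exact: lebesgue_measure_setT_gt0.
Qed.

Lemma spec_laplace_le c s t : 0 < c <= 3 -> 0 < s -> s <= t ->
  spec_laplace c t <= spec_laplace c s.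
Proof.
move=> c03 s0 st; have t0 := lt_le_trans s0 st.
apply: le_Rintegral => //; [exact: integrable_spec|exact: integrable_spec|].
move=> x _; rewrite ler_wpM2r ?(ltW (p_gt0 _))// ler_wpM2r ?expR_ge0//.
by rewrite ler_expR lerN2 ler_wpM2l ?expR_ge0.
Qed.

(** The elementary inequalities [y <= e^y - 1 <= y e^y], integrated: a mean value
    theorem for the transform, whose derivative has exponent [c + 1]. *)
Lemma spec_laplace_diff c x y : 0 < c <= 2 -> 0 <= x -> x < y ->
  x * spec_laplace (c + 1) y <= spec_laplace c (y - x) - spec_laplace c y
    <= x * spec_laplace (c + 1) (y - x).
Proof.
move=> /andP[c0 c2] x0 xy.
have y0 : 0 < y by rewrite (le_lt_trans x0).
have yx0 : 0 < y - x by rewrite subr_gt0.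
have c3 : 0 < c <= 3 by rewrite c0; lra.
have c13 : 0 < c + 1 <= 3 by apply/andP; split; lra.
have i1 := integrable_spec c3 y0; have i2 := integrable_spec c3 yx0.
have i3 := integrable_spec c13 y0; have i4 := integrable_spec c13 yx0.
rewrite /spec_laplace -RintegralB// -!RintegralZl//.
have iB : mu.-integrable setT (EFin \o (fun z => lap_kernel c (y - x) z * p z
    - lap_kernel c y z * p z)) by exact: (integrableB measurableT i2 i1).
have iZ1 : mu.-integrable setT (EFin \o (fun z => x * (lap_kernel (c + 1) y z * p z))).
  exact: (integrableZl measurableT x i3).
have iZ2 : mu.-integrable setT (EFin \o (fun z => x * (lap_kernel (c + 1) (y - x) z * p z))).
  exact: (integrableZl measurableT x i4).
have key z : x * lap_kernel (c + 1) y z <= lap_kernel c (y - x) z - lap_kernel c y z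
    <= x * lap_kernel (c + 1) (y - x) z.
  rewrite /lap_kernel mulrDl mul1r expRD.
  have e : expR (- (expR z * (y - x))) = expR (- (expR z * y)) * expR (expR z * x).
    by rewrite -expRD; congr expR; ring.
  have e' : expR (- (expR z * y)) = expR (- (expR z * (y - x))) * expR (- (expR z * x)).
    by rewrite -expRD; congr expR; ring.
  have q0 : 0 <= expR (c * z) by exact: expR_ge0.
  apply/andP; split.
    rewrite e.
    have h := expR_ge1Dx (expR z * x).
    rewrite (_ : x * _ = expR (- (expR z * y)) * expR (c * z) * (expR z * x)); last by ring.
    rewrite (_ : _ - _ = expR (- (expR z * y)) * expR (c * z) * (expR (expR z * x) - 1)); last by ring.
    by rewrite ler_wpM2l ?mulr_ge0 ?expR_ge0//; lra.
  rewrite e'.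
  have h := expR_ge1Dx (- (expR z * x)).
  rewrite (_ : x * _ = expR (- (expR z * (y - x))) * expR (c * z) * (expR z * x)); last by ring.
  rewrite (_ : _ - _ = expR (- (expR z * (y - x))) * expR (c * z) * (1 - expR (- (expR z * x)))); last by ring.
  by rewrite ler_wpM2l ?mulr_ge0 ?expR_ge0//; lra.
apply/andP; split; apply: le_Rintegral => // z _.
  rewrite mulrA -mulrBl ler_wpM2r ?(ltW (p_gt0 _))//.
  by case/andP: (key z).
rewrite mulrA -mulrBl ler_wpM2r ?(ltW (p_gt0 _))//.
by case/andP: (key z).
Qed.

(** Euler's Gamma function, in the variable [e^x]. *)
Definition Gam c := \int[mu]_x lap_kernel c 1 x.

Lemma Gam_gt0 c : 0 < c <= 3 -> 0 < Gam c.
Proof.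
move=> c03; have i := integrable_lap_kernel c03 ltr01.
rewrite -lte_fin /Gam /Rintegral fineK; last exact: integrable_fin_num.
apply: integral_gt0 => //.
- exact: (measurable_int _ i).
- by move=> x _; rewrite lte_fin lap_kernel_gt0.
- exact: lebesgue_measure_setT_gt0.
Qed.

Let measurable_shifted_p v : measurable_fun setT (fun x : R => p (x - v)).
Proof.
apply: continuous_measurable_fun => x.
have cs : {for x, continuous (fun x : R => x - v)}.
  by apply: continuousB; [exact: cvg_id|exact: cst_continuous].
exact: (continuous_comp cs (@cp (x - v))).
Qed.

Let measurable_lap_kernel c t : measurable_fun setT (lap_kernel c t).
Proof. by apply: continuous_measurable_fun; exact: continuous_lap_kernel. Qed.

Let measurable_shifted c v :
  measurable_fun setT (fun x => lap_kernel c 1 x * p (x - v)).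
Proof. exact: measurable_funM. Qed.

Let integrable_shifted c v : 0 < c <= 3 ->
  mu.-integrable setT (EFin \o (fun x => lap_kernel c 1 x * p (x - v))).
Proof.
move=> c03; apply: (@le_integrable _ _ _ mu setT measurableT _
  (fun x => (K%:E * (lap_kernel c 1 x)%:E)%E)) => //.
- by apply/measurable_EFinP; exact: measurable_shifted.
- move=> x _; rewrite /= lee_fin mulrC.
  have l0 := lap_kernel_gt0 c 1 x; have p0 := p_gt0 (x - v).
  rewrite (ger0_norm (mulr_ge0 (ltW p0) (ltW l0))).
  rewrite (ger0_norm (mulr_ge0 K_ge0 (ltW l0))).
  by rewrite ler_wpM2r ?p_le ?(ltW l0).
- exact: (integrableZl measurableT K (integrable_lap_kernel c03 ltr01)).
Qed.

(** The substitution [x - ln t] moves all dependence on [t] into the argument of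
    [p]. *)
Lemma spec_laplace_scale c t : 0 < c <= 3 -> 0 < t ->
  t `^ c * spec_laplace c t = \int[mu]_x (lap_kernel c 1 x * p (x - ln t)).
Proof.
move=> c03 t0; apply: EFin_inj.
have tc0 : 0 < t `^ c by rewrite powR_gt0.
rewrite EFinM -spec_laplace_fin// -(@ge0_integral_shift _ (- ln t)); last 2 first.
- exact: (measurable_int _ (integrable_spec c03 t0)).
- by move=> x; rewrite lee_fin mulr_ge0 ?ltW ?lap_kernel_gt0 ?p_gt0.
have e x : (t `^ c * (lap_kernel c t (x - ln t) * p (x - ln t)) =
    lap_kernel c 1 x * p (x - ln t))%R.
  rewrite /lap_kernel; move: (p _) => q.
  have e1 : expR (x - ln t) * t = expR x by rewrite expRB lnK ?posrE// divfK ?gt_eqF.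
  rewrite e1 mulr1 mulrBr expRB /powR gt_eqF//; field.
  by rewrite gt_eqF ?expR_gt0.
have e2 x : (lap_kernel c t (x - ln t) * p (x - ln t) =
    (t `^ c)^-1 * (lap_kernel c 1 x * p (x - ln t)))%R.
  by rewrite -e mulKf// gt_eqF.
have i := integrable_shifted (ln t) c03.
rewrite /Rintegral fineK; last exact: (integrable_fin_num measurableT i).
pose f x := lap_kernel c 1 x * p (x - ln t).
have -> : (fun x => (lap_kernel c t (x - ln t) * p (x - ln t))%:E) =
    (fun x => ((t `^ c)^-1%:E * (EFin \o f) x)%E).
  by apply/funext => x; rewrite e2.
by rewrite (integralZl measurableT i) muleA -EFinM divff ?gt_eqF// mul1e.
Qed.

(** Abelian theorem: large times only see the behaviour of [p] at minus
    infinity. *)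
Lemma cvg_spec_laplace (c l : R) : 0 < c <= 3 ->
  (forall v : R^nat, v n @[n --> \oo] --> +oo ->
    forall x, p (x - v n) @[n --> \oo] --> l) ->
  t `^ c * spec_laplace c t @[t --> +oo] --> l * Gam c.
Proof.
move=> c03 hl; apply/cvg_pinftyP => v vy.
have vpos : \forall n \near \oo, 0 < v n by move/cvgryPgt : vy; exact.
have lny : ln (v n) @[n --> \oo] --> +oo%R.
  apply/cvgryPge => M; move/cvgryPge : vy => /(_ (expR M)).
  apply: filterS => n h.
  by rewrite -(expRK M) ler_ln ?posrE ?expR_gt0// (lt_le_trans _ h) ?expR_gt0.
suff h : \int[mu]_x (lap_kernel c 1 x * p (x - ln (v n))) @[n --> \oo] --> l * Gam c.
  apply: cvg_trans h; apply: near_eq_cvg; near=> n; rewrite spec_laplace_scale//.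
  by near: n.
have gE : l * Gam c = \int[mu]_x (lap_kernel c 1 x * l).
  by rewrite RintegralZr 1?mulrC//; exact: integrable_lap_kernel.
rewrite gE.
have : (\int[mu]_x (lap_kernel c 1 x * p (x - ln (v n)))%:E)%E @[n --> \oo] -->
    (\int[mu]_x (lap_kernel c 1 x * l)%:E)%E.
  have [] // := @dominated_convergence _ _ R mu setT measurableT
    (fun n x => (lap_kernel c 1 x * p (x - ln (v n)))%:E)
    (fun x => (lap_kernel c 1 x * l)%:E)
    (fun x => (K%:E * (lap_kernel c 1 x)%:E)%E).
  - by move=> n; apply/measurable_EFinP; exact: measurable_shifted.
  - apply/measurable_EFinP; apply: measurable_funM => //.
    exact: measurable_lap_kernel.
  - apply: aeW => x _; apply: cvg_EFin; first by apply: nearW.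
    apply: cvgM; first exact: cvg_cst.
    exact: (hl _ lny).
  - exact: (integrableZl measurableT K (integrable_lap_kernel c03 ltr01)).
  - apply: aeW => x n _; rewrite -EFinM lee_fin mulrC.
    have l0 := lap_kernel_gt0 c 1 x; have p0 := p_gt0 (x - ln (v n)).
    rewrite (ger0_norm (mulr_ge0 (ltW p0) (ltW l0))).
    by rewrite ler_wpM2r ?p_le ?(ltW l0).
move=> h; apply: fine_cvg; rewrite fineK//.
apply: integrable_fin_num => //.
exact: (integrableZr measurableT l (integrable_lap_kernel c03 ltr01)).
Unshelve. all: by end_near. Qed.

End weighted_laplace.

Section spectral.
Context {R : realType}.
Notation mu := (@lebesgue_measure R).
Variables (C1 C2 a1 a2 : R).
Hypotheses (hC1 : 0 <= C1) (hC2 : 0 < C2).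
Hypotheses (ha2 : 0 < a2) (ha21 : a2 < a1) (ha1 : a1 < 1).

Let b1 := a1 - 2^-1.
Let b2 := a2 - 2^-1.
Let hb1 : `|b1| < 2^-1. Proof. rewrite ltr_norml /b1; have := ha2; have := ha21; have := ha1; lra. Qed.
Let hb2 : `|b2| < 2^-1. Proof. rewrite ltr_norml /b2; have := ha2; have := ha21; have := ha1; lra. Qed.

(** The spectral density, up to the power [e^((1 - a2) x)]: the jump of
    [1 / (C1 s^a1 + C2 s^a2)] across the negative half-line, at [s = - e^x]. *)
Definition phi (x : R) := expR (b2 * x) * hpi C1 C2 b1 b2 x / pi.

Lemma phi_gt0 x : 0 < phi x.
Proof. by rewrite /phi divr_gt0 ?pi_gt0// mulr_gt0 ?expR_gt0// hpi_gt0. Qed.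

Definition phi_sup := (C2 * cos (b2 * pi))^-1 / pi.

Lemma phi_le x : phi x <= phi_sup.
Proof. by rewrite /phi ler_wpM2r ?invr_ge0 ?pi_ge0// hpi_le. Qed.

Lemma continuous_phi : continuous phi.
Proof.
move=> x.
have c1 : {for x, continuous (fun x : R => expR (b2 * x))}.
  by apply: continuous_expR_comp; apply: continuousM; [exact: cst_continuous|exact: cvg_id].
have ch : {for x, continuous (hpi C1 C2 b1 b2)} by apply: continuous_hpi.
exact: (continuousM (continuousM c1 ch) (@cst_continuous _ _ pi^-1 x)).
Qed.

Definition phi0 := cos (b2 * pi) / C2 / pi.

Lemma phi0_gt0 : 0 < phi0.
Proof. by rewrite /phi0 !divr_gt0 ?pi_gt0// (cos_pi_gt0 hb1 hb2). Qed.

Lemma cvg_phi (v : R^nat) : v n @[n --> \oo] --> +oo ->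
  forall x, phi (x - v n) @[n --> \oo] --> phi0.
Proof.
move=> vy x.
have bb : 0 < b1 - b2 by rewrite /b1 /b2; have := ha21; lra.
have dv : (b1 - b2) * v n @[n --> \oo] --> +oo%R.
  move/cvgryPge: vy => vy; apply/cvgryPge => M.
  by apply: filterS (vy ((b1 - b2)^-1 * M)) => n; rewrite ler_pdivrMl.
have E0 : expR ((b1 - b2) * (x - v n)) @[n --> \oo] --> 0.
  under eq_fun do rewrite mulrBr expRD.
  rewrite -(mulr0 (expR ((b1 - b2) * x))); apply: cvgM; first exact: cvg_cst.
  exact: (cvg_comp _ _ dv (@cvgr_expR R)).
rewrite /phi0 -(edge_ratio0 C1 b1 b2 hC2).
have -> : (fun n => phi (x - v n)) =
    (fun n => edge_ratio C1 C2 b1 b2 (expR ((b1 - b2) * (x - v n))) / pi).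
  by apply/funext => n; rewrite /phi hpiE.
apply: cvgM; last exact: cvg_cst.
exact: (cvg_comp _ _ E0 (edge_ratio_continuous0 hC2)).
Qed.

End spectral.

(** * The density of the potential and its Laplace transform *)

Section laplace.
Context {R : realType}.
Notation mu := (@lebesgue_measure R).
Variables (C1 C2 a1 a2 : R).
Hypotheses (hC1 : 0 <= C1) (hC2 : 0 < C2).
Hypotheses (ha2 : 0 < a2) (ha21 : a2 < a1) (ha1 : a1 < 1).
Let b1 := a1 - 2^-1.
Let b2 := a2 - 2^-1.
Let hb1 : `|b1| < 2^-1.
Proof. rewrite ltr_norml /b1; have := ha2; have := ha21; have := ha1; lra. Qed.
Let hb2 : `|b2| < 2^-1.
Proof. rewrite ltr_norml /b2; have := ha2; have := ha21; have := ha1; lra. Qed.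

Notation phi := (phi C1 C2 a1 a2).

Definition pot_density t := spec_laplace phi (1 - a2) t.
Notation u := pot_density.

Let c03 : 0 < 1 - a2 <= 3.
Proof. apply/andP; split; have := ha2; have := ha21; have := ha1; lra. Qed.

Let cphi : continuous phi := continuous_phi hC1 hC2 ha2 ha21 ha1.
Let phi0' : forall x, 0 < phi x := phi_gt0 hC1 hC2 ha2 ha21 ha1.
Let phi_le' := phi_le hC1 hC2 ha2 ha21 ha1.

(** Translating the line absorbs the Laplace variable into the two weights. *)
Lemma hpi_shift (s x : R) : 0 < s ->
  hpi C1 C2 b1 b2 (x + ln s) =
  hpi (C1 * expR (b1 * ln s)) (C2 * expR (b2 * ln s)) b1 b2 x.
Proof.
move=> s0; rewrite /hpi /cinv_re.
have er (b t : R) : cexp_re b (x + ln s) t = expR (b * ln s) * cexp_re b x t.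
  by rewrite /cexp_re mulrDr expRD; ring.
have ei (b t : R) : cexp_im b (x + ln s) t = expR (b * ln s) * cexp_im b x t.
  by rewrite /cexp_im mulrDr expRD; ring.
by rewrite /den_re /den_im !er !ei !mulrA.
Qed.

(** After the translation by [ln s] this is the mean value property on the strip,
    with weights [C_i s^(a_i - 1/2)]. *)
Lemma stieltjes_identity (s : R) : 0 < s ->
  (\int[mu]_x (expR ((1 - a2) * x) * phi x / (s + expR x))%:E)%E =
  ((C1 * s `^ a1 + C2 * s `^ a2)^-1)%:E.
Proof.
move=> s0.
pose f x := expR ((1 - a2) * x) * phi x / (s + expR x).
have cf : continuous f.
  move=> x.
  have k1 : {for x, continuous (fun x : R => expR ((1 - a2) * x))}.
    by apply: continuous_expR_comp; apply: continuousM; [exact: cst_continuous|exact: cvg_id].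
  have k2 : {for x, continuous (fun x : R => s + expR x)}.
    by apply: continuousD; [exact: cst_continuous|exact: continuous_expR].
  have k3 : {for x, continuous (fun x : R => (s + expR x)^-1)}.
    by apply: (continuousV _ k2); rewrite gt_eqF// addr_gt0// expR_gt0.
  exact: (continuousM (continuousM k1 (@cphi x)) k3).
have f0 x : 0 < f x.
  by rewrite divr_gt0 ?addr_gt0 ?expR_gt0// mulr_gt0 ?expR_gt0.
rewrite -(@ge0_integral_shift _ (ln s) (EFin \o f)); last 2 first.
- by apply/measurable_EFinP; exact: continuous_measurable_fun.
- by move=> x; rewrite lee_fin ltW.
pose A := C1 * expR (b1 * ln s); pose B := C2 * expR (b2 * ln s).
have A0 : 0 <= A by rewrite mulr_ge0 ?expR_ge0.
have B0 : 0 < B by rewrite mulr_gt0 ?expR_gt0.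
pose k : R := (pi * expR (2^-1 * ln s))^-1.
have fE x : f (x + ln s) = k * (hpi A B b1 b2 x * sech2 x).
  rewrite /f /phi hpi_shift// -/A -/B mulrA.
  move: (hpi A B b1 b2 x) => h; rewrite /k /sech2.
  have -> : expR ((1 - a2) * (x + ln s)) * (expR (b2 * (x + ln s)) * h) =
     expR (2^-1 * (x + ln s)) * h.
    by rewrite mulrA -expRD; congr (expR _ * _); rewrite /b2; field.
  have -> : s + expR (x + ln s) =
      expR (2^-1 * ln s) ^+ 2 * (1 + expR (x / 2) ^+ 2).
    have h1 : 2 * (2^-1 * ln s) = ln s by field.
    have h2 : 2 * (x / 2) = x by field.
    rewrite -!expRM_natl h1 h2.
    by rewrite expRD lnK ?posrE//; ring.
  rewrite mulrDr expRD (mulrC 2^-1 x) expRN.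
  have := expR_gt0 (x / 2); have := expR_gt0 (2^-1 * ln s); have := @pi_gt0 R.
  move: (expR (x / 2)) (expR (2^-1 * ln s)) (pi : R) => e v q q0 v0 e0.
  by field; rewrite !gt_eqF//; nra.
under eq_integral do rewrite /= fE EFinM.
rewrite ge0_integralZl//=; last 3 first.
- apply/measurable_EFinP; apply: continuous_measurable_fun => x.
  have k1 : {for x, continuous (hpi A B b1 b2)} by apply: continuous_hpi.
  exact: (continuousM k1 (@continuous_sech2 _ x)).
- by move=> x _; rewrite lee_fin mulr_ge0 ?ltW ?sech2_gt0// hpi_gt0.
- by rewrite lee_fin invr_ge0 mulr_ge0 ?pi_ge0 ?expR_ge0.
rewrite strip_mean_value// -EFinM; congr EFin; rewrite /k /A /B /powR (gt_eqF s0).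
have -> : expR (a1 * ln s) = expR (b1 * ln s) * expR (2^-1 * ln s).
  by rewrite -expRD; congr expR; rewrite /b1; ring.
have -> : expR (a2 * ln s) = expR (b2 * ln s) * expR (2^-1 * ln s).
  by rewrite -expRD; congr expR; rewrite /b2; ring.
have AB : 0 < A + B by rewrite ltr_wpDl.
rewrite !mulrA -mulrDl -/A -/B invfM.
have := @pi_gt0 R; move: (pi : R) => q q0; field.
by rewrite !gt_eqF ?expR_gt0.
Qed.

Lemma pot_density_ge0 t : 0 <= u t.
Proof.
by apply: Rintegral_ge0 => x _; rewrite mulr_ge0 ?ltW ?lap_kernel_gt0 ?phi0'.
Qed.

Lemma measurable_pot_density :
  measurable_fun setT (fun t => \1_(`]0%R, +oo[%classic : set R) t * u t).
Proof.
pose F (z : R * R) : \bar R := (\1_(`]0, +oo[%classic : set R) z.1 *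
   (lap_kernel (1 - a2) z.1 z.2 * phi z.2))%:E.
have mF : measurable_fun setT F.
  have m1 : measurable_fun setT (\1_(`]0, +oo[%classic : set R) : R -> R).
    exact: measurable_indic.
  have m3 : measurable_fun setT (fun z : R * R => expR (- (expR z.2 * z.1))).
    apply: measurableT_comp => //; apply: measurableT_comp => //.
    apply: measurable_funM; last exact: measurable_fst.
    by apply: measurableT_comp => //; exact: measurable_snd.
  have m4 : measurable_fun setT (fun z : R * R => expR ((1 - a2) * z.2)).
    apply: measurableT_comp => //.
    by apply: measurable_funM => //; exact: measurable_snd.
  have m5 : measurable_fun setT (fun z : R * R => phi z.2).
    apply: (measurableT_comp (continuous_measurable_fun cphi)).
    exact: measurable_snd.
  apply/measurable_EFinP; apply: measurable_funM.
    exact: (measurableT_comp m1 measurable_fst).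
  apply: measurable_funM => //; exact: measurable_funM.
have F0 z : (0 <= F z)%E.
  rewrite lee_fin mulr_ge0// mulr_ge0 ?ltW ?phi0'//.
  exact: lap_kernel_gt0.
have := @measurable_fun_fubini_tonelli_F _ _ _ _ R mu F mF F0.
rewrite (_ : fubini_F _ _ = EFin \o (fun t => \1_(`]0%R, +oo[%classic : set R) t * u t)).
  by move/measurable_EFinP.
apply/funext => t; rewrite /fubini_F /= indicE.
have [tp|tp] := boolP (t \in _); last first.
  by rewrite mul0r; apply: integral0_eq => x _; rewrite /F /= indicE (negbTE tp) mul0r.
have t0 : 0 < t by move: tp; rewrite inE/= in_itv/= andbT.
rewrite mul1r /u -(spec_laplace_fin cphi phi0' phi_le' c03 t0).
by apply: eq_integral => x _; rewrite /F /= indicE tp mul1r.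
Qed.

(** Tonelli: integrating [e^(- s t)] against [exp (- e^x t)] leaves the Stieltjes
    kernel [1 / (s + e^x)]. *)
Lemma laplace_pot_density (s : R) : 0 < s ->
  (\int[mu]_(t in `]0%R, +oo[) (expR (- (s * t)) * u t)%:E)%E =
  ((C1 * s `^ a1 + C2 * s `^ a2)^-1)%:E.
Proof.
move=> s0; rewrite -stieltjes_identity//.
pose F (z : R * R) : \bar R := (\1_(`]0, +oo[%classic : set R) z.1 * (expR (- (s * z.1)) *
   (lap_kernel (1 - a2) z.1 z.2 * phi z.2)))%:E.
have mF : measurable_fun setT F.
  have m1 : measurable_fun setT (\1_(`]0, +oo[%classic : set R) : R -> R).
    exact: measurable_indic.
  have m2 : measurable_fun setT (fun z : R * R => expR (- (s * z.1))).
    apply: measurableT_comp => //; apply: measurableT_comp => //.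
    by apply: measurable_funM => //; exact: measurable_fst.
  have m3 : measurable_fun setT (fun z : R * R => expR (- (expR z.2 * z.1))).
    apply: measurableT_comp => //; apply: measurableT_comp => //.
    apply: measurable_funM; last exact: measurable_fst.
    by apply: measurableT_comp => //; exact: measurable_snd.
  have m4 : measurable_fun setT (fun z : R * R => expR ((1 - a2) * z.2)).
    apply: measurableT_comp => //.
    by apply: measurable_funM => //; exact: measurable_snd.
  have m5 : measurable_fun setT (fun z : R * R => phi z.2).
    apply: (measurableT_comp (continuous_measurable_fun cphi)).
    exact: measurable_snd.
  apply/measurable_EFinP; apply: measurable_funM.
    exact: (measurableT_comp m1 measurable_fst).
  apply: measurable_funM => //; apply: measurable_funM => //.
  exact: measurable_funM.
have F0 z : (0 <= F z)%E.
  rewrite lee_fin mulr_ge0// mulr_ge0 ?expR_ge0// mulr_ge0 ?ltW ?phi0'//.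
  exact: lap_kernel_gt0.
have := @fubini_tonelli _ _ _ _ R mu mu F mF F0.
rewrite (_ : (\int[mu]_x \int[mu]_y F (x, y))%E = (\int[mu]_(t in `]0%R, +oo[) (expR (- (s * t)) * u t)%:E)%E); last first.
  rewrite [RHS]integral_mkcond; apply: eq_integral => t _.
  rewrite patchE; case: ifPn => tp; last first.
    apply: integral0_eq => x _.
    by rewrite /F /= indicE (negbTE tp) mul0r.
  have t0 : 0 < t by move: tp; rewrite inE/= in_itv/= andbT.
  rewrite EFinM /u -(spec_laplace_fin cphi phi0' phi_le' c03 t0).
  rewrite -ge0_integralZl//=.
  - apply: eq_integral => x _.
    by rewrite /F /= indicE tp mul1r.
  - apply/measurable_EFinP; apply: measurable_funM.
      exact: (continuous_measurable_fun (@continuous_lap_kernel _ (1 - a2) t)).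
    exact: (continuous_measurable_fun cphi).
  - by move=> x _; rewrite lee_fin mulr_ge0 ?ltW ?phi0'// lap_kernel_gt0.
move=> ->; apply: eq_integral => x _.
transitivity (\int[mu]_(t in `]0%R, +oo[) ((expR ((1 - a2) * x) * phi x)%:E *
    (expR (- ((s + expR x) * t)))%:E))%E.
  rewrite [RHS]integral_mkcond; apply: eq_integral => t _.
  rewrite patchE /F /= indicE; case: ifPn => tp; last by rewrite mul0r.
  rewrite -EFinM mul1r /lap_kernel; congr EFin.
  rewrite (_ : - ((s + expR x) * t) = - (s * t) - expR x * t); last by ring.
  by rewrite expRD; ring.
have se : 0 < s + expR x by rewrite addr_gt0 ?expR_gt0.
have me : measurable_fun setT (fun t : R => (expR (- ((s + expR x) * t)))%:E).
  apply/measurable_EFinP; apply: measurableT_comp => //.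
  by apply: measurableT_comp => //; exact: measurable_funM.
rewrite ge0_integralZl//=; last 2 first.
- exact: (measurable_funTS me).
- by rewrite lee_fin mulr_ge0 ?expR_ge0// ltW.
rewrite integral_itv_obnd_cbnd; last exact: (measurable_funTS me).
by rewrite integral_expR_ge0// -EFinM.
Qed.

End laplace.

(** * Determination of a measure by its moments *)

Section bernstein.
Context {R : realType}.
Implicit Types (f g : nat -> R) (y : R).

(** [bernp n f] is the polynomial whose value at [y] is the expectation of
    [f S] for [S] binomial with parameters [n] and [y]; conditioning on the
    first of the [n] trials gives this recursion. *)
Fixpoint bernp n f : {poly R} :=
  if n is m.+1 then 'X * bernp m (f \o succn) + (1 - 'X) * bernp m f
  else (f 0%N)%:P.

Lemma bernpS n f y : (bernp n.+1 f).[y] =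
  y * (bernp n (f \o succn)).[y] + (1 - y) * (bernp n f).[y].
Proof. by rewrite /= !hornerE. Qed.

Lemma bernp_cst n c y : (bernp n (fun=> c)).[y] = c.
Proof.
elim: n => [|n IHn]; first by rewrite /= hornerC.
by rewrite bernpS /comp/= IHn; ring.
Qed.

Lemma bernpD n f g y :
  (bernp n (fun k => f k + g k)).[y] = (bernp n f).[y] + (bernp n g).[y].
Proof.
elim: n f g => [|n IHn] f g; first by rewrite /= !hornerC.
by rewrite !bernpS /comp/= !IHn; ring.
Qed.

Lemma bernpZ n c f y :
  (bernp n (fun k => c * f k)).[y] = c * (bernp n f).[y].
Proof.
elim: n f => [|n IHn] f; first by rewrite /= !hornerC.
by rewrite !bernpS /comp/= !IHn; ring.
Qed.

Lemma le_bernp n f g y : 0 <= y <= 1 -> (forall k, f k <= g k) ->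
  (bernp n f).[y] <= (bernp n g).[y].
Proof.
move=> /andP[y0 y1]; elim: n f g => [|n IHn] f g fg.
  by rewrite /= !hornerC.
rewrite !bernpS lerD// ler_wpM2l ?subr_ge0// IHn// => k; exact: fg.
Qed.

Lemma bernp_sqr n x y : (bernp n (fun k => (k%:R - x) ^+ 2)).[y] =
  n%:R * (y * (1 - y)) + (n%:R * y - x) ^+ 2.
Proof.
elim: n x => [|n IHn] x; first by rewrite /= !hornerC; ring.
rewrite bernpS IHn.
rewrite (_ : _ \o _ = (fun k => (k%:R - (x - 1)) ^+ 2)); last first.
  by apply/funext => k; rewrite /= -natr1; ring.
by rewrite IHn -natr1; ring.
Qed.

Lemma normr_bernp_le n f y : 0 <= y <= 1 ->
  `|(bernp n f).[y]| <= (bernp n (fun k => `|f k|)).[y].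
Proof.
move=> y01; rewrite ler_norml; apply/andP; split.
  rewrite -mulN1r -bernpZ; apply: le_bernp => // k.
  by rewrite mulN1r lerNl -normrN ler_norm.
by apply: le_bernp => // k; exact: ler_norm.
Qed.

Definition bernstein (h : R -> R) n := bernp n.+1 (fun k => h (k%:R / n.+1%:R)).

Lemma bernstein_bounded h M n y : 0 <= y <= 1 -> (forall x, `|h x| <= M) ->
  `|(bernstein h n).[y]| <= M.
Proof.
move=> y01 hM; rewrite (le_trans (normr_bernp_le _ _ y01))//.
by rewrite -[leRHS](bernp_cst n.+1 M y); exact: le_bernp.
Qed.

(** Chebyshev's inequality for the binomial law: values of [h] far from [y]
    contribute at most twice its bound times the probability of a deviation. *)
Lemma cvg_bernstein h M y : 0 <= y <= 1 -> (forall x, `|h x| <= M) ->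
  {for y, continuous h} -> (bernstein h n).[y] @[n --> \oo] --> h y.
Proof.
move=> y01 hM ch.
have M0 : 0 <= M := le_trans (normr_ge0 _) (hM 0).
apply/cvgrPdist_le => e e0.
have e20 : 0 < e / 2 by rewrite divr_gt0.
move/cvgrPdist_lt: ch => /(_ _ e20) /nbhs_ballP[r /= r0 hr].
near=> n.
pose q (k : nat) : R := k%:R / n.+1%:R.
have n0 : 0 < n.+1%:R :> R by [].
have key k : `|h (q k) - h y| <= e / 2 + 2 * M / r ^+ 2 / n.+1%:R ^+ 2
    * (k%:R - n.+1%:R * y) ^+ 2.
  have sq : (k%:R - n.+1%:R * y) ^+ 2 / n.+1%:R ^+ 2 = (q k - y) ^+ 2.
    have : n.+1%:R != 0 :> R by [].
    by rewrite /q; move: (n.+1%:R : R) => N N0; field.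
  rewrite (_ : _ * _ ^+ 2 = 2 * M / r ^+ 2 * ((k%:R - n.+1%:R * y) ^+ 2 / n.+1%:R ^+ 2)); last first.
    by rewrite mulrAC -mulrA.
  rewrite sq; have [qr|qr] := ltP `|y - q k| r.
    have := hr (q k) qr; rewrite distrC => /ltW h1; rewrite (le_trans h1)// lerDl.
    by rewrite mulr_ge0 ?sqr_ge0// divr_ge0 ?sqr_ge0// mulr_ge0.
  apply: (@le_trans _ _ (2 * M)).
    by rewrite (le_trans (ler_normB _ _))// mulr_natl mulr2n lerD.
  apply: (@le_trans _ _ (2 * M / r ^+ 2 * (q k - y) ^+ 2)); last by rewrite lerDr ltW.
  rewrite -mulrA ler_peMr ?mulr_ge0//.
  rewrite ler_pdivlMl ?exprn_gt0// mulr1 -(real_normK (num_real (q k - y))).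
  by rewrite lerXn2r// ?nnegrE ?(ltW r0)// distrC.
have := normr_bernp_le n.+1 (fun k => h (q k) + - h y) y01.
rewrite bernpD bernp_cst => hle; rewrite distrC; apply: (le_trans hle) => {hle}.
apply: (le_trans (le_bernp _ y01 key)).
rewrite bernpD bernp_cst bernpZ bernp_sqr subrr expr0n addr0.
apply: (@le_trans _ _ (e / 2 + 2 * M / r ^+ 2 / n.+1%:R)).
  rewrite lerD2l.
  have -> : 2 * M / r ^+ 2 / n.+1%:R ^+ 2 * (n.+1%:R * (y * (1 - y))) =
      2 * M / r ^+ 2 / n.+1%:R * (y * (1 - y)).
    have : n.+1%:R != 0 :> R by [].
    by move: (n.+1%:R : R) => N N0; field; rewrite N0 gt_eqF.
  rewrite ler_piMr//.
    by rewrite divr_ge0// divr_ge0 ?sqr_ge0// mulr_ge0.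
  by case/andP: y01 => y0 y1; nra.
rewrite -lerBrDl (_ : e - e / 2 = e / 2); last by field.
rewrite ler_pdivrMr// -ler_pdivrMl//.
rewrite (@le_trans _ _ n%:R)// ?ler_nat//.
by near: n; exact: nbhs_infty_ger.
Unshelve. all: by end_near. Qed.

End bernstein.

Section moments.
Context {R : realType}.

Lemma cvg_Rintegral_dominated d (T : measurableType d)
    (m : {measure set T -> \bar R}) (f_ : nat -> T -> R) (f g : T -> R) :
  (forall n, measurable_fun setT (f_ n)) -> measurable_fun setT f ->
  (forall x, f_ n x @[n --> \oo] --> f x) ->
  m.-integrable setT (EFin \o g) -> (forall n x, `|f_ n x| <= g x) ->
  \int[m]_x f_ n x @[n --> \oo] --> \int[m]_x f x.
Proof.
move=> mf_ mf cf ig fg.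
have [||||| i _ h] := @dominated_convergence _ _ R m setT measurableT
  (fun n => EFin \o f_ n) (EFin \o f) (EFin \o g).
- by move=> n; apply/measurable_EFinP; exact: mf_.
- exact/measurable_EFinP.
- by apply: aeW => x _; apply: cvg_EFin; [by apply: nearW|exact: cf].
- by [].
- by apply: aeW => x n _; rewrite lee_fin; exact: fg.
apply: fine_cvg; rewrite fineK//; exact: integrable_fin_num.
Qed.

Variables (d1 d2 : measure_display) (T1 : measurableType d1) (T2 : measurableType d2).
Variables (m1 : {measure set T1 -> \bar R}) (m2 : {measure set T2 -> \bar R}).
Variables (f1 v1 : T1 -> R) (f2 v2 : T2 -> R).
Hypotheses (mf1 : m1.-integrable setT (EFin \o f1)) (mv1 : measurable_fun setT v1).
Hypotheses (mf2 : m2.-integrable setT (EFin \o f2)) (mv2 : measurable_fun setT v2).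
Hypotheses (v101 : forall x, 0 <= v1 x <= 1) (v201 : forall x, 0 <= v2 x <= 1).
Hypothesis moments : forall k,
  \int[m1]_x (f1 x * v1 x ^+ k) = \int[m2]_x (f2 x * v2 x ^+ k).

Lemma integrable_bounded_mul d (T : measurableType d)
    (m : {measure set T -> \bar R}) (f g : T -> R) (M : R) :
  m.-integrable setT (EFin \o f) -> measurable_fun setT g ->
  (forall x, `|g x| <= M) -> m.-integrable setT (EFin \o (fun x => f x * g x)).
Proof.
move=> fi mg gM.
have mf : measurable_fun setT f by apply/measurable_EFinP; exact: measurable_int fi.
apply: (@le_integrable _ _ _ m setT measurableT _ (fun x => (M%:E * (f x)%:E)%E)).
- by apply/measurable_EFinP; exact: measurable_funM.
- move=> x _; rewrite /= lee_fin normrM [leRHS]normrM mulrC ler_wpM2r//.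
  by rewrite (le_trans (gM x))// ler_norm.
- exact: (integrableZl measurableT M fi).
Qed.

Let moments_poly (p : {poly R}) :
  \int[m1]_x (f1 x * p.[v1 x]) = \int[m2]_x (f2 x * p.[v2 x]).
Proof.
have lin d (T : measurableType d) (m : {measure set T -> \bar R}) (f v : T -> R) :
    m.-integrable setT (EFin \o f) -> measurable_fun setT v ->
    (forall x, 0 <= v x <= 1) ->
    \int[m]_x (f x * p.[v x]) = \sum_(i < size p) p`_i * \int[m]_x (f x * v x ^+ i).
  move=> fi mv v01.
  have vi i x : `|v x ^+ i| <= 1.
    by case/andP: (v01 x) => v0 v1'; rewrite ger0_norm ?exprn_ge0// exprn_ile1.
  have ii i : m.-integrable setT (EFin \o (fun x => f x * v x ^+ i)).
    by apply: (@integrable_bounded_mul _ _ _ _ _ 1) => //; exact: measurable_funX.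
  transitivity (fine (\sum_(i < size p) \int[m]_x (p`_i * (f x * v x ^+ i))%:E)%E).
    rewrite /Rintegral -integral_sum//; last first.
      by move=> i; exact: (integrableZl measurableT p`_i (ii i)).
    congr fine; apply: eq_integral => x _; rewrite sumEFin; congr EFin.
    by rewrite horner_coef mulr_sumr; apply: eq_bigr => i _; ring.
  rewrite -sum_fine; last first.
    move=> i _; apply: integrable_fin_num => //.
    exact: (integrableZl measurableT p`_i (ii i)).
  apply: eq_bigr => i _.
  by rewrite -[LHS]/(\int[m]_x (p`_i * (f x * v x ^+ i))) RintegralZl.
by rewrite !lin//; apply: eq_bigr => i _; rewrite moments.
Qed.

Lemma moments_continuous (h : R -> R) M : continuous h ->
  (forall x, `|h x| <= M) ->
  \int[m1]_x (f1 x * h (v1 x)) = \int[m2]_x (f2 x * h (v2 x)).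
Proof.
move=> ch hM.
have lim d (T : measurableType d) (m : {measure set T -> \bar R}) (f v : T -> R) :
    m.-integrable setT (EFin \o f) -> measurable_fun setT v ->
    (forall x, 0 <= v x <= 1) ->
    \int[m]_x (f x * (bernstein h n).[v x]) @[n --> \oo] --> \int[m]_x (f x * h (v x)).
  move=> fi mv v01.
  have mf : measurable_fun setT f by apply/measurable_EFinP; exact: measurable_int fi.
  have M0 : 0 <= M := le_trans (normr_ge0 _) (hM 0).
  apply: (@cvg_Rintegral_dominated _ _ _ _ _ (fun x => M * `|f x|)).
  - move=> n; apply: measurable_funM => //.
    apply: (@measurableT_comp _ _ _ _ _ _ (fun y => (bernstein h n).[y])) => //.
    by apply: continuous_measurable_fun => y; exact: continuous_horner.
  - apply: measurable_funM => //; apply: measurableT_comp => //.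
    exact: continuous_measurable_fun.
  - move=> x; apply: cvgM; first exact: cvg_cst.
    by apply: (cvg_bernstein (v01 x) hM); exact: ch.
  - exact: (integrableZl measurableT M (integrable_norm fi)).
  - move=> n x; rewrite normrM mulrC ler_wpM2r//.
    exact: bernstein_bounded.
have h1 := lim _ _ _ _ _ mf1 mv1 v101.
have h2 := lim _ _ _ _ _ mf2 mv2 v201.
rewrite (_ : (fun n => _) = (fun n => \int[m2]_x (f2 x * (bernstein h n).[v2 x]))) in h1; last first.
  by apply/funext => n; exact: moments_poly.
exact: (cvg_unique _ h1 h2).
Qed.

(** Undoes a weight [y] where it is bounded below; the cut function is a pointwise
    limit of continuous functions that are bounded by [2 / c]. *)
Definition inv_cut (c y : R) := if c <= y then y^-1 else 0.

Lemma moments_inv_cut c : 0 < c ->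
  \int[m1]_x (f1 x * inv_cut c (v1 x)) = \int[m2]_x (f2 x * inv_cut c (v2 x)).
Proof.
move=> c0; have c20 : 0 < c / 2 by rewrite divr_gt0.
pose h n y := Num.min 1 (Num.max 0 (1 + n%:R * (y - c))) / Num.max y (c / 2).
have mx y : 0 < Num.max y (c / 2) by rewrite lt_max c20 orbT.
have ch n : continuous (h n).
  move=> y.
  have k1 : {for y, continuous (fun y : R => 1 + n%:R * (y - c))}.
    apply: continuousD; first exact: cst_continuous.
    apply: continuousM; first exact: cst_continuous.
    by apply: continuousB; [exact: cvg_id|exact: cst_continuous].
  have k2 : {for y, continuous (fun y : R => Num.min 1 (Num.max 0 (1 + n%:R * (y - c))))}.
    apply: continuous_min; first exact: cst_continuous.
    by apply: continuous_max; first exact: cst_continuous.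
  have k3 : {for y, continuous (fun y : R => Num.max y (c / 2))}.
    by apply: continuous_max; [exact: cvg_id|exact: cst_continuous].
  have k4 : {for y, continuous (fun y : R => (Num.max y (c / 2))^-1)}.
    by apply: (continuousV _ k3); rewrite gt_eqF.
  exact: (continuousM k2 k4).
have hM n y : `|h n y| <= 2 / c.
  have t0 : 0 <= Num.min 1 (Num.max 0 (1 + n%:R * (y - c))).
    by rewrite le_min ler01/= le_max lexx.
  rewrite /h ger0_norm ?divr_ge0 ?(ltW (mx y))//.
  apply: (@le_trans _ _ (1 / Num.max y (c / 2))).
    by rewrite ler_wpM2r ?invr_ge0 ?(ltW (mx y))// ge_min lexx.
  rewrite mul1r -[leRHS]invrK lef_pV2 ?posrE ?invr_gt0 ?divr_gt0//.
  by rewrite invf_div le_max lexx orbT.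
have cvh y : h n y @[n --> \oo] --> inv_cut c y.
  rewrite /h /inv_cut; case: ifPn => [cy|]; last rewrite -ltNge => yc.
    rewrite (_ : (fun n => _) = (fun=> y^-1)); first exact: cvg_cst.
    apply/funext => n.
    have -> : Num.max y (c / 2) = y by apply/max_idPl; lra.
    have -> : Num.max 0 (1 + n%:R * (y - c)) = 1 + n%:R * (y - c).
      by apply/max_idPr; rewrite addr_ge0// mulr_ge0// subr_ge0.
    rewrite (_ : Num.min _ _ = 1) ?mul1r//.
    by apply/min_idPl; rewrite lerDl mulr_ge0// subr_ge0.
  apply: cvg_near_cst; near=> n.
  rewrite (_ : Num.max 0 _ = 0); first by rewrite (_ : Num.min _ _ = 0) ?mul0r//; apply/min_idPr.
  have cy0 : 0 < c - y by rewrite subr_gt0.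
  have h1 : 1 <= n%:R * (c - y).
    rewrite -ler_pdivrMr// mul1r.
    by near: n; exact: nbhs_infty_ger.
  apply/max_idPl.
  rewrite (_ : _ + _ = 1 - n%:R * (c - y)); last by ring.
  by rewrite subr_le0.
have lim d (T : measurableType d) (m : {measure set T -> \bar R}) (f v : T -> R) :
    m.-integrable setT (EFin \o f) -> measurable_fun setT v ->
    \int[m]_x (f x * h n (v x)) @[n --> \oo] --> \int[m]_x (f x * inv_cut c (v x)).
  move=> fi mv.
  have mf : measurable_fun setT f by apply/measurable_EFinP; exact: measurable_int fi.
  have mh n : measurable_fun setT (fun x => f x * h n (v x)).
    apply: measurable_funM => //; apply: measurableT_comp => //.
    exact: continuous_measurable_fun.
  have chx x : f x * h n (v x) @[n --> \oo] --> f x * inv_cut c (v x).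
    by apply: cvgM; [exact: cvg_cst|exact: cvh].
  apply: (@cvg_Rintegral_dominated _ _ _ _ _ (fun x => 2 / c * `|f x|)) => //.
  - by apply: (measurable_fun_cvg mh) => x _; exact: chx.
  - exact: (integrableZl measurableT (2 / c) (integrable_norm fi)).
  - by move=> n x; rewrite normrM mulrC ler_wpM2r.
have h1 := lim _ _ _ _ _ mf1 mv1.
have h2 := lim _ _ _ _ _ mf2 mv2.
rewrite (_ : (fun n => _) = (fun n => \int[m2]_x (f2 x * h n (v2 x)))) in h1; last first.
  by apply/funext => n; exact: moments_continuous (ch n) (hM n).
exact: (cvg_unique _ h1 h2).
Unshelve. all: by end_near. Qed.

End moments.

(** * Independence and random evaluation *)

Section decoupling.
Local Open Scope ereal_scope.
Context {d d1 d2 : measure_display} {T : measurableType d}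
  {E1 : measurableType d1} {E2 : measurableType d2} {R : realType}.
Variable P : probability T R.
Variables (xi : T -> E1) (eta : T -> E2).
Hypotheses (mxi : measurable_fun setT xi) (meta : measurable_fun setT eta).
Hypothesis indep : forall A B, measurable A -> measurable B ->
  P (xi @^-1` A `&` eta @^-1` B) = P (xi @^-1` A) * P (eta @^-1` B).

Let X : {mfun T >-> E1} := mfun_Sub (mem_set mxi).
Let Y : {mfun T >-> E2} := mfun_Sub (mem_set meta).

Let mpair : measurable_fun setT (fun w => (xi w, eta w)).
Proof. exact: measurable_fun_pair. Qed.

Let Z : {mfun T >-> (E1 * E2)%type} := mfun_Sub (mem_set mpair).

(** The law of the pair is the product of the two laws.  Writing the result on two
    copies of the sample space replaces conditional expectations by partial
    integrals. *)
Lemma indep_integral (f : E1 * E2 -> \bar R) : measurable_fun setT f ->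
  (forall z, 0 <= f z) ->
  \int[P]_w f (xi w, eta w) = \int[P]_w1 \int[P]_w2 f (xi w1, eta w2).
Proof.
move=> mf f0.
transitivity (\int[distribution P Z]_z f z).
  by rewrite ge0_integral_distribution.
transitivity (\int[distribution P X \x distribution P Y]_z f z).
  apply/esym/eq_measure_integral => A mA _.
  apply: product_measure_unique => // B C mB mC; exact: indep.
rewrite fubini_tonelli1//.
rewrite ge0_integral_distribution; last 2 first.
- exact: measurable_fun_fubini_tonelli_F.
- by move=> x; exact: integral_ge0.
apply: eq_integral => w _; rewrite /fubini_F /=.
rewrite ge0_integral_distribution//.
by apply: measurableT_comp => //; exact: measurable_pair1.
Qed.

End decoupling.

Section evaluation.
Context {R : realType}.

(** A right-continuous process can be evaluated at a random time measurably:
    approximate the time from the right by times with countably many values. *)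
Lemma measurable_eval d1 d2 (T1 : measurableType d1) (T2 : measurableType d2)
    (L : R -> T1 -> R) (y : T2 -> R) :
  (forall t, 0 <= t -> measurable_fun setT (L t)) ->
  (forall w t, 0 <= t -> L s w @[s --> t^'+] --> L t w) ->
  measurable_fun setT y -> (forall w, 0 <= y w) ->
  measurable_fun setT (fun z : T1 * T2 => L (y z.2) z.1).
Proof.
move=> mL cL my y0.
pose k n (w : T2) : nat := Num.truncn (n.+1%:R * y w).
pose tn n (j : nat) : R := j.+1%:R / n.+1%:R.
have ny0 n w : 0 <= n.+1%:R * y w by rewrite mulr_ge0.
have mk n : measurable_fun setT (k n).
  move=> _ B _; rewrite setTI (_ : _ @^-1` B =
      \bigcup_(j in B) (y @^-1` `[j%:R / n.+1%:R, j.+1%:R / n.+1%:R[)).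
    apply: bigcup_measurable => j _; rewrite -[X in measurable X]setTI.
    by apply: my => //; exact: measurable_itv.
  have e w j : (y w \in `[j%:R / n.+1%:R, j.+1%:R / n.+1%:R[) = (k n w == j).
    rewrite in_itv/= ler_pdivrMr// ltr_pdivlMr// mulrC /k.
    by rewrite -truncn_ge_nat// -truncn_lt_nat// ltnS -eqn_leq eq_sym.
  apply/seteqP; split => [w Bw|w [j Bj]] /=.
    by exists (k n w) => //=; rewrite e.
  by rewrite e => /eqP ->.
have tn_gt n w : y w < tn n (k n w).
  by rewrite /tn /k ltr_pdivlMr// mulrC truncnS_gt.
have tn_le n w : tn n (k n w) <= y w + n.+1%:R^-1.
  by rewrite /tn /k ler_pdivrMr// mulrDl mulVf// -[(Num.truncn _).+1%:R]natr1 lerD2r [y w * _]mulrC truncn_le.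
pose F n (z : T1 * T2) := L (tn n (k n z.2)) z.1.
have mF n : measurable_fun setT (F n).
  move=> _ B mB; rewrite setTI.
  rewrite [X in measurable X](_ : _ =
    \bigcup_j ((L (tn n j) @^-1` B) `*` (k n @^-1` [set j]))); last first.
    apply/seteqP; split => [[w1 w2]/= h|[w1 w2] [j _] [/= h kj]].
      by exists (k n w2).
    by rewrite /F/= kj.
  apply: bigcup_measurable => j _; apply: measurableX.
    by rewrite -[X in measurable X]setTI; apply: mL => //; rewrite divr_ge0.
  by rewrite -[X in measurable X]setTI; exact: mk.
apply: (measurable_fun_cvg mF) => -[w1 w2] _ /=.
  have := cL w1 (y w2) (y0 w2).
  move/cvg_at_rightP; apply; split; first by move=> n; exact: tn_gt.
  apply: (@squeeze_cvgr _ _ _ _ (cst (y w2)) (fun n => y w2 + n.+1%:R^-1)).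
  + by apply: nearW => n; rewrite (ltW (tn_gt _ _)) tn_le.
  + exact: cvg_cst.
  + have h : y w2 + harmonic n @[n --> \oo] --> y w2 + 0.
      by apply: cvgD; [exact: cvg_cst|exact: cvg_harmonic].
    by rewrite addr0 in h.
Qed.

End evaluation.

(** * The potential of the subordinator *)

Section potential.
Local Open Scope ereal_scope.
Context {d : measure_display} {T : measurableType d} {R : realType}.
Notation mu := (@lebesgue_measure R).
Variable P : probability T R.
Variable D : R -> T -> R.
Hypothesis subD : subordinator P D.
Implicit Types (g h : R -> \bar R) (x t : R) (w : T).

Let lD := subD.1.
Let mD t : (0 <= t)%R -> measurable_fun setT (D t).
Proof. exact: levy_measurable lD t. Qed.
Let D0 w : D 0%R w = 0%R. Proof. exact: levy_start lD w. Qed.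
Let D_mono w s t : (0 <= s)%R -> (s <= t)%R -> (D s w <= D t w)%R.
Proof. exact: subD.2. Qed.

(** The process frozen at negative times, so that it is jointly measurable on the
    whole line and Lebesgue integrals over all times make sense. *)
Definition Dpos (x : R) (w : T) : R := D (Num.max x 0)%R w.

Lemma DposE x w : (0 <= x)%R -> Dpos x w = D x w.
Proof. by move=> x0; rewrite /Dpos max_l. Qed.

Lemma Dpos_ge0 x w : (0 <= Dpos x w)%R.
Proof. by rewrite -(D0 w) /Dpos D_mono// le_max lexx orbT. Qed.

Lemma measurable_Dpos : measurable_fun setT (fun z : R * T => Dpos z.1 z.2).
Proof.
have h := @measurable_eval R _ _ T R D (fun x : R => Num.max x 0%R) mD.
have sw : measurable_fun setT (@unstable.swap R T).
  exact: measurable_swap.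
have h' : measurable_fun setT (fun z : T * R => D (Num.max z.2 0%R) z.1).
  apply: h.
  - by move=> w t t0; exact: (levy_cadlag lD w).1.
  - by apply: measurable_maxr.
  - by move=> x; rewrite le_max lexx orbT.
exact: (measurableT_comp h' sw).
Qed.

Definition nonnegI (x : R) : \bar R := (\1_(`[0%R, +oo[%classic : set R) x)%:E.

Lemma nonnegI_ge0 x : 0 <= nonnegI x. Proof. by rewrite lee_fin. Qed.

Lemma nonnegIE x : nonnegI x = (if (0 <= x)%R then 1 else 0).
Proof. by rewrite /nonnegI indicE mem_setE in_itv/= andbT; case: ifP. Qed.

Lemma measurable_nonnegI : measurable_fun setT nonnegI.
Proof. by apply/measurable_EFinP; exact: measurable_indic. Qed.

Lemma measurable_Dpos1 w : measurable_fun setT (Dpos ^~ w).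
Proof. exact: (measurableT_comp measurable_Dpos (measurable_pair2 w)). Qed.

Definition Kpot (g : R -> \bar R) (z : R * T) := nonnegI z.1 * g (Dpos z.1 z.2).

Lemma measurable_Kpot g : measurable_fun setT g -> measurable_fun setT (Kpot g).
Proof.
move=> mg; apply: emeasurable_funM.
  exact: (measurableT_comp measurable_nonnegI measurable_fst).
exact: (measurableT_comp mg measurable_Dpos).
Qed.

Lemma Kpot_ge0 g z : (forall x, 0 <= g x) -> 0 <= Kpot g z.
Proof. by move=> g0; rewrite mule_ge0// nonnegI_ge0. Qed.

(** The potential [g |-> E int_0^oo g (D_x) dx] of the subordinator. *)
Definition pot (g : R -> \bar R) := \int[mu]_x \int[P]_w Kpot g (x, w).

Lemma pot_ge0 g : (forall x, 0 <= g x) -> 0 <= pot g.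
Proof. by move=> g0; do 2! apply: integral_ge0 => ? _; exact: Kpot_ge0. Qed.

Lemma pot_prod g : measurable_fun setT g -> (forall x, 0 <= g x) ->
  pot g = \int[mu \x P]_z Kpot g z.
Proof.
move=> mg g0; rewrite fubini_tonelli1//; first exact: measurable_Kpot.
by move=> z; exact: Kpot_ge0.
Qed.

Lemma le_pot g h : measurable_fun setT g -> measurable_fun setT h ->
  (forall x, 0 <= g x) -> (forall x, (0 <= x)%R -> g x <= h x) -> (forall x, 0 <= h x) ->
  pot g <= pot h.
Proof.
move=> mg mh g0 gh h0; rewrite !pot_prod//; apply: ge0_le_integral => //.
- by move=> z _; exact: Kpot_ge0.
- exact: measurable_Kpot.
- exact: measurable_Kpot.
- move=> z _; rewrite /Kpot lee_wpmul2l// ?nonnegI_ge0//.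
  by apply: gh; exact: Dpos_ge0.
Qed.

Lemma potZ (c : R) g : measurable_fun setT g -> (forall x, 0 <= g x) ->
  (0 <= c)%R -> pot (fun x => c%:E * g x) = c%:E * pot g.
Proof.
move=> mg g0 c0; rewrite !pot_prod//; last 2 first.
- exact: measurable_funeM.
- by move=> x; rewrite mule_ge0.
rewrite -ge0_integralZl//; last 2 first.
- exact: measurable_Kpot.
- by move=> z _; exact: Kpot_ge0.
by apply: eq_integral => z _; rewrite /Kpot muleCA.
Qed.

Lemma potD g h : measurable_fun setT g -> measurable_fun setT h ->
  (forall x, 0 <= g x) -> (forall x, 0 <= h x) ->
  pot (fun x => g x + h x) = pot g + pot h.
Proof.
move=> mg mh g0 h0; rewrite !pot_prod//; last 2 first.
- exact: emeasurable_funD.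
- by move=> x; rewrite adde_ge0.
rewrite -ge0_integralD//; last 4 first.
- by move=> z _; exact: Kpot_ge0.
- exact: measurable_Kpot.
- by move=> z _; exact: Kpot_ge0.
- exact: measurable_Kpot.
by apply: eq_integral => z _; rewrite /Kpot ge0_muleDr.
Qed.

Variables (C1 C2 a1 a2 : R).
Hypotheses (hC1 : (0 <= C1)%R) (hC2 : (0 < C2)%R).
Hypotheses (ha2 : (0 < a2)%R) (ha21 : (a2 < a1)%R) (ha1 : (a1 < 1)%R).
Hypothesis laplD : forall s t, (0 <= s)%R -> (0 <= t)%R ->
  'E_P[fun w => expR (- (s * D t w))] =
  (expR (- (t * (C1 * s `^ a1 + C2 * s `^ a2))))%:E.

Let measurable_expN (s : R) : measurable_fun setT (fun y : R => (expR (- (s * y)))%:E).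
Proof.
apply/measurable_EFinP; apply: measurableT_comp => //.
by apply: measurableT_comp => //; exact: measurable_funM.
Qed.

Lemma pot_expR s : (0 < s)%R ->
  pot (fun y => (expR (- (s * y)))%:E) = ((C1 * s `^ a1 + C2 * s `^ a2)^-1)%:E.
Proof.
move=> s0; set psi := (_ + _)%R.
have psi0 : (0 < psi)%R.
  by rewrite /psi ltr_wpDl ?mulr_ge0 ?powR_ge0// mulr_gt0// powR_gt0.
rewrite -integral_expR_ge0// [RHS]integral_mkcond; apply: eq_integral => x _.
rewrite patchE mem_setE in_itv/= andbT.
case: ifPn => x0; last first.
  apply: integral0_eq => w _.
  by rewrite /Kpot nonnegIE (negbTE x0) mul0e.
rewrite mulrC -laplD ?(ltW s0)// unlock; apply: eq_integral => w _.
by rewrite /Kpot nonnegIE x0 mul1e DposE.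
Qed.

Notation u := (pot_density C1 C2 a1 a2).

(** Both sides have the same Laplace transform.  At [k + 1] it is the [k]-th moment
    of [e^(- y)] for the finite measures with an extra weight [e^(- y)]; the weight
    is undone on [y <= b], that is on [e^(- y) >= e^(- b)]. *)
Lemma potential_cdf b : (0 <= b)%R ->
  pot (fun y => (\1_(`]-oo, b]%classic : set R) y)%:E) =
  \int[mu]_(t in `]0%R, b]) (u t)%:E.
Proof.
move=> b0.
pose f1 (z : R * T) : R := (\1_(`[0%R, +oo[%classic : set R) z.1 * expR (- Dpos z.1 z.2))%R.
pose v1 (z : R * T) : R := expR (- Dpos z.1 z.2).
pose f2 (t : R) : R := (expR (- t) * (\1_(`]0%R, +oo[%classic : set R) t * u t))%R.
pose v2 (t : R) : R := expR (- Num.max t 0)%R.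
have u0 t : (0 <= \1_(`]0%R, +oo[%classic : set R) t * u t)%R.
  by rewrite mulr_ge0// (pot_density_ge0 hC1 hC2 ha2 ha21 ha1).
have mv1 : measurable_fun setT v1.
  apply: measurableT_comp => //; apply: measurableT_comp => //.
  exact: measurable_Dpos.
have mv2 : measurable_fun setT v2.
  apply: measurableT_comp => //; apply: measurableT_comp => //.
  exact: measurable_maxr.
have f1E k : pot (fun y => (expR (- (k.+1%:R * y)))%:E) =
    \int[mu \x P]_z (f1 z * v1 z ^+ k)%:E.
  rewrite pot_prod//.
  apply: eq_integral => z _; rewrite /Kpot /nonnegI -EFinM /f1 /v1 -mulrA.
  by rewrite -expRM_natl -expRD; congr (_ * expR _)%:E; rewrite -natr1; ring.
have psi0 k : (0 < C1 * k.+1%:R `^ a1 + C2 * k.+1%:R `^ a2)%R.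
  by rewrite ltr_wpDl ?mulr_ge0 ?powR_ge0// mulr_gt0// powR_gt0.
have f2E k : \int[mu]_(t in `]0%R, +oo[) (expR (- (k.+1%:R * t)) * u t)%:E =
    \int[mu]_t (f2 t * v2 t ^+ k)%:E.
  rewrite integral_mkcond; apply: eq_integral => t _.
  rewrite patchE /f2 /v2 indicE; case: ifPn => tp; last by rewrite mul0r mulr0 mul0r.
  have t0 : (0 < t)%R by move: tp; rewrite inE/= in_itv/= andbT.
  rewrite max_l ?(ltW t0)// -expRM_natl mul1r mulrAC -expRD.
  by congr (expR _ * _)%:E; rewrite -natr1; ring.
have mf1 : measurable_fun setT f1.
  apply: measurable_funM => //.
  exact: (measurableT_comp (measurable_indic _) measurable_fst).
have mf2 : measurable_fun setT f2.
  apply: measurable_funM.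
    by apply: measurableT_comp => //; exact: measurableT_comp.
  exact: measurable_pot_density.
have if1 : (mu \x P).-integrable setT (EFin \o f1).
  apply/integrableP; split; first exact/measurable_EFinP.
  rewrite (_ : \int[_]_x _ = \int[mu \x P]_z (f1 z * v1 z ^+ 0)%:E).
    by rewrite -f1E pot_expR// ltry.
  by apply: eq_integral => z _; rewrite expr0 mulr1 /= ger0_norm// mulr_ge0// expR_ge0.
have if2 : mu.-integrable setT (EFin \o f2).
  apply/integrableP; split; first exact/measurable_EFinP.
  rewrite (_ : \int[_]_x _ = \int[mu]_t (f2 t * v2 t ^+ 0)%:E).
    by rewrite -f2E laplace_pot_density// ltry.
  by apply: eq_integral => t _; rewrite expr0 mulr1 /= ger0_norm// mulr_ge0 ?expR_ge0.
have v101 z : (0 <= v1 z <= 1)%R.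
  by rewrite expR_ge0 expR_le1 oppr_le0 Dpos_ge0.
have v201 z : (0 <= v2 z <= 1)%R.
  by rewrite expR_ge0 expR_le1 oppr_le0 le_max lexx orbT.
have mom k : (\int[(mu \x P)%E]_z (f1 z * v1 z ^+ k) = \int[mu]_t (f2 t * v2 t ^+ k))%R.
  rewrite /Rintegral -f1E -f2E pot_expR// laplace_pot_density//.
have c0 : (0 < expR (- b))%R by exact: expR_gt0.
have := moments_inv_cut if1 mv1 if2 mv2 v101 v201 mom c0.
have cutE y : inv_cut (expR (- b)) (expR (- y)) =
    (expR y * \1_(`]-oo, b]%classic : set R) y)%R.
  rewrite /inv_cut ler_expR lerN2 indicE mem_setE in_itv/=.
  by case: ifPn => yb; rewrite ?mulr1 ?mulr0// expRN invrK.
have m1b : measurable_fun setT (fun y : R => (\1_(`]-oo, b]%classic : set R) y)%:E : \bar R).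
  by apply/measurable_EFinP; exact: measurable_indic.
have e1 : \int[mu \x P]_z (f1 z * inv_cut (expR (- b)) (v1 z))%:E =
    pot (fun y => (\1_(`]-oo, b]%classic : set R) y)%:E).
  rewrite pot_prod//; apply: eq_integral => z _.
  rewrite /f1 /v1 cutE /Kpot /nonnegI -EFinM; congr EFin.
  by rewrite -mulrA [(expR _ * (expR _ * _))%R]mulrA -expRD addNr expR0 mul1r.
have e2 : \int[mu]_t (f2 t * inv_cut (expR (- b)) (v2 t))%:E =
    \int[mu]_(t in `]0%R, b]) (u t)%:E.
  rewrite [RHS]integral_mkcond; apply: eq_integral => t _.
  rewrite patchE /f2 /v2 cutE !indicE !mem_setE !in_itv/= andbT.
  have [t0|t0] := boolP (0 < t)%R => /=; last by rewrite mul0r mulr0 mul0r.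
  rewrite max_l ?(ltW t0)//; case: ifPn => tb; last by rewrite mulr0 mulr0.
  by rewrite mul1r mulr1 mulrAC -expRD addNr expR0 mul1r.
rewrite /Rintegral e1 e2.
have mcut : measurable_fun setT (fun y : R => expR y * \1_(`]-oo, b]%classic : set R) y)%R.
  by apply: measurable_funM => //; exact: measurable_indic.
have cutM y : (`|inv_cut (expR (- b)) (expR (- y))| <= expR b)%R.
  rewrite cutE indicE mem_setE in_itv/=; have [yb|yb] := boolP (y <= b)%R.
    by rewrite mulr1 ger0_norm ?expR_ge0// ler_expR.
  by rewrite mulr0 normr0 expR_ge0.
have mc1 : measurable_fun setT (fun z => inv_cut (expR (- b)) (v1 z)).
  rewrite (_ : (fun z => _) = (fun y : R => expR y * \1_(`]-oo, b]%classic : set R) y)%R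
     \o (fun z : R * T => Dpos z.1 z.2)); last by apply/funext => z; rewrite /v1 cutE.
  exact: (measurableT_comp mcut measurable_Dpos).
have mc2 : measurable_fun setT (fun z => inv_cut (expR (- b)) (v2 z)).
  rewrite (_ : (fun z => _) = (fun y : R => expR y * \1_(`]-oo, b]%classic : set R) y)%R
     \o (fun t : R => Num.max t 0%R)); last by apply/funext => z; rewrite /v2 cutE.
  by apply: (measurableT_comp mcut); exact: measurable_maxr.
have i1 := integrable_bounded_mul if1 mc1 (fun z => cutM _).
have i2 := integrable_bounded_mul if2 mc2 (fun z => cutM _).
have fin1 : pot (fun y => (\1_(`]-oo, b]%classic : set R) y)%:E) \is a fin_num.
  rewrite -e1; exact: (integrable_fin_num measurableT i1).
have fin2 : \int[mu]_(t in `]0%R, b]) (u t)%:E \is a fin_num.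
  rewrite -e2; exact: (integrable_fin_num measurableT i2).
by move=> h; rewrite -[LHS]fineK// h fineK.
Qed.

End potential.

(** * Second moments of occupation times *)

Section levy.
Local Open Scope ereal_scope.
Context {d : measure_display} {T : measurableType d} {R : realType}.
Variable P : probability T R.

Lemma same_law_integral d' (T' : measurableType d') (X Y : T -> T')
    (f : T' -> \bar R) : measurable_fun setT X -> measurable_fun setT Y ->
  same_law P X Y -> measurable_fun setT f -> (forall y, 0 <= f y) ->
  \int[P]_w f (X w) = \int[P]_w f (Y w).
Proof.
move=> mX mY XY mf f0.
pose X' : {mfun T >-> T'} := mfun_Sub (mem_set mX).
pose Y' : {mfun T >-> T'} := mfun_Sub (mem_set mY).
transitivity (\int[distribution P X']_y f y).
  by rewrite ge0_integral_distribution.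
transitivity (\int[distribution P Y']_y f y).
  by apply: eq_measure_integral => A mA _; exact: XY.
by rewrite ge0_integral_distribution.
Qed.

Variable L : R -> T -> R.
Hypothesis lL : levy_process P L.

Lemma measurable_increment s t : (0 <= s)%R -> (0 <= t)%R ->
  measurable_fun setT (fun w => L t w - L s w)%R.
Proof. by move=> s0 t0; apply: measurable_funB; apply: (levy_measurable lL). Qed.

(** Increments number 0 and 2 of the subdivision [t1, t2, t3, t4, t4, ...]. *)
Lemma levy_indep2 t1 t2 t3 t4 (A B : set R) :
  (0 <= t1)%R -> (t1 <= t2)%R -> (t2 <= t3)%R -> (t3 <= t4)%R ->
  measurable A -> measurable B ->
  P ((fun w => L t2 w - L t1 w)%R @^-1` A `&` (fun w => L t4 w - L t3 w)%R @^-1` B) =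
  P ((fun w => L t2 w - L t1 w)%R @^-1` A) * P ((fun w => L t4 w - L t3 w)%R @^-1` B).
Proof.
move=> h1 h2 h3 h4 mA mB.
pose t (i : nat) := nth t4 [:: t1; t2; t3] i.
have tS i : (t i <= t i.+1)%R.
  by case: i => [|[|[|i]]] //=; rewrite /t /= nth_nil.
have := levy_indep_increments lL h1 tS.
pose E i := if i == 0%N then (fun w => L t2 w - L t1 w)%R @^-1` A
  else (fun w => L t4 w - L t3 w)%R @^-1` B.
move=> /(_ [fset 0%N; 2%N]%fset E) h.
rewrite [X in P X](_ : _ = \bigcap_(i in [set` [fset 0%N; 2%N]%fset]) E i).
  rewrite h; last first.
    move=> i; rewrite !inE => /orP[/eqP ->|/eqP ->]; rewrite /E /=.
      by exists A => //; rewrite setTI.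
    by exists B => //; rewrite setTI.
  by rewrite big_fsetU1 ?inE//= big_seq_fset1.
apply/seteqP; split => [w [wA wB] i|w h'].
  by rewrite /= !inE => /orP[/eqP ->|/eqP ->].
by split; [apply: (h' 0%N)|apply: (h' 2%N)]; rewrite /= !inE.
Qed.

End levy.

Section square.
Local Open Scope ereal_scope.
Context {R : realType}.
Notation mu := (@lebesgue_measure R).
Implicit Types (a b f : R -> \bar R) (x h : R).

Definition posI x : \bar R := (\1_(`]0%R, +oo[%classic : set R) x)%:E.

Lemma posIE x : posI x = (if (0 < x)%R then 1 else 0).
Proof. by rewrite /posI indicE mem_setE in_itv/= andbT; case: ifP. Qed.

Lemma posI_ge0 x : 0 <= posI x. Proof. by rewrite lee_fin. Qed.

Lemma measurable_posI : measurable_fun setT posI.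
Proof. by apply/measurable_EFinP; exact: measurable_indic. Qed.

Lemma integral_posI f : measurable_fun setT f ->
  \int[mu]_h (posI h * f h) = \int[mu]_h (nonnegI h * f h).
Proof.
move=> mf.
transitivity (\int[mu]_(h in `]0%R, +oo[) f h).
  rewrite [RHS]integral_mkcond; apply: eq_integral => h _.
  rewrite patchE mem_setE in_itv/= andbT posIE.
  by case: ifPn => h0; rewrite ?mul1e ?mul0e.
rewrite integral_itv_obnd_cbnd; last exact: measurable_funTS.
rewrite [LHS]integral_mkcond; apply: eq_integral => h _.
rewrite patchE mem_setE in_itv/= andbT nonnegIE.
by case: ifPn => h0; rewrite ?mul1e ?mul0e.
Qed.

(** The plane is cut along its diagonal and each half-plane is sheared onto
    [R * [0, +oo[]. *)
Lemma mul_integral_shear a b : measurable_fun setT a -> measurable_fun setT b ->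
  (forall x, 0 <= a x) -> (forall x, 0 <= b x) ->
  (\int[mu]_x a x) * (\int[mu]_x b x) =
  \int[mu]_x \int[mu]_h (a x * (nonnegI h * b (x + h)%R)) +
  \int[mu]_x \int[mu]_h (b x * (nonnegI h * a (x + h)%R)).
Proof.
move=> ma mb a0 b0.
have ma1 : measurable_fun setT (fun z : R * R => a z.1).
  exact: (measurableT_comp ma measurable_fst).
have mb2 : measurable_fun setT (fun z : R * R => b z.2).
  exact: (measurableT_comp mb measurable_snd).
have mp : measurable_fun setT (fun z : R * R => posI (z.1 - z.2)%R).
  apply: (measurableT_comp measurable_posI).
  by apply: measurable_funB; [exact: measurable_fst|exact: measurable_snd].
have mn : measurable_fun setT (fun z : R * R => nonnegI (z.2 - z.1)%R).
  apply: (measurableT_comp measurable_nonnegI).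
  by apply: measurable_funB; [exact: measurable_snd|exact: measurable_fst].
pose F1 (z : R * R) := a z.1 * (nonnegI (z.2 - z.1)%R * b z.2).
pose F2 (z : R * R) := b z.2 * (posI (z.1 - z.2)%R * a z.1).
have mF1 : measurable_fun setT F1.
  by apply: emeasurable_funM => //; exact: emeasurable_funM.
have mF2 : measurable_fun setT F2.
  by apply: emeasurable_funM => //; exact: emeasurable_funM.
have F10 z : 0 <= F1 z by rewrite /F1 !mule_ge0// nonnegI_ge0.
have F20 z : 0 <= F2 z by rewrite /F2 !mule_ge0// posI_ge0.
transitivity (\int[mu]_x \int[mu]_y (F1 (x, y) + F2 (x, y))).
  rewrite muleC -ge0_integralZl//; last by apply: integral_ge0.
  apply: eq_integral => x _; rewrite muleC -ge0_integralZl//.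
  apply: eq_integral => y _; rewrite /F1 /F2/= nonnegIE posIE subr_ge0 subr_gt0.
  by have [xy|xy] := leP x y; rewrite ?(mul1e, mul0e, mule0, adde0, add0e)// muleC.
transitivity (\int[mu]_x (\int[mu]_y F1 (x, y) + \int[mu]_y F2 (x, y))).
  apply: eq_integral => x _; rewrite ge0_integralD//.
  - exact: measurableT_comp mF1 (measurable_pair1 x).
  - exact: measurableT_comp mF2 (measurable_pair1 x).
have i1 := @measurable_fun_fubini_tonelli_F _ _ _ _ R mu F1 mF1 F10.
have i2 := @measurable_fun_fubini_tonelli_F _ _ _ _ R mu F2 mF2 F20.
have j1 x : setT x -> 0 <= fubini_F mu F1 x by move=> _; apply: integral_ge0.
have j2 x : setT x -> 0 <= fubini_F mu F2 x by move=> _; apply: integral_ge0.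
rewrite (ge0_integralD mu measurableT j1 i1 j2 i2) {i1 i2 j1 j2}.
have e1 : \int[mu]_x fubini_F mu F1 x =
    \int[mu]_x \int[mu]_h (a x * (nonnegI h * b (x + h)%R)).
  apply: eq_integral => x _; rewrite /fubini_F.
  have mF1x : measurable_fun setT (fun y => F1 (x, y)).
    exact: measurableT_comp mF1 (measurable_pair1 x).
  rewrite -(ge0_integral_shift x mF1x (fun y => F10 (x, y))).
  by apply: eq_integral => h _; rewrite /F1/= addrK [(h + x)%R]addrC.
have e2 : \int[mu]_x fubini_F mu F2 x =
    \int[mu]_x \int[mu]_h (b x * (nonnegI h * a (x + h)%R)).
  have -> : \int[mu]_x fubini_F mu F2 x = \int[mu]_y \int[mu]_x F2 (x, y).
    exact: (@fubini_tonelli _ _ _ _ R mu mu F2 mF2 F20).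
  apply: eq_integral => y _.
  have mF2y : measurable_fun setT (fun x => F2 (x, y)).
    exact: measurableT_comp mF2 (measurable_pair2 y).
  rewrite -(ge0_integral_shift y mF2y (fun x => F20 (x, y))).
  transitivity (\int[mu]_h (posI h * (b y * a (y + h)%R))).
    by apply: eq_integral => h _; rewrite /F2/= addrK [(h + y)%R]addrC muleCA.
  rewrite integral_posI; first by apply: eq_integral => h _; rewrite muleCA.
  apply: measurable_funeM; apply: (measurableT_comp ma).
  exact: measurable_funD.
by rewrite e1 e2.
Qed.

End square.

Section occupation.
Local Open Scope ereal_scope.
Context {d : measure_display} {T : measurableType d} {R : realType}.
Notation mu := (@lebesgue_measure R).
Variable P : probability T R.
Variable D : R -> T -> R.
Hypothesis subD : subordinator P D.
Implicit Types (f g : R -> \bar R) (x h t : R) (w : T).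

Let lD := subD.1.
Let mD t : (0 <= t)%R -> measurable_fun setT (D t).
Proof. exact: levy_measurable lD t. Qed.
Let D0 w : D 0%R w = 0%R. Proof. exact: levy_start lD w. Qed.

Notation Kpot := (Kpot D).
Notation pot := (pot P D).

(** Markov property: after time [x] the process starts afresh from its position. *)
Lemma subordinator_two_times x h (F : R * R -> \bar R) :
  (0 <= x)%R -> (0 <= h)%R -> measurable_fun setT F -> (forall z, 0 <= F z) ->
  \int[P]_w F (D x w, D (x + h)%R w - D x w)%R =
  \int[P]_w1 \int[P]_w2 F (D x w1, D h w2).
Proof.
move=> x0 h0 mF F0.
have xh0 : (0 <= x + h)%R by rewrite addr_ge0.
have mI := measurable_increment lD x0 xh0.
rewrite (@indep_integral _ _ _ _ _ _ _ P (D x) (fun w => D (x + h)%R w - D x w)%R)//.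
- apply: eq_integral => w1 _.
  apply: (@same_law_integral _ _ _ P _ _ (fun w => D (x + h)%R w - D x w)%R (D h)
    (fun y => F (D x w1, y))) => //.
  + exact: mD.
  + by apply: (levy_stationary_increments lD).
  + exact: measurableT_comp mF (measurable_pair1 _).
- exact: mD.
- move=> A B mA mB.
  have := @levy_indep2 _ _ _ P D lD 0%R x x (x + h)%R A B (lexx _) x0 (lexx _) _ mA mB.
  rewrite lerDl => /(_ h0).
  rewrite (_ : (fun w => D x w - D 0 w)%R = D x)//.
  by apply/funext => w; rewrite D0 subr0.
Qed.

(** Total time spent by the path under the weight [g]. *)
Definition occ g w := \int[mu]_x Kpot g (x, w).

Lemma occ_ge0 g w : (forall x, 0 <= g x) -> 0 <= occ g w.
Proof. by move=> g0; apply: integral_ge0 => x _; exact: Kpot_ge0. Qed.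

Let mK g : measurable_fun setT g -> measurable_fun setT (Kpot g).
Proof. exact: (measurable_Kpot subD). Qed.

Lemma measurable_occ g : measurable_fun setT g -> (forall x, 0 <= g x) ->
  measurable_fun setT (occ g).
Proof.
move=> mg g0.
exact: (@measurable_fun_fubini_tonelli_G _ _ _ _ R mu _ (mK mg) (fun z => Kpot_ge0 _ z g0)).
Qed.

Lemma integral_occ g : measurable_fun setT g -> (forall x, 0 <= g x) ->
  \int[P]_w occ g w = pot g.
Proof.
move=> mg g0; apply/esym.
exact: (@fubini_tonelli _ _ _ _ R mu P _ (mK mg) (fun z => Kpot_ge0 _ z g0)).
Qed.

Definition Kpair f g (z : (R * T) * (R * T)) : \bar R :=
  Kpot f z.1 * (nonnegI z.2.1 * g (Dpos D z.1.1 z.1.2 + Dpos D z.2.1 z.2.2)%R).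

Lemma measurable_Kpair f g : measurable_fun setT f -> measurable_fun setT g ->
  measurable_fun setT (Kpair f g).
Proof.
move=> mf mg; apply: emeasurable_funM.
  exact: measurableT_comp (mK mf) measurable_fst.
apply: emeasurable_funM.
  apply: (measurableT_comp measurable_nonnegI).
  exact: measurableT_comp measurable_fst measurable_snd.
apply: (measurableT_comp mg); apply: measurable_funD.
  exact: measurableT_comp (measurable_Dpos subD) measurable_fst.
exact: measurableT_comp (measurable_Dpos subD) measurable_snd.
Qed.

Lemma Kpair_ge0 f g z : (forall x, 0 <= f x) -> (forall x, 0 <= g x) ->
  0 <= Kpair f g z.
Proof.
by move=> f0 g0; rewrite mule_ge0 ?Kpot_ge0// mule_ge0// nonnegI_ge0.
Qed.

Section pot_fubini.
Context {d' : measure_display} {T' : measurableType d'}.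
Variables (F : T' * R -> \bar R).
Hypotheses (mF : measurable_fun setT F) (F0 : forall z, 0 <= F z).

Let K1 (z : (T' * R) * T) := nonnegI z.1.2 * F (z.1.1, Dpos D z.1.2 z.2).

Let mK1 : measurable_fun setT K1.
Proof.
apply: emeasurable_funM.
  apply: (measurableT_comp measurable_nonnegI).
  exact: measurableT_comp measurable_snd measurable_fst.
apply: (measurableT_comp mF); apply: measurable_fun_pair.
  exact: measurableT_comp measurable_fst measurable_fst.
have mp : measurable_fun setT (fun z : (T' * R) * T => (z.1.2, z.2)).
  apply: measurable_fun_pair; last exact: measurable_snd.
  exact: measurableT_comp measurable_snd measurable_fst.
exact: (measurableT_comp (measurable_Dpos subD) mp).
Qed.

Let K10 z : 0 <= K1 z. Proof. by rewrite mule_ge0 ?nonnegI_ge0. Qed.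
Let mK2 := @measurable_fun_fubini_tonelli_F _ _ _ _ R P K1 mK1 K10.
Let K20 z : 0 <= fubini_F P K1 z. Proof. by apply: integral_ge0. Qed.

Lemma measurable_pot_param : measurable_fun setT (fun z : T' => pot (fun y => F (z, y))).
Proof. exact: (@measurable_fun_fubini_tonelli_F _ _ _ _ R mu _ mK2 K20). Qed.

Lemma integral_pot (m : {sigma_finite_measure set T' -> \bar R}) :
  \int[m]_z pot (fun y => F (z, y)) = pot (fun y => \int[m]_z F (z, y)).
Proof.
transitivity (\int[mu]_x \int[m]_z fubini_F P K1 (z, x)).
  exact: (@fubini_tonelli _ _ _ _ R m mu _ mK2 K20).
apply: eq_integral => x _.
have mx : measurable_fun setT (fun z : T' * T => ((z.1, x), z.2)).
  apply: measurable_fun_pair; last exact: measurable_snd.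
  by apply: measurable_fun_pair; [exact: measurable_fst|exact: measurable_cst].
pose K3 (z : T' * T) := K1 ((z.1, x), z.2).
have mK3 : measurable_fun setT K3 by exact: measurableT_comp mK1 mx.
transitivity (\int[P]_w \int[m]_z K3 (z, w)).
  exact: (@fubini_tonelli _ _ _ _ R m P K3 mK3 (fun z => K10 _)).
apply: eq_integral => w _; rewrite /K3 /K1 /Kpot /=.
rewrite ge0_integralZl ?nonnegI_ge0//.
exact: measurableT_comp mF (measurable_pair2 _).
Qed.

End pot_fubini.

Lemma pot_swap (F : R * R -> \bar R) : measurable_fun setT F ->
  (forall z, 0 <= F z) ->
  pot (fun x => pot (fun y => F (x, y))) = pot (fun y => pot (fun x => F (x, y))).
Proof.
move=> mF F0.
have n0 z : 0 <= nonnegI z by exact: nonnegI_ge0.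
have mDF : measurable_fun setT (fun z : (R * T) * R => (Dpos D z.1.1 z.1.2, z.2)).
  apply: measurable_fun_pair; last exact: measurable_snd.
  exact: (measurableT_comp (measurable_Dpos subD) measurable_fst).
pose G (z : (R * T) * R) := nonnegI z.1.1 * F (Dpos D z.1.1 z.1.2, z.2).
have mG : measurable_fun setT G.
  apply: emeasurable_funM; last exact: measurableT_comp mF mDF.
  apply: (measurableT_comp measurable_nonnegI).
  exact: measurableT_comp measurable_fst measurable_fst.
have G0 z : 0 <= G z by rewrite mule_ge0.
have mG1 x : measurable_fun setT (fun z : T * R => G ((x, z.1), z.2)).
  apply: (measurableT_comp mG); apply: measurable_fun_pair; last exact: measurable_snd.
  by apply: measurable_fun_pair; [exact: measurable_cst|exact: measurable_fst].
pose H (z : R * R) := \int[P]_w G ((z.1, w), z.2).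
have mH : measurable_fun setT H.
  have mG2 : measurable_fun setT (fun z : (R * R) * T => G ((z.1.1, z.2), z.1.2)).
    apply: (measurableT_comp mG); apply: measurable_fun_pair.
      apply: measurable_fun_pair; last exact: measurable_snd.
      exact: measurableT_comp measurable_fst measurable_fst.
    exact: measurableT_comp measurable_snd measurable_fst.
  exact: (@measurable_fun_fubini_tonelli_F _ _ _ _ R P _ mG2 (fun z => G0 _)).
have H0 z : 0 <= H z by apply: integral_ge0.
transitivity (\int[mu]_x pot (fun y => H (x, y))); last exact: (@integral_pot _ (measurableTypeR R) H mH H0 mu).
apply: eq_integral => x _.
rewrite -[RHS](integral_pot (mG1 x) (fun z => G0 _) P).
apply: eq_integral => w _; rewrite /Kpot /nonnegI -potZ//.
exact: measurableT_comp mF (measurable_pair1 _).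
Qed.

Lemma measurable_pot_shift g : measurable_fun setT g -> (forall x, 0 <= g x) ->
  measurable_fun setT (fun a : R => pot (fun y => g (a + y)%R)).
Proof.
move=> mg g0; apply: (@measurable_pot_param _ _ (fun z : R * R => g (z.1 + z.2)%R)) => //.
apply: (measurableT_comp mg).
by apply: measurable_funD; [exact: measurable_fst|exact: measurable_snd].
Qed.

(** Mean weight of the pairs of times, the earlier one weighted by [f] and the later
    one by [g]: from the earlier position on, the process starts afresh. *)
Definition pair_pot f g := pot (fun a => f a * pot (fun y => g (a + y)%R)).

Let Ghalf f g (z : (T * R) * R) : \bar R :=
  Kpot f (z.1.2, z.1.1) * (nonnegI z.2 * Kpot g ((z.1.2 + z.2)%R, z.1.1)).

Let mGhalf f g : measurable_fun setT f -> measurable_fun setT g ->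
  measurable_fun setT (Ghalf f g).
Proof.
move=> mf mg.
have m11 : measurable_fun setT (fun z : (T * R) * R => z.1.1).
  exact: measurableT_comp measurable_fst measurable_fst.
have m12 : measurable_fun setT (fun z : (T * R) * R => z.1.2).
  exact: measurableT_comp measurable_snd measurable_fst.
have m2 : measurable_fun setT (fun z : (T * R) * R => z.2) by exact: measurable_snd.
apply: emeasurable_funM.
  by apply: (measurableT_comp (mK mf)); exact: measurable_fun_pair.
apply: emeasurable_funM; first exact: (measurableT_comp measurable_nonnegI).
apply: (measurableT_comp (mK mg)); apply: measurable_fun_pair => //.
exact: measurable_funD.
Qed.

Let Ghalf_ge0 f g z : (forall x, 0 <= f x) -> (forall x, 0 <= g x) ->
  0 <= Ghalf f g z.
Proof.
move=> f0 g0; apply: mule_ge0; first exact: Kpot_ge0.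
by apply: mule_ge0; [exact: nonnegI_ge0|exact: Kpot_ge0].
Qed.

Let Ghalf_expect f g x h : measurable_fun setT f -> measurable_fun setT g ->
  (forall x, 0 <= f x) -> (forall x, 0 <= g x) ->
  \int[P]_w Ghalf f g ((w, x), h) =
  \int[P]_w1 \int[P]_w2 Kpair f g ((x, w1), (h, w2)).
Proof.
move=> mf mg f0 g0; rewrite /Ghalf /Kpair /Kpot /=.
have [x0|x0] := leP 0%R x; last first.
  have nx : nonnegI x = 0 by rewrite nonnegIE leNgt x0.
  rewrite integral0_eq; last by move=> w _; rewrite nx !mul0e.
  rewrite integral0_eq// => w _; rewrite integral0_eq// => w2 _.
  by rewrite nx !mul0e.
have [h0|h0] := leP 0%R h; last first.
  have nh : nonnegI h = 0 by rewrite nonnegIE leNgt h0.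
  rewrite integral0_eq; last by move=> w _; rewrite nh mul0e mule0.
  rewrite integral0_eq// => w _; rewrite integral0_eq// => w2 _.
  by rewrite nh mul0e mule0.
have xh0 : (0 <= x + h)%R by rewrite addr_ge0.
have n1 : nonnegI x = 1 by rewrite nonnegIE x0.
have n2 : nonnegI h = 1 by rewrite nonnegIE h0.
have n3 : nonnegI (x + h)%R = 1 by rewrite nonnegIE xh0.
pose F (z : R * R) := f z.1 * g (z.1 + z.2)%R.
have mF : measurable_fun setT F.
  apply: emeasurable_funM; first exact: measurableT_comp mf measurable_fst.
  apply: (measurableT_comp mg).
  by apply: measurable_funD; [exact: measurable_fst|exact: measurable_snd].
have F0 z : 0 <= F z by rewrite mule_ge0.
transitivity (\int[P]_w F (D x w, D (x + h)%R w - D x w)%R).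
  by apply: eq_integral => w _; rewrite n1 n2 n3 !mul1e !DposE// /F/= subrKC.
rewrite (subordinator_two_times x0 h0 mF F0).
apply: eq_integral => w1 _; apply: eq_integral => w2 _.
by rewrite n1 n2 !mul1e !DposE.
Qed.

(* The order of the four integrals is rearranged one Tonelli exchange at a time, so
   that the two sample points of the Markov property become innermost. *)
Let half_expect f g : measurable_fun setT f -> measurable_fun setT g ->
  (forall x, 0 <= f x) -> (forall x, 0 <= g x) ->
  measurable_fun setT (fun w => \int[mu]_x \int[mu]_h Ghalf f g ((w, x), h)) /\
  \int[P]_w \int[mu]_x \int[mu]_h Ghalf f g ((w, x), h) = pair_pot f g.
Proof.
move=> mf mg f0 g0.
have mG := mGhalf mf mg; have G0 z := @Ghalf_ge0 f g z f0 g0.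
pose H := fubini_F mu (Ghalf f g).
have mH : measurable_fun setT H.
  exact: (@measurable_fun_fubini_tonelli_F _ _ _ _ R mu _ mG G0).
have H0 z : 0 <= H z by apply: integral_ge0.
split; first exact: (@measurable_fun_fubini_tonelli_F _ _ _ _ R mu _ mH H0).
transitivity (\int[mu]_x \int[P]_w H (w, x)).
  exact: (@fubini_tonelli _ _ _ _ R P mu H mH H0).
rewrite /pair_pot.
have mKp := measurable_Kpair mf mg; have Kp0 z := @Kpair_ge0 f g z f0 g0.
apply: eq_integral => x _.
pose G' (z : T * R) := Ghalf f g ((z.1, x), z.2).
have mG' : measurable_fun setT G'.
  apply: (measurableT_comp mG); apply: measurable_fun_pair.
    by apply: measurable_fun_pair; [exact: measurable_fst|exact: measurable_cst].
  exact: measurable_snd.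
transitivity (\int[mu]_h \int[P]_w G' (w, h)).
  exact: (@fubini_tonelli _ _ _ _ R P mu G' mG' (fun z => G0 _)).
pose K' (z : (R * T) * T) := Kpair f g ((x, z.1.2), (z.1.1, z.2)).
have mK' : measurable_fun setT K'.
  apply: (measurableT_comp mKp); apply: measurable_fun_pair.
    apply: measurable_fun_pair; first exact: measurable_cst.
    exact: measurableT_comp measurable_snd measurable_fst.
  apply: measurable_fun_pair; last exact: measurable_snd.
  exact: measurableT_comp measurable_fst measurable_fst.
pose K2 := fubini_F P K'.
have mK2 : measurable_fun setT K2.
  exact: (@measurable_fun_fubini_tonelli_F _ _ _ _ R P _ mK' (fun z => Kp0 _)).
have K20 z : 0 <= K2 z by apply: integral_ge0 => w _; exact: Kp0.
transitivity (\int[mu]_h \int[P]_w1 K2 (h, w1)).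
  by apply: eq_integral => h _; exact: Ghalf_expect.
transitivity (\int[P]_w1 \int[mu]_h K2 (h, w1)).
  exact: (@fubini_tonelli _ _ _ _ R mu P K2 mK2 K20).
apply: eq_integral => w1 _.
transitivity ((nonnegI x * f (Dpos D x w1)) *
  pot (fun y => g (Dpos D x w1 + y)%R)); last by rewrite -muleA.
have nf0 : 0 <= nonnegI x * f (Dpos D x w1) by rewrite mule_ge0 ?nonnegI_ge0.
have mg1 : measurable_fun setT (fun y => g (Dpos D x w1 + y)%R).
  by apply: (measurableT_comp mg); exact: measurable_funD.
have mKg := mK mg1; have Kg0 z : 0 <= Kpot (fun y => g (Dpos D x w1 + y)%R) z.
  exact: Kpot_ge0.
rewrite -ge0_integralZl//; last 2 first.
- exact: (@measurable_fun_fubini_tonelli_F _ _ _ _ R P _ mKg Kg0).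
- by move=> h _; apply: integral_ge0.
apply: eq_integral => h _; rewrite -ge0_integralZl//.
exact: measurableT_comp mKg (measurable_pair1 h).
Qed.

(** A pair of times is ordered in one of two ways; the later visit is then counted
    from the earlier one. *)
Lemma integral_occ_mul f g : measurable_fun setT f -> measurable_fun setT g ->
  (forall x, 0 <= f x) -> (forall x, 0 <= g x) ->
  \int[P]_w (occ f w * occ g w) = pair_pot f g + pair_pot g f.
Proof.
move=> mf mg f0 g0.
have [m1 e1] := half_expect mf mg f0 g0.
have [m2 e2] := half_expect mg mf g0 f0.
pose S1 w := \int[mu]_x \int[mu]_h Ghalf f g ((w, x), h).
pose S2 w := \int[mu]_x \int[mu]_h Ghalf g f ((w, x), h).
have S10 w : setT w -> 0 <= S1 w.
  by move=> _; do 2! apply: integral_ge0 => ? _; exact: Ghalf_ge0.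
have S20 w : setT w -> 0 <= S2 w.
  by move=> _; do 2! apply: integral_ge0 => ? _; exact: Ghalf_ge0.
transitivity (\int[P]_w (S1 w + S2 w)).
  apply: eq_integral => w _.
  apply: (mul_integral_shear (a := fun x => Kpot f (x, w)) (b := fun x => Kpot g (x, w))).
  - exact: measurableT_comp (mK mf) (measurable_pair2 w).
  - exact: measurableT_comp (mK mg) (measurable_pair2 w).
  - by move=> x; exact: Kpot_ge0.
  - by move=> x; exact: Kpot_ge0.
by rewrite (ge0_integralD P measurableT S10 m1 S20 m2) -e1 -e2.
Qed.

End occupation.

(** * Occupation of windows *)

Section increments.
Local Open Scope ereal_scope.
Context {d : measure_display} {T : measurableType d} {R : realType}.
Notation mu := (@lebesgue_measure R).
Variable P : probability T R.
Variable D : R -> T -> R.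
Hypothesis subD : subordinator P D.
Notation pot := (pot P D).

Definition leI (b : R) (y : R) : \bar R := (\1_(`]-oo, b]%classic : set R) y)%:E.
Definition itvI (a b : R) (y : R) : \bar R := (\1_(`]a, b]%classic : set R) y)%:E.

Lemma leI_ge0 b y : 0 <= leI b y. Proof. by rewrite lee_fin. Qed.
Lemma itvI_ge0 a b y : 0 <= itvI a b y. Proof. by rewrite lee_fin. Qed.

Lemma leIE b y : leI b y = if (y <= b)%R then 1 else 0.
Proof. by rewrite /leI indicE mem_setE in_itv/=; case: ifP. Qed.

Lemma itvIE a b y : itvI a b y = if (a < y <= b)%R then 1 else 0.
Proof. by rewrite /itvI indicE mem_setE in_itv/=; case: ifP. Qed.

Lemma measurable_leI b : measurable_fun setT (leI b).
Proof. by apply/measurable_EFinP; exact: measurable_indic. Qed.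

Lemma measurable_itvI a b : measurable_fun setT (itvI a b).
Proof. by apply/measurable_EFinP; exact: measurable_indic. Qed.

Lemma eq_pot (g h : R -> \bar R) : (forall y, (0 <= y)%R -> g y = h y) ->
  pot g = pot h.
Proof.
move=> gh; apply: eq_integral => x _; apply: eq_integral => w _.
by rewrite /Kpot gh// (Dpos_ge0 subD).
Qed.

Variables u v : R -> R.
Hypothesis u_ge0 : forall t, (0 <= u t)%R.
Hypothesis measurable_u : measurable_fun setT
  (fun t => \1_(`]0%R, +oo[%classic : set R) t * u t)%R.
Hypothesis u_le : forall s t, (0 < s)%R -> (s <= t)%R -> (u t <= u s)%R.
Hypothesis v_le : forall s t, (0 < s)%R -> (s <= t)%R -> (v t <= v s)%R.
Hypothesis v_ge0 : forall t, (0 < t)%R -> (0 <= v t)%R.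
Hypothesis u_diff : forall x y, (0 <= x)%R -> (x < y)%R ->
  (x * v y <= u (y - x) - u y <= x * v (y - x))%R.
Hypothesis cdf_pot : forall b, (0 <= b)%R ->
  pot (leI b) = \int[mu]_(t in `]0%R, b]) (u t)%:E.
Hypothesis cdf_fin : forall b, (0 <= b)%R -> pot (leI b) < +oo.

Lemma pot_itvI_fin a b : (0 <= b)%R -> pot (itvI a b) < +oo.
Proof.
move=> b0; apply: le_lt_trans (cdf_fin b0).
apply: (le_pot subD (measurable_itvI _ _) (measurable_leI _) (itvI_ge0 _ _)).
  move=> y _; rewrite itvIE leIE; case: (y <= b)%R; rewrite ?andbT ?andbF//.
  by case: ifP.
exact: leI_ge0.
Qed.

Let measurable_u' (a b : R) : (0 <= a)%R -> measurable_fun `]a, b] (EFin \o u).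
Proof.
move=> a0; apply/measurable_EFinP.
apply: (eq_measurable_fun (fun t => \1_(`]0%R, +oo[%classic : set R) t * u t)%R).
  move=> t; rewrite inE/= in_itv/= => /andP[at_ _].
  by rewrite indicE mem_setE in_itv/= andbT (le_lt_trans a0 at_) mul1r.
exact: measurable_funTS.
Qed.

Lemma pot_itv (a b : R) : (0 <= a)%R -> (a <= b)%R ->
  pot (itvI a b) = \int[mu]_(t in `]a, b]) (u t)%:E.
Proof.
move=> a0 ab; have b0 := le_trans a0 ab.
have fa : pot (leI a) \is a fin_num.
  by rewrite ge0_fin_numE ?cdf_fin//; apply: pot_ge0; exact: leI_ge0.
have e1 : pot (leI b) = pot (leI a) + pot (itvI a b).
  rewrite -(potD subD (measurable_leI a) (measurable_itvI a b) (leI_ge0 a) (itvI_ge0 a b)).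
  apply: eq_pot => y _; rewrite !leIE itvIE ltNge.
  have [ya|ya] := leP y a; rewrite ?add0e//= (le_trans ya ab).
  by rewrite adde0.
have e2 : \int[mu]_(t in `]0%R, b]) (u t)%:E =
    pot (leI a) + \int[mu]_(t in `]a, b]) (u t)%:E.
  have sU : `]0%R, b]%classic = `]0%R, a]%classic `|` `]a, b]%classic :> set R.
    by rewrite -itv_bndbnd_setU ?bnd_simp.
  have mU : measurable_fun (`]0%R, a] `|` `]a, b] : set R) (EFin \o u).
    by rewrite -sU; exact: measurable_u'.
  rewrite cdf_pot// sU; apply: ge0_integral_setU => //.
    by move=> t _; rewrite lee_fin.
  apply/disj_setPRL => t/=; rewrite !in_itv/= => /andP[h _].
  by apply/negP; rewrite negb_and -ltNge h orbT.
have h : pot (itvI a b) + pot (leI a) = \int[mu]_(t in `]a, b]) (u t)%:E + pot (leI a).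
  by rewrite addeC -e1 addeC -e2 cdf_pot.
by rewrite -[LHS](addeK _ fa) h addeK.
Qed.

Lemma pot_itv_bounds (a b : R) : (0 < a)%R -> (a <= b)%R ->
  ((b - a) * u b)%:E <= pot (itvI a b) <= ((b - a) * u a)%:E.
Proof.
move=> a0 ab; rewrite pot_itv ?(ltW a0)//.
have leb : mu `]a, b] = (b - a)%:E.
  rewrite lebesgue_measure_itv/= lte_fin -EFinD; case: ltP => // ba.
  by rewrite (@le_anti _ _ a b) ?subrr ?ab.
have c (k : R) : \int[mu]_(t in `]a, b]) (cst k%:E t) = ((b - a) * k)%:E.
  by rewrite integral_cst//= leb mulrC EFinM.
rewrite -!c; apply/andP; split.
- apply: ge0_le_integral => //.
  + by move=> t _; rewrite lee_fin.
  + exact: measurable_u' (ltW a0).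
  + move=> t; rewrite /= in_itv/= lee_fin => /andP[at_ tb].
    by rewrite u_le// (lt_trans a0).
- apply: ge0_le_integral => //.
  + by move=> t _; rewrite lee_fin.
  + exact: measurable_u' (ltW a0).
  + move=> t; rewrite /= in_itv/= lee_fin => /andP[at_ tb].
    by rewrite u_le// ltW.
Qed.

(** The bounds on the increments of the density, integrated over the window. *)
Lemma pot_itv_diff (x t dl : R) : (0 <= x)%R -> (x < t)%R -> (0 <= dl)%R ->
  pot (itvI t (t + dl)) + (dl * (x * v (t + dl)))%:E <=
    pot (itvI (t - x) (t - x + dl)) <=
  pot (itvI t (t + dl)) + (dl * (x * v (t - x)))%:E.
Proof.
move=> x0 xt d0.
have t0 : (0 < t)%R by exact: le_lt_trans xt.
have tx0 : (0 < t - x)%R by rewrite subr_gt0.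
rewrite !pot_itv ?(ltW t0) ?(ltW tx0) ?lerDl//.
have mu' := @measurable_u' t (t + dl)%R (ltW t0).
have mux : measurable_fun (`]t, (t + dl)%R]%classic : set R) (EFin \o (fun y : R => u (y - x)%R)).
  apply/measurable_EFinP.
  apply: (eq_measurable_fun (fun y : R => \1_(`]0%R, +oo[%classic : set R) (y - x) * u (y - x))%R).
    move=> y; rewrite inE/= in_itv/= => /andP[ty _].
    by rewrite indicE mem_setE in_itv/= andbT subr_gt0 (lt_trans xt ty) mul1r.
  apply: measurable_funTS; apply: (measurableT_comp measurable_u).
  exact: measurable_funB.
have -> : \int[mu]_(s in `](t - x)%R, (t - x + dl)%R]) (u s)%:E =
    \int[mu]_(y in `]t, (t + dl)%R]) (u (y - x))%:E.
  rewrite integral_mkcond [RHS]integral_mkcond.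
  rewrite -(@ge0_integral_shift _ (- x)%R); last 2 first.
  - apply/(measurable_restrictT _ _).1 => //; apply: measurable_u'; exact: ltW.
  - by move=> y; rewrite patchE; case: ifP => // _; rewrite lee_fin.
  apply: eq_integral => y _; rewrite !patchE !mem_setE !in_itv/=.
  by rewrite ltrD2r addrAC lerD2r.
have leb : mu `]t, (t + dl)%R] = dl%:E.
  rewrite lebesgue_measure_itv/= lte_fin -EFinD addrAC subrr add0r.
  case: ltP => // h; congr EFin; apply/esym/le_anti.
  by rewrite d0 andbT -(lerD2l t) addr0.
have cK (k : R) : \int[mu]_(y in `]t, (t + dl)%R]) (cst k%:E y) = (dl * k)%:E.
  by rewrite integral_cst//= leb mulrC EFinM.
have sum (k : R) : (0 <= k)%R ->
  \int[mu]_(t in `]t, (t + dl)%R]) (u t)%:E + (dl * k)%:E =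
  \int[mu]_(y in `]t, (t + dl)%R]) (u y + k)%:E.
  move=> k0; rewrite -cK -ge0_integralD//.
  - by move=> y _; rewrite lee_fin.
rewrite !sum; last 2 first.
- by rewrite mulr_ge0// v_ge0.
- by rewrite mulr_ge0// v_ge0// ltr_wpDr.
have mk (k : R) : measurable_fun `]t, (t + dl)%R] (fun y => (u y + k)%:E).
  by apply/measurable_EFinP; apply: measurable_funD => //; exact/measurable_EFinP.
apply/andP; split; apply: ge0_le_integral => //.
- by move=> y _; rewrite lee_fin addr_ge0// mulr_ge0// v_ge0// ltr_wpDr.
- exact: mk.
- move=> y; rewrite /= in_itv/= => /andP[ty tdy]; rewrite lee_fin.
  have /andP[h _] := u_diff x0 (lt_trans xt ty).
  rewrite -lerBrDl (le_trans _ h)// ler_wpM2l// v_le//.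
  exact: lt_trans ty.
- by move=> y _; rewrite lee_fin.
- exact: mk.
- move=> y; rewrite /= in_itv/= => /andP[ty tdy]; rewrite lee_fin.
  have /andP[_ h] := u_diff x0 (lt_trans xt ty).
  rewrite -lerBlDl (le_trans h)// ler_wpM2l// v_le//.
  by rewrite lerD2r ltW.
Qed.

(** The paths are nondecreasing: no visit to a lower window follows a visit to a
    higher one. *)
Lemma pair_pot_disjoint (s t a b : R) : (0 <= t)%R -> (s <= t)%R ->
  pair_pot P D (itvI t b) (itvI a s) = 0.
Proof.
move=> t0 st; rewrite /pair_pot.
rewrite (@eq_pot _ (fun=> 0)).
  by apply: integral0_eq => x _; apply: integral0_eq => w _; rewrite /Kpot mule0.
move=> x x0; rewrite (@eq_pot _ (fun y => if (t < x)%R then 0 else itvI a s (x + y))).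
  rewrite itvIE; case: ltP => [tx|]; last by rewrite /= mul0e.
  rewrite [X in _ * X](_ : _ = 0) ?mule0//.
  by apply: integral0_eq => y _; apply: integral0_eq => w _; rewrite /Kpot mule0.
move=> y y0; case: ltP => // tx; rewrite itvIE; case: ifP => // /andP[_ h].
have : (t < s)%R by rewrite (lt_le_trans tx)// (le_trans _ h)// lerDl.
by rewrite ltNge st.
Qed.

Lemma pair_pot_itv s t dl : pair_pot P D (itvI s (s + dl)) (itvI t (t + dl)) =
  pot (fun a => itvI s (s + dl) a * pot (itvI (t - a) (t - a + dl))).
Proof.
apply: eq_pot => a a0.
have e : pot (fun y => itvI t (t + dl) (a + y)) = pot (itvI (t - a) (t - a + dl)).
  by apply: eq_pot => y y0; rewrite !itvIE ltrBlDl addrAC lerBrDl.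
by rewrite e.
Qed.

(** The first moment of the potential of a window is the constant in front of the
    decay of the covariance. *)
Definition pot_mean s dl := pot (fun a => itvI s (s + dl) a * a%:E).

Let meas_mean s dl : measurable_fun setT (fun a => itvI s (s + dl) a * a%:E).
Proof. by apply: emeasurable_funM; [exact: measurable_itvI|exact/measurable_EFinP]. Qed.

Let mean_ge0 s dl a : (0 <= s)%R -> 0 <= itvI s (s + dl) a * a%:E.
Proof.
move=> s0; rewrite itvIE; case: ifP => [/andP[sa _]|]; last by rewrite mul0e.
by rewrite mul1e lee_fin (le_trans s0)// ltW.
Qed.

Lemma pot_mean_fin (s dl : R) : (0 <= s)%R -> (0 <= dl)%R -> pot_mean s dl \is a fin_num.
Proof.
move=> s0 d0; rewrite ge0_fin_numE; last first.
  by apply: pot_ge0 => a; exact: mean_ge0.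
have sd0 : (0 <= s + dl)%R by rewrite addr_ge0.
apply: (@le_lt_trans _ _ (pot (fun a => (s + dl)%:E * itvI s (s + dl) a))).
  apply: (le_pot subD) => //.
  - by apply: measurable_funeM; exact: measurable_itvI.
  - by move=> a; exact: mean_ge0.
  - move=> a _; rewrite itvIE; case: ifP => [/andP[_ h]|]; last by rewrite mul0e mule0.
    by rewrite mul1e mule1 lee_fin.
  - by move=> a; rewrite mule_ge0// ?lee_fin// itvI_ge0.
rewrite (potZ subD) ?lte_mul_pinfty ?lee_fin//.
- exact: pot_itvI_fin.
- exact: measurable_itvI.
- exact: itvI_ge0.
Qed.

(** The covariance is [int_A (U (t - a, t - a + dl] - U (t, t + dl]) U(da)] over
    the first window [A], and the difference is of order [a dl v]. *)
Lemma occ_product_bounds (s t dl : R) : (0 <= s)%R -> (0 <= dl)%R -> (s + dl < t)%R ->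
  pot (itvI s (s + dl)) * pot (itvI t (t + dl)) + (dl * v (t + dl))%:E * pot_mean s dl <=
    \int[P]_w (occ D (itvI s (s + dl)) w * occ D (itvI t (t + dl)) w) <=
  pot (itvI s (s + dl)) * pot (itvI t (t + dl)) + (dl * v (t - (s + dl)))%:E * pot_mean s dl.
Proof.
move=> s0 d0 sdt; set A := itvI s _; set B := itvI t _.
have t0 : (0 <= t)%R by rewrite (le_trans _ (ltW sdt))// addr_ge0.
have mA : measurable_fun setT A by exact: measurable_itvI.
have mB : measurable_fun setT B by exact: measurable_itvI.
have A0 : forall y, 0 <= A y by exact: itvI_ge0.
have B0 : forall y, 0 <= B y by exact: itvI_ge0.
rewrite (integral_occ_mul subD mA mB A0 B0).
rewrite (@pair_pot_disjoint (s + dl)%R t)// ?(ltW sdt)// adde0 pair_pot_itv.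
have fB : pot B \is a fin_num.
  by rewrite ge0_fin_numE ?pot_itvI_fin ?addr_ge0//; apply: pot_ge0.
have pB : (0 <= fine (pot B))%R by rewrite fine_ge0// pot_ge0.
have comb (k : R) : (0 <= k)%R ->
    pot A * pot B + k%:E * pot_mean s dl =
    pot (fun a => (fine (pot B))%:E * A a + k%:E * (A a * a%:E)).
  move=> k0.
  have m1 : measurable_fun setT (fun a => (fine (pot B))%:E * A a) by exact: measurable_funeM.
  have m2 : measurable_fun setT (fun a => k%:E * (A a * a%:E)) by exact: measurable_funeM (meas_mean s dl).
  have p1 a : 0 <= (fine (pot B))%:E * A a by rewrite mule_ge0.
  have p2 a : 0 <= k%:E * (A a * a%:E) by apply: mule_ge0; [rewrite lee_fin|exact: mean_ge0].
  rewrite (potD subD m1 m2 p1 p2) (potZ subD mA A0 pB).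
  rewrite (potZ subD (meas_mean s dl) (fun a => mean_ge0 dl a s0) k0).
  rewrite (fineK fB).
  exact: (congr1 (fun z => z + k%:E * pot_mean s dl) (muleC (pot A) (pot B))).
have mV : measurable_fun setT (fun a => A a * pot (itvI (t - a) (t - a + dl))).
  apply: emeasurable_funM => //.
  have := measurable_pot_shift subD mB B0.
  apply: eq_measurable_fun => a _; apply: eq_pot => y y0.
  by rewrite /B !itvIE ltrBlDl addrAC lerBrDl.
have V0 a : 0 <= A a * pot (itvI (t - a) (t - a + dl)).
  by rewrite mule_ge0// pot_ge0//; exact: itvI_ge0.
have mC (k : R) : measurable_fun setT
    (fun a => (fine (pot B))%:E * A a + k%:E * (A a * a%:E)).
  by apply: emeasurable_funD; [exact: measurable_funeM|exact: measurable_funeM (meas_mean s dl)].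
have v1 : (0 <= v (t + dl))%R.
  by rewrite v_ge0// ltr_wpDr// (le_lt_trans _ sdt)// addr_ge0.
have v2 : (0 <= v (t - (s + dl)))%R by rewrite v_ge0// subr_gt0.
have k1 : (0 <= dl * v (t + dl))%R by rewrite mulr_ge0.
have k2 : (0 <= dl * v (t - (s + dl)))%R by rewrite mulr_ge0.
have dv (k : R) a : (0 <= k)%R -> 0 <= (fine (pot B))%:E * A a + k%:E * (A a * a%:E).
  move=> k0; apply: adde_ge0; first by rewrite mule_ge0.
  by apply: mule_ge0; [rewrite lee_fin|exact: mean_ge0].
rewrite (comb _ k1) (comb _ k2); apply/andP; split.
- apply: (le_pot subD (mC _) mV _ _ V0) => a; first exact: dv.
  move=> a0; rewrite /A itvIE; case: ifP => [/andP[sa ad]|_]; last by rewrite !mul0e !mule0 adde0.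
  rewrite !mul1e mule1 (fineK fB) -EFinM.
  have /andP[h _] := pot_itv_diff a0 (le_lt_trans ad sdt) d0.
  by apply: le_trans h; rewrite leeD2l// lee_fin mulrAC mulrA.
- apply: (le_pot subD mV (mC _) V0 _ (dv _ ^~ k2)) => a a0.
  rewrite /A itvIE; case: ifP => [/andP[sa ad]|_]; last by rewrite !mul0e !mule0 adde0.
  rewrite !mul1e mule1 (fineK fB) -EFinM.
  have /andP[_ h] := pot_itv_diff a0 (le_lt_trans ad sdt) d0.
  apply: (le_trans h); rewrite leeD2l// lee_fin mulrA mulrAC.
  rewrite ler_wpM2r// ler_wpM2l// v_le// ?subr_gt0//.
  by rewrite lerD2l lerN2.
Qed.

(** The mean square of the occupation of a remote window, divided by twice the
    density there, tends to this number. *)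
Definition pot_tent dl := pot (fun y => (Num.max (dl - y) 0)%:E).

Let meas_tent dl : measurable_fun setT (fun y : R => (Num.max (dl - y) 0)%:E).
Proof. by apply/measurable_EFinP; apply: measurable_maxr => //; exact: measurable_funB. Qed.

Let tent_ge0 dl y : 0 <= (Num.max (dl - y) 0 : R)%:E.
Proof. by rewrite lee_fin le_max lexx orbT. Qed.

Lemma pot_tent_fin (dl : R) : (0 <= dl)%R -> pot_tent dl \is a fin_num.
Proof.
move=> d0; rewrite ge0_fin_numE; last by apply: pot_ge0 => a; exact: tent_ge0.
apply: (@le_lt_trans _ _ (pot (fun a => dl%:E * leI dl a))).
  apply: (le_pot subD) => //.
  - by apply: measurable_funeM; exact: measurable_leI.
  - move=> a a0; rewrite leIE; have [ad|ad] := leP a dl.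
      by rewrite mule1 lee_fin ge_max d0 andbT lerBlDr lerDl.
    by rewrite mule0 max_r// subr_le0 ltW.
  - by move=> a; apply: mule_ge0; [rewrite lee_fin|exact: leI_ge0].
rewrite (potZ subD (measurable_leI dl) (leI_ge0 dl) d0).
by rewrite lte_mul_pinfty ?lee_fin// cdf_fin.
Qed.

(** Both visits of the window are counted from the earlier one; exchanging the
    two potentials, the later visit is at distance [y] from it and the earlier
    one ranges over a window of length [dl - y]. *)
Lemma occ_square_bounds (t dl : R) : (0 < t)%R -> (0 <= dl)%R ->
  (2 * u (t + dl))%:E * pot_tent dl <=
    \int[P]_w (occ D (itvI t (t + dl)) w * occ D (itvI t (t + dl)) w) <=
  (2 * u t)%:E * pot_tent dl.
Proof.
move=> t0 d0; set B := itvI t _.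
have mB : measurable_fun setT B by exact: measurable_itvI.
have B0 : forall y, 0 <= B y by exact: itvI_ge0.
rewrite (integral_occ_mul subD mB mB B0 B0).
pose F (z : R * R) := B z.1 * B (z.1 + z.2)%R.
have mF : measurable_fun setT F.
  apply: emeasurable_funM; first exact: measurableT_comp mB measurable_fst.
  apply: (measurableT_comp mB).
  by apply: measurable_funD; [exact: measurable_fst|exact: measurable_snd].
have F0 z : 0 <= F z by rewrite mule_ge0.
have mF' : measurable_fun setT (fun z : R * R => F (z.2, z.1)).
  by apply: (measurableT_comp mF); apply: measurable_fun_pair; [exact: measurable_snd|exact: measurable_fst].
pose g y := pot (fun a => F (a, y)).
have mg : measurable_fun setT g := measurable_pot_param subD mF' (fun z => F0 _).
have g0 y : 0 <= g y by apply: pot_ge0.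
have -> : pair_pot P D B B = pot g.
  rewrite -(pot_swap subD mF F0); apply: eq_pot => a _.
  have [Ba|Ba] : B a = 1 \/ B a = 0 by rewrite /B itvIE; case: ifP; [left|right].
    by rewrite Ba mul1e; apply: eq_pot => y _; rewrite /F /= Ba mul1e.
  rewrite Ba mul0e; apply/esym; apply: integral0_eq => x _; apply: integral0_eq => w _.
  by rewrite /Kpot /F /= Ba mul0e mule0.
have gE y : (0 <= y)%R -> g y = pot (itvI t (t + dl - y)).
  move=> y0; apply: eq_pot => a _; rewrite /F /B /= !itvIE.
  have [ta|ta] /= := ltP t a; last by rewrite mul0e.
  rewrite (ltr_wpDr y0 ta) /= lerBrDr.
  by have [h|h] := leP (a + y)%R (t + dl)%R;
    rewrite ?mule0// mule1 (le_trans _ h)// lerDl.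
have gb y : (0 <= y)%R -> (u (t + dl) * Num.max (dl - y) 0)%:E <= g y <=
    (u t * Num.max (dl - y) 0)%:E.
  move=> y0; rewrite gE//; have [yd|yd] := leP y dl.
    have h : (t <= t + dl - y)%R by rewrite -addrA lerDl subr_ge0.
    have := pot_itv_bounds t0 h; rewrite max_l ?subr_ge0//.
    have -> : (t + dl - y - t = dl - y)%R by ring.
    move=> /andP[h1 h2]; rewrite ![(u _ * _)%R]mulrC h2 andbT (le_trans _ h1)// lee_fin.
    rewrite ler_wpM2l ?subr_ge0// u_le//; first exact: lt_le_trans h.
    by rewrite lerBlDr lerDl.
  rewrite max_r; last by rewrite subr_le0 ltW.
  rewrite !mulr0 (@eq_pot _ (fun=> 0)); last first.
    move=> a _; rewrite itvIE; case: ifP => // /andP[ta ad].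
    have : (t < t + dl - y)%R by exact: lt_le_trans ad.
    by rewrite -addrA ltrDl subr_gt0 ltNge (ltW yd).
  rewrite [pot _](_ : _ = 0) ?lexx//.
  by apply: integral0_eq => x _; apply: integral0_eq => w _; rewrite /Kpot mule0.
have c (k : R) : (0 <= k)%R -> (2 * k)%:E * pot_tent dl =
    pot (fun y => (k * Num.max (dl - y) 0)%:E) + pot (fun y => (k * Num.max (dl - y) 0)%:E).
  move=> k0.
  have -> : pot (fun y => (k * Num.max (dl - y) 0)%:E) = k%:E * pot_tent dl.
    exact: (potZ subD (meas_tent dl) (tent_ge0 dl) k0).
  rewrite -(fineK (pot_tent_fin d0)) -!EFinM -EFinD; congr EFin; ring.
have mk (k : R) : measurable_fun setT (fun y : R => (k * Num.max (dl - y) 0)%:E).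
  exact: (measurable_funeM k%:E (meas_tent dl)).
have k0 (k y : R) : (0 <= k)%R -> 0 <= (k * Num.max (dl - y) 0)%:E.
  by move=> kp; rewrite lee_fin mulr_ge0// le_max lexx orbT.
rewrite !c//; apply/andP; split; apply: leeD;
  apply: (le_pot subD) => //; try (by move=> y; apply: k0);
  by move=> y y0; have /andP[] := gb y y0.
Qed.

End increments.

(** * The inverse subordinator *)

Section inverse.
Local Open Scope ereal_scope.
Context {d : measure_display} {T : measurableType d} {R : realType}.
Notation mu := (@lebesgue_measure R).
Variable P : probability T R.
Variable D : R -> T -> R.
Hypothesis subD : subordinator P D.
Notation Y := (inverse_subordinator D).

Lemma inverse_ge0 t w : (0 <= Y t w)%R.
Proof.
rewrite /inverse_subordinator; set S := [set _ | _].
have [->|/set0P S0] := eqVneq S set0; first by rewrite inf0.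
by apply: lb_le_inf => // x [].
Qed.

(** The paths are nondecreasing, so the times at which the level is not exceeded
    fill the interval up to the infimum of the other times.  If the level is never
    exceeded both sides are 0: the infimum is over the empty set, and the real
    part of the infinite occupation time is 0 by convention. *)
Lemma inverse_occ (t : R) w : (0 <= t)%R -> Y t w = fine (occ D (leI t) w).
Proof.
move=> t0; have mono := subD.2.
pose E : set R := [set x | 0 <= x /\ D x w <= t]%R.
pose S : set R := [set s | 0 <= s /\ t < D s w]%R.
have EE : E = `[0%R, +oo[%classic `&` (Dpos D ^~ w) @^-1` `]-oo, t]%classic.
  apply/seteqP; split => x /=; rewrite !in_itv/= andbT => -[x0];
    by rewrite ?DposE.
have mE : measurable E.
  rewrite EE; apply: measurableI => //; rewrite -[X in measurable X]setTI.
  by apply: (measurable_Dpos1 subD w) => //; exact: measurable_itv.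
have -> : occ D (leI t) w = mu E.
  rewrite -[RHS]mul1e -integral_cst// [RHS]integral_mkcond; apply: eq_integral => x _.
  rewrite patchE /Kpot /= nonnegIE leIE; case: ifPn => x0; last first.
    by rewrite mul0e; case: ifPn => //; rewrite inE => -[h]; rewrite h in x0.
  rewrite mul1e DposE//; case: ifPn => xt; case: ifPn => //.
    by move=> /negP; rewrite inE => h; exfalso; apply: h.
  by rewrite inE => -[_ h]; rewrite h in xt.
rewrite /inverse_subordinator -/S.
have [S0|/set0P S0] := eqVneq S set0.
  rewrite S0 inf0.
  have -> : E = `[0%R, +oo[%classic.
    apply/seteqP; split => x /=; rewrite in_itv/= andbT; first by case.
    move=> x0; split => //; rewrite leNgt; apply/negP => h.
    by have : S x by []; rewrite S0.
  by rewrite lebesgue_measure_itv/= ltry.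
have lbS : has_lbound S by exists 0%R => x [].
have i0 : (0 <= inf S)%R by apply: lb_le_inf => // x [].
have li (i1 : bool) : mu [set` Interval (BLeft 0%R) (BSide i1 (inf S))] = (inf S)%:E.
  rewrite lebesgue_measure_itv/= lte_fin; case: ifPn => [_|]; first by rewrite sube0.
  by rewrite -leNgt => h; congr EFin; apply/le_anti; rewrite i0 h.
suff -> : mu E = (inf S)%:E by [].
apply/le_anti/andP; split.
  rewrite -(li false); apply: le_measure; rewrite ?inE//.
  move=> x [x0 xt]; rewrite /= in_itv/= x0 /=; apply: lb_le_inf => //.
  move=> y [y0 ty]; rewrite leNgt; apply/negP => yx.
  by have := mono w _ _ y0 (ltW yx); rewrite leNgt (le_lt_trans xt ty).
rewrite -(li true); apply: le_measure; rewrite ?inE//.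
move=> x; rewrite /= in_itv/= => /andP[x0 xi]; split => //.
rewrite leNgt; apply/negP => h.
by have : (inf S <= x)%R by [apply: ge_inf]; rewrite leNgt xi.
Qed.

Lemma measurable_inverse t : (0 <= t)%R -> measurable_fun setT (Y t).
Proof.
move=> t0; rewrite (_ : Y t = fine \o occ D (leI t)); last first.
  by apply/funext => w; rewrite inverse_occ.
apply: measurableT_comp => //.
exact: (measurable_occ subD (measurable_leI t) (leI_ge0 t)).
Qed.

Hypothesis cdf_fin : forall b, (0 <= b)%R -> pot P D (leI b) < +oo.

(** The occupation time has finite mean. *)
Lemma occ_ae_fin (b : R) : (0 <= b)%R ->
  {ae P, forall w, occ D (leI b) w \is a fin_num}.
Proof.
move=> b0; have i : P.-integrable setT (occ D (leI b)).
  apply/integrableP; split; first exact: (measurable_occ subD (measurable_leI b) (leI_ge0 b)).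
  rewrite (eq_integral (occ D (leI b))); last first.
    by move=> w _; rewrite gee0_abs// (occ_ge0 _ _ (leI_ge0 b)).
  by rewrite (integral_occ subD (measurable_leI b) (leI_ge0 b)) cdf_fin.
have := integrable_ae measurableT i.
by apply: filterS => w; apply.
Qed.

(** Occupation times are additive in the set; outside a null event they are finite
    and the additivity survives on real parts. *)
Lemma inverse_increment (s t : R) : (0 <= s)%R -> (s <= t)%R ->
  {ae P, forall w, (Y t w - Y s w)%:E = occ D (itvI s t) w}.
Proof.
move=> s0 st; have t0 := le_trans s0 st.
have := occ_ae_fin t0; apply: filterS2 (occ_ae_fin s0) => w fs ft.
have e : occ D (leI t) w = occ D (leI s) w + occ D (itvI s t) w.
  have mK g : measurable_fun setT g -> measurable_fun setT (fun x => Kpot D g (x, w)).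
    by move=> mg; exact: measurableT_comp (measurable_Kpot subD mg) (measurable_pair2 w).
  have K0 g : (forall x, 0 <= g x) -> forall x, setT x -> 0 <= Kpot D g (x, w).
    by move=> g0 x _; exact: Kpot_ge0.
  rewrite /occ -(ge0_integralD mu measurableT (K0 _ (leI_ge0 s)) (mK _ (measurable_leI s))
    (K0 _ (itvI_ge0 s t)) (mK _ (measurable_itvI s t))).
  apply: eq_integral => x _; rewrite /Kpot -ge0_muleDr ?leI_ge0 ?itvI_ge0//.
  rewrite !leIE itvIE ltNge; have [ya|ya] := leP (Dpos D x w) s.
    by rewrite (le_trans ya st) adde0.
  by rewrite add0e.
have fi : occ D (itvI s t) w \is a fin_num.
  rewrite ge0_fin_numE ?(occ_ge0 _ _ (itvI_ge0 s t))//.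
  rewrite (le_lt_trans _ (_ : occ D (leI t) w < +oo))//; last by rewrite ltey_eq ft.
  by rewrite e leeDr// (occ_ge0 _ _ (leI_ge0 s)).
rewrite !inverse_occ// e -{1}(fineK fs) -{1}(fineK fi) -EFinD/= addrAC subrr add0r.
by rewrite fineK.
Qed.

Lemma inverse_increment_ge0 (s t : R) : (0 <= s)%R -> (s <= t)%R ->
  {ae P, forall w, (Y s w <= Y t w)%R}.
Proof.
move=> s0 st; have := inverse_increment s0 st; apply: filterS => w e.
by rewrite -subr_ge0 -lee_fin e; apply: occ_ge0; exact: itvI_ge0.
Qed.

Lemma expectation_inverse_increment (s t : R) : (0 <= s)%R -> (s <= t)%R ->
  \int[P]_w (Y t w - Y s w)%:E = pot P D (itvI s t).
Proof.
move=> s0 st; have t0 := le_trans s0 st.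
rewrite -(integral_occ subD (measurable_itvI s t) (itvI_ge0 s t)).
apply: ae_eq_integral => //.
- apply/measurable_EFinP; apply: measurable_funB; exact: measurable_inverse.
- exact: (measurable_occ subD (measurable_itvI s t) (itvI_ge0 s t)).
- by have := inverse_increment s0 st; apply: filterS => w e _.
Qed.

Lemma expectation_inverse_product (s s' t t' : R) :
  (0 <= s)%R -> (s <= s')%R -> (0 <= t)%R -> (t <= t')%R ->
  \int[P]_w ((Y s' w - Y s w) * (Y t' w - Y t w))%:E =
  \int[P]_w (occ D (itvI s s') w * occ D (itvI t t') w).
Proof.
move=> s0 ss t0 tt; have s'0 := le_trans s0 ss; have t'0 := le_trans t0 tt.
have mI a b := measurable_occ subD (measurable_itvI a b) (itvI_ge0 a b).
apply: ae_eq_integral => //.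
- by apply/measurable_EFinP; apply: measurable_funM; apply: measurable_funB;
    exact: measurable_inverse.
- by apply: emeasurable_funM; exact: mI.
- have := inverse_increment s0 ss; apply: filterS2 (inverse_increment t0 tt) => w e1 e2 _.
  by rewrite EFinM e1 e2.
Qed.

End inverse.

(** * Second moments of claims and of Poisson increments *)

Section pair_moments.
Local Open Scope ereal_scope.
Context {d : measure_display} {T : measurableType d} {R : realType}.
Variable P : probability T R.
Implicit Types (xi eta : T -> R).

Lemma L2_L1 xi : xi \in Lfun P 2%:E -> xi \in Lfun P 1.
Proof. by move=> x2; rewrite (Lfun_subset12 _ x2)// fin_num_measure. Qed.

Lemma L2_measurable xi : xi \in Lfun P 2%:E -> measurable_fun setT xi.
Proof. by move=> /sub_Lfun_mfun; rewrite inE. Qed.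

Lemma L2_intro xi : measurable_fun setT xi ->
  \int[P]_w (xi w ^+ 2)%:E < +oo -> xi \in Lfun P 2%:E.
Proof.
move=> mxi h; rewrite inE; apply/andP; rewrite !inE/=; split => //.
rewrite /finite_norm unlock /= poweR_lty//; apply: le_lt_trans h.
rewrite le_eqVlt; apply/orP; left; apply/eqP; apply: eq_integral => w _.
by rewrite -[2%R]/(2%:R) powR_mulrn// real_normK// num_real.
Qed.

Lemma L2_scale (k : R) xi : xi \in Lfun P 2%:E -> (k \o* xi)%R \in Lfun P 2%:E.
Proof. by move=> x2; rewrite Lfun_scale// ler1n. Qed.

Lemma L2_add xi eta : xi \in Lfun P 2%:E -> eta \in Lfun P 2%:E ->
  (xi \+ eta)%R \in Lfun P 2%:E.
Proof. by move=> x2 y2; rewrite rpredD ?lee1n. Qed.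

Lemma second_moment_pair xi eta (m1 m2 v1 v2 b e1 e2 : R) :
  xi \in Lfun P 2%:E -> eta \in Lfun P 2%:E ->
  'E_P[xi] = m1%:E -> 'E_P[eta] = m2%:E ->
  'V_P[xi] = v1%:E -> 'V_P[eta] = v2%:E -> covariance P xi eta = 0 ->
  \int[P]_w ((b + e1 * xi w + e2 * eta w) ^+ 2)%:E =
  ((b + e1 * m1 + e2 * m2) ^+ 2 + e1 ^+ 2 * v1 + e2 ^+ 2 * v2)%:E.
Proof.
move=> x2 y2 Ex Ey Vx Vy c0.
have kx2 := L2_scale e1 x2; have ky2 := L2_scale e2 y2.
have s2 := L2_add kx2 ky2.
pose W := (cst b \+ (e1 \o* xi \+ e2 \o* eta))%R.
have W2 : W \in Lfun P 2%:E by rewrite L2_add// Lfun_cst.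
have EW : 'E_P[W] = (b + e1 * m1 + e2 * m2)%:E.
  rewrite expectationD ?L2_L1 ?Lfun_cst// expectationD ?L2_L1// expectation_cst.
  by rewrite !expectationZl ?L2_L1// Ex Ey -!EFinM -!EFinD addrA.
have VW : 'V_P[W] = (e1 ^+ 2 * v1 + e2 ^+ 2 * v2)%:E.
  rewrite varianceD_cst_l// varianceD// !varianceZ// Vx Vy.
  rewrite (covarianceZl e1 (L2_L1 x2) (L2_L1 ky2) (Lfun2_mul_Lfun1 x2 ky2)).
  rewrite (covarianceZr e2 (L2_L1 x2) (L2_L1 y2) (Lfun2_mul_Lfun1 x2 y2)).
  rewrite c0 !mule0 adde0.
  by rewrite -!EFinM -EFinD.
have := varianceE W2; rewrite VW EW unlock.
have -> : \int[P]_w (EFin \o (W ^+ 2)%R) w =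
    \int[P]_w ((b + e1 * xi w + e2 * eta w) ^+ 2)%:E.
  apply: eq_integral => w _; congr EFin.
  by rewrite -[LHS]/((b + (xi w * e1 + eta w * e2)) ^+ 2)%R; ring.
move=> h.
have : (e1 ^+ 2 * v1 + e2 ^+ 2 * v2)%:E + (b + e1 * m1 + e2 * m2)%:E ^+ 2 =
  \int[P]_w ((b + e1 * xi w + e2 * eta w) ^+ 2)%:E.
  by rewrite h -EFin_expe subeK.
by move<-; rewrite -EFin_expe -EFinD; congr EFin; ring.
Qed.

Lemma L2_mean xi : xi \in Lfun P 2%:E -> exists m : R, 'E_P[xi] = m%:E.
Proof. by move=> x2; exists (fine 'E_P[xi]); rewrite fineK// expectation_fin_num// L2_L1. Qed.

Lemma L2_variance xi : xi \in Lfun P 2%:E -> exists v : R, 'V_P[xi] = v%:E.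
Proof. by move=> x2; exists (fine 'V_P[xi]); rewrite fineK// variance_fin_num. Qed.

Lemma second_moment xi (m v b : R) : xi \in Lfun P 2%:E ->
  'E_P[xi] = m%:E -> 'V_P[xi] = v%:E ->
  \int[P]_w ((b + xi w) ^+ 2)%:E = ((b + m) ^+ 2 + v)%:E.
Proof.
move=> x2 Ex Vx.
have := @second_moment_pair xi (cst 0%R) m 0 v 0 b 1 0 x2 (Lfun_cst _ _ _) Ex
  (expectation_cst _ _) Vx (variance_cst _ _) (covariance_cst_r _ _ _).
rewrite !mul1r mul0r mulr0 !addr0 => h; rewrite -[RHS](_ : ((b + m) ^+ 2 + 1 ^+ 2 * v)%:E = _); last by congr EFin; ring.
by rewrite -h; apply: eq_integral => w _; rewrite mul1r addr0.
Qed.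

(** The product of the two variables has no sign, so Tonelli is applied to the
    square of their sum instead. *)
Lemma indep_covariance xi eta : xi \in Lfun P 2%:E -> eta \in Lfun P 2%:E ->
  (forall A B : set R, measurable A -> measurable B ->
    P (xi @^-1` A `&` eta @^-1` B) = P (xi @^-1` A) * P (eta @^-1` B)) ->
  covariance P xi eta = 0.
Proof.
move=> x2 y2 ind.
have [m1 E1] := L2_mean x2; have [m2 E2] := L2_mean y2.
have [v1 V1] := L2_variance x2; have [v2 V2] := L2_variance y2.
have mx := L2_measurable x2; have my := L2_measurable y2.
have s2 := L2_add x2 y2; have [v Vs] := L2_variance s2.
have Es : 'E_P[xi \+ eta] = (m1 + m2)%:E by rewrite expectationD ?L2_L1// E1 E2.
have h1 : \int[P]_w ((0 + (xi \+ eta) w) ^+ 2)%:E = ((m1 + m2) ^+ 2 + v)%:E.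
  by rewrite (second_moment 0 s2 Es Vs) add0r.
have h2 : \int[P]_w ((0 + (xi \+ eta) w) ^+ 2)%:E = ((m1 + m2) ^+ 2 + v1 + v2)%:E.
  pose f (z : R * R) : \bar R := ((z.1 + z.2) ^+ 2)%:E.
  have mf : measurable_fun setT f.
    apply/measurable_EFinP; apply: measurable_funX.
    by apply: measurable_funD; [exact: measurable_fst|exact: measurable_snd].
  have f0 z : 0 <= f z by rewrite lee_fin sqr_ge0.
  transitivity (\int[P]_w f (xi w, eta w)).
    by apply: eq_integral => w _; rewrite add0r.
  rewrite (indep_integral mx my ind mf f0).
  transitivity (\int[P]_w (((m2 + xi w) ^+ 2)%:E + v2%:E)).
    by apply: eq_integral => w _; rewrite /f /= (second_moment _ y2 E2 V2) EFinD [(m2 + _)%R]addrC.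
  have v20 : 0 <= v2%:E by rewrite -V2 variance_ge0.
  rewrite ge0_integralD//.
  - rewrite (second_moment _ x2 E1 V1) integral_cst//= probability_setT mule1 -EFinD.
    by congr EFin; ring.
  - by move=> w _; rewrite lee_fin sqr_ge0.
  - apply/measurable_EFinP; apply: measurable_funX.
    exact: measurable_funD.
have := varianceD x2 y2; rewrite Vs V1 V2.
have c_fin : covariance P xi eta \is a fin_num.
  exact: (covariance_fin_num (L2_L1 x2) (L2_L1 y2) (Lfun2_mul_Lfun1 x2 y2)).
move: h2; rewrite h1 => -[h2]; rewrite -(fineK c_fin) -!EFinM -!EFinD => -[h3].
have vE : (v = v1 + v2)%R by lra.
by congr EFin; lra.
Qed.

(** Second moments of all translates determine mean and variance; they involve
    nonnegative functions only, for which no integrability is required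
    beforehand. *)
Lemma moments_of_squares xi (m v : R) : measurable_fun setT xi ->
  (forall b : R, \int[P]_w ((b + xi w) ^+ 2)%:E = ((b + m) ^+ 2 + v)%:E) ->
  [/\ xi \in Lfun P 2%:E, 'E_P[xi] = m%:E & 'V_P[xi] = v%:E].
Proof.
move=> mxi sq.
have x2 : xi \in Lfun P 2%:E.
  apply: L2_intro => //; have := sq 0%R.
  under eq_integral do rewrite add0r.
  by move=> ->; exact: ltry.
have [m' E'] := L2_mean x2; have [v' V'] := L2_variance x2.
have h b := etrans (esym (sq b)) (second_moment b x2 E' V').
have [h0] := h 0%R; have [h1] := h 1%R.
have e : (m' = m)%R by nra.
by rewrite E' V' e; split => //; congr EFin; rewrite e in h0; lra.
Qed.

End pair_moments.

Section claims.
Local Open Scope ereal_scope.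
Context {d : measure_display} {T : measurableType d} {R : realType}.
Variable P : probability T R.
Variable X : nat -> T -> R.
Hypothesis mX : forall i, measurable_fun setT (X i).
Hypothesis iidX : iid P X.
Variable m : R.
Hypothesis X0_2 : X 0%N \in Lfun P 2%:E.
Hypothesis EX0 : 'E_P[X 0%N] = m%:E.
Variable v : R.
Hypothesis VX0 : 'V_P[X 0%N] = v%:E.

Let sq_law i (b : R) : \int[P]_w ((b + X i w) ^+ 2)%:E = ((b + m) ^+ 2 + v)%:E.
Proof.
rewrite -(second_moment b X0_2 EX0 VX0).
apply: (same_law_integral (f := fun x : R => ((b + x) ^+ 2)%:E)) => //.
- exact: iidX.2.
- apply/measurable_EFinP; apply: measurable_funX.
  exact: measurable_funD.
- by move=> y; rewrite lee_fin sqr_ge0.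
Qed.

Let X2 i : X i \in Lfun P 2%:E.
Proof. by have [] := moments_of_squares (mX i) (sq_law i). Qed.

Lemma claim_moments i : 'E_P[X i] = m%:E /\ 'V_P[X i] = v%:E.
Proof. by have [] := moments_of_squares (mX i) (sq_law i). Qed.

Lemma claims_uncorrelated i j : i != j -> covariance P (X i) (X j) = 0.
Proof.
move=> ij; apply: indep_covariance => // A B mA mB.
pose E k := if k == i then X i @^-1` A else X j @^-1` B.
have := iidX.1 [fset i; j]%fset E.
rewrite [X in P X](_ : _ = X i @^-1` A `&` X j @^-1` B); last first.
  apply/seteqP; split => [w h|w [wA wB] k].
    split; first by have := h i; rewrite /E eqxx; apply; rewrite /= !inE eqxx.
    by have := h j; rewrite /E eq_sym (negbTE ij); apply; rewrite /= !inE eqxx orbT.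
  by rewrite /= !inE /E; have [ki|ki] := eqVneq k i; rewrite ?ki//= => /eqP ->.
rewrite big_fsetU1 ?inE//= big_seq_fset1 /E eqxx eq_sym (negbTE ij); apply => k.
rewrite !inE => /orP[/eqP ->|/eqP ->]; rewrite ?eqxx ?[j == i]eq_sym ?(negbTE ij).
  by exists A => //; rewrite setTI.
by exists B => //; rewrite setTI.
Qed.

Definition claims_sum (a b : nat) (w : T) : R := (\sum_(a <= i < b) X i w)%R.

Lemma claims_sumS a b : (a <= b)%N ->
  claims_sum a b.+1 = (claims_sum a b \+ X b)%R.
Proof. by move=> ab; apply/funext => w; rewrite /claims_sum big_nat_recr. Qed.

Lemma claims_sum_nil a : claims_sum a a = cst 0%R.
Proof. by apply/funext => w; rewrite /claims_sum big_geq. Qed.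

Lemma claims_sum_L2 a b : claims_sum a b \in Lfun P 2%:E.
Proof.
have [ab|ba] := leqP a b; last first.
  rewrite (_ : claims_sum a b = cst 0%R) ?Lfun_cst//.
  by apply/funext => w; rewrite /claims_sum big_geq// ltnW.
rewrite -(subnKC ab); elim: (b - a)%N => [|n IH].
  by rewrite addn0 claims_sum_nil Lfun_cst.
by rewrite addnS claims_sumS ?leq_addr// L2_add.
Qed.

Lemma claims_sum_mean a b : (a <= b)%N -> 'E_P[claims_sum a b] = ((b - a)%:R * m)%:E.
Proof.
move=> ab; rewrite -{1}(subnKC ab); elim: (b - a)%N => [|n IH].
  by rewrite addn0 claims_sum_nil expectation_cst mul0r.
rewrite addnS claims_sumS ?leq_addr// expectationD ?L2_L1 ?claims_sum_L2//.
by rewrite IH (claim_moments _).1 -EFinD; congr EFin; rewrite -natr1; ring.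
Qed.

Lemma claims_sum_cov a b j : (b <= j)%N -> covariance P (claims_sum a b) (X j) = 0.
Proof.
move=> bj; have [ab|ba] := leqP a b; last first.
  rewrite (_ : claims_sum a b = cst 0%R) ?covariance_cst_l//.
  by apply/funext => w; rewrite /claims_sum big_geq// ltnW.
move: bj; rewrite -(subnKC ab); elim: (b - a)%N => [|n IH] bj.
  by rewrite addn0 claims_sum_nil covariance_cst_l.
rewrite addnS claims_sumS ?leq_addr// covarianceDl ?claims_sum_L2//.
rewrite IH ?(leq_trans _ bj) ?addnS// add0e claims_uncorrelated//.
by rewrite addnS in bj; rewrite ltn_eqF.
Qed.

Lemma claims_sum_variance a b : (a <= b)%N ->
  'V_P[claims_sum a b] = ((b - a)%:R * v)%:E.
Proof.
move=> ab; rewrite -{1}(subnKC ab); elim: (b - a)%N => [|n IH].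
  by rewrite addn0 claims_sum_nil variance_cst mul0r.
rewrite addnS claims_sumS ?leq_addr// varianceD ?claims_sum_L2//.
rewrite IH (claim_moments _).2 claims_sum_cov// mule0 adde0 -EFinD.
by congr EFin; rewrite -natr1; ring.
Qed.

Lemma claims_sum_disjoint a b c e : (a <= b)%N -> (b <= c)%N -> (c <= e)%N ->
  covariance P (claims_sum a b) (claims_sum c e) = 0.
Proof.
move=> ab bc ce; rewrite -(subnKC ce); elim: (e - c)%N => [|n IH].
  by rewrite addn0 claims_sum_nil covariance_cst_r.
rewrite addnS claims_sumS ?leq_addr// covarianceDr ?claims_sum_L2//.
by rewrite IH claims_sum_cov ?adde0// (leq_trans bc)// leq_addr.
Qed.

End claims.

Section poisson.
Local Open Scope ereal_scope.
Context {d : measure_display} {T : measurableType d} {R : realType}.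
Variable P : probability T R.
Variables (lam : R) (N : R -> T -> nat).
Hypothesis lam0 : (0 < lam)%R.
Hypothesis hN : poisson_process P lam N.

Let lN := poisson_levy hN.

Lemma poisson_measurable t : (0 <= t)%R -> measurable_fun setT (N t).
Proof.
move=> t0 _ B _; rewrite setTI.
rewrite (_ : N t @^-1` B = (fun w => (N t w)%:R : R) @^-1` ((fun k : nat => k%:R) @` B)).
  rewrite -[X in measurable X]setTI; apply: (levy_measurable lN t0) => //.
  apply: countable_measurable => [x|]; first exact: measurable_set1.
  exact: (card_le_trans (card_image_le _ _) (countableP B)).
apply/seteqP; split => w /=; first by move=> h; exists (N t w).
by move=> [k Bk /eqP]; rewrite eqr_nat => /eqP <-.
Qed.

Lemma poisson_expect (t : R) (f : nat -> R) : (0 < t)%R -> (forall k, 0 <= f k)%R ->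
  \int[P]_w (f (N t w))%:E = \sum_(k <oo) (f k * poisson_pmf (lam * t) k)%:E.
Proof.
move=> t0 f0; pose F k := N t @^-1` [set k].
have mF k : measurable (F k).
  rewrite -[X in measurable X]setTI; exact: (poisson_measurable (ltW t0)).
have TF : setT = \bigcup_k F k by apply/seteqP; split => w //= _; exists (N t w).
rewrite TF ge0_integral_bigcup//; last 3 first.
- rewrite -TF; apply/measurable_EFinP; apply: (measurableT_comp (f := f)) => //.
  exact: poisson_measurable (ltW t0).
- by move=> w _; rewrite lee_fin.
- by move=> i j _ _ [w [/= <- <-]].
apply: eq_eseriesr => k _.
transitivity (\int[P]_(w in F k) (cst (f k)%:E w)).
  by apply: eq_integral => w; rewrite inE => <-.
rewrite integral_cst// EFinM; congr (_ * _); exact: (poisson_marginal hN k t0).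
Qed.

(** The Poisson weights satisfy [k p_k = r p_(k - 1)]. *)
Lemma poisson_stein (t : R) (f : nat -> R) : (0 < t)%R -> (forall k, 0 <= f k)%R ->
  \int[P]_w ((N t w)%:R * f (N t w))%:E =
  (lam * t)%:E * \int[P]_w (f (N t w).+1)%:E.
Proof.
move=> t0 f0; have r0 : (0 < lam * t)%R by rewrite mulr_gt0.
have p0 k : (0 <= poisson_pmf (lam * t) k)%R by exact: poisson_pmf_ge0.
rewrite (@poisson_expect t (fun k => k%:R * f k)%R)//; last by move=> k; rewrite mulr_ge0.
rewrite (@poisson_expect t (fun k => f k.+1))//.
rewrite -nneseriesZl; last by move=> k _; rewrite lee_fin mulr_ge0.
rewrite nneseries_recl//; last by move=> k _; rewrite lee_fin mulr_ge0// mulr_ge0.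
rewrite !mul0r add0e -(@nneseries_addn _ _ 1); last first.
  by move=> k; rewrite lee_fin mulr_ge0// mulr_ge0.
apply: eq_eseriesr => k _; rewrite addn1 -EFinM; congr EFin.
rewrite /poisson_pmf r0 factS natrM exprS.
have k1 : (k.+1%:R : R) != 0%R by rewrite pnatr_eq0.
move: (k.+1%:R : R) k1 (k`!%:R : R) (lam * t)%R (f k.+1) => x x0 y r fk.
transitivity ((x / x) * (r * (fk * (r ^+ k / y * expR (- r)))))%R.
  by rewrite invfM; ring.
by rewrite divff// mul1r.
Qed.

Lemma poisson_moments (t : R) : (0 < t)%R ->
  [/\ (fun w => (N t w)%:R : R) \in Lfun P 2%:E,
      'E_P[fun w => (N t w)%:R : R] = (lam * t)%:E &
      'V_P[fun w => (N t w)%:R : R] = (lam * t)%:E].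
Proof.
move=> t0; have mM := levy_measurable lN (ltW t0).
have e1 : \int[P]_w ((N t w)%:R)%:E = (lam * t)%:E :> \bar R.
  transitivity (\int[P]_w ((N t w)%:R * 1)%:E : \bar R).
    by apply: eq_integral => w _; rewrite mulr1.
  rewrite (@poisson_stein t (fun=> 1%R))// integral_cst//= probability_setT.
  by rewrite !mule1.
have e2 : \int[P]_w ((N t w)%:R ^+ 2)%:E = (lam * t * (lam * t + 1))%:E.
  transitivity (\int[P]_w ((N t w)%:R * (N t w)%:R)%:E : \bar R).
    by apply: eq_integral => w _; rewrite expr2.
  rewrite (@poisson_stein t (fun k => k%:R))//.
  transitivity ((lam * t)%:E * \int[P]_w (((N t w)%:R)%:E + 1%:E)).
    by congr (_ * _); apply: eq_integral => w _; rewrite -natr1 EFinD.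
  rewrite ge0_integralD//.
  - by rewrite e1 integral_cst//= probability_setT mule1 -EFinD -EFinM.
  - exact/measurable_EFinP.
have M2 : (fun w => (N t w)%:R : R) \in Lfun P 2%:E.
  by apply: L2_intro => //; rewrite e2 ltry.
have EM : 'E_P[fun w => (N t w)%:R : R] = (lam * t)%:E by rewrite unlock.
split => //; rewrite varianceE// EM.
have -> : 'E_P[(fun w => (N t w)%:R) ^+ 2] = (lam * t * (lam * t + 1))%:E by rewrite unlock.
by rewrite -EFin_expe -EFinB; congr EFin; ring.
Qed.

Lemma poisson_increment_moments (s t : R) : (0 <= s)%R -> (s <= t)%R ->
  [/\ (fun w => (N t w)%:R - (N s w)%:R : R)%R \in Lfun P 2%:E,
      'E_P[fun w => (N t w)%:R - (N s w)%:R : R]%R = (lam * (t - s))%:E &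
      'V_P[fun w => (N t w)%:R - (N s w)%:R : R]%R = (lam * (t - s))%:E].
Proof.
move=> s0 st; have t0 := le_trans s0 st.
have mI := measurable_increment lN s0 t0.
have [ts|ts] := eqVneq t s.
  rewrite ts subrr mulr0 (_ : (fun w => _) = cst 0%R); last first.
    by apply/funext => w; rewrite subrr.
  by rewrite Lfun_cst expectation_cst variance_cst.
have h0 : (0 < t - s)%R by rewrite subr_gt0 lt_neqAle eq_sym ts.
have [M2 EM VM] := poisson_moments h0.
apply: moments_of_squares => // b.
rewrite -(second_moment b M2 EM VM).
apply: (same_law_integral (P := P) (X := (fun w => (N t w)%:R - (N s w)%:R : R)%R)
  (Y := fun w => (N (t - s) w)%:R : R) (f := fun x : R => ((b + x) ^+ 2)%:E)) => //.
- exact: (levy_measurable lN (ltW h0)).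
- have := levy_stationary_increments lN s0 (ltW h0).
  by rewrite subrKC.
- apply/measurable_EFinP; apply: measurable_funX; exact: measurable_funD.
- by move=> y; rewrite lee_fin sqr_ge0.
Qed.

Lemma poisson_increments_uncorrelated (t1 t2 t3 t4 : R) :
  (0 <= t1)%R -> (t1 <= t2)%R -> (t2 <= t3)%R -> (t3 <= t4)%R ->
  covariance P (fun w => (N t2 w)%:R - (N t1 w)%:R : R)%R
    (fun w => (N t4 w)%:R - (N t3 w)%:R : R)%R = 0.
Proof.
move=> h1 h2 h3 h4; have t3p := le_trans h1 (le_trans h2 h3).
have [x2 _ _] := poisson_increment_moments h1 h2.
have [y2 _ _] := poisson_increment_moments t3p h4.
apply: indep_covariance => // A B mA mB.
exact: (levy_indep2 lN h1 h2 h3 h4 mA mB).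
Qed.

End poisson.

(** * Conditioning on the time change *)

Section generated.
Context {d : measure_display} {T : measurableType d}.

(** The information carried by a family of events is a random element: the
    identity, with values in the same set under the smaller sigma-algebra. *)
Lemma measurable_id_generated (G : set_system T) :
  (forall A, G A -> measurable A) ->
  measurable_fun setT (id : T -> g_sigma_algebraType G).
Proof.
move=> mG _ A mA; rewrite setTI preimage_id.
by apply: (smallest_sub _ _ mA); [exact: sigma_algebra_measurable|exact: mG].
Qed.

Lemma process_events_measurable {I : Type} d' (T' : measurableType d') (A : set I)
    (X : I -> T -> T') : (forall i, A i -> measurable_fun setT (X i)) ->
  forall B, process_events A X B -> measurable B.
Proof.
move=> mX; apply: smallest_sub; first exact: sigma_algebra_measurable.
by move=> B [i Ai [C mC <-]]; exact: mX.
Qed.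

Lemma measurable_process_generated {I : Type} d' (T' : measurableType d') (A : set I)
    (X : I -> T -> T') (G : set_system T) i : process_events A X `<=` <<s G >> ->
  A i -> measurable_fun setT (X i : g_sigma_algebraType G -> T').
Proof.
move=> XG Ai _ B mB; apply: XG; apply: sub_sigma_algebra.
by exists i => //; exists B.
Qed.

End generated.

Section random_sums.
Context {R : realType} {d1 d2 : measure_display} {E1 : measurableType d1}
  {E2 : measurableType d2}.

(** The number of terms takes countably many values. *)
Lemma measurable_random_sum (k : E1 -> nat) (X : nat -> E2 -> R) :
  measurable_fun setT k -> (forall i, measurable_fun setT (X i)) ->
  measurable_fun setT (fun z : E1 * E2 => \sum_(i < k z.1) X i z.2).
Proof.
move=> mk mX _ B mB; rewrite setTI.
rewrite [X in measurable X](_ : _ = \bigcup_n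
   ((k @^-1` [set n]) `*` ((fun w => \sum_(i < n) X i w) @^-1` B))).
  apply: bigcup_measurable => n _; apply: measurableX.
    by rewrite -[X in measurable X]setTI; exact: mk.
  rewrite -[X in measurable X]setTI.
  by apply: (@measurable_sum _ _ _ _ _ _ (fun (i : 'I_n) w => X i w)) => // i; exact: mX.
apply/seteqP; split => [[w1 w2] h|[w1 w2] [n _ [/= <-]]] //.
by exists (k w1).
Qed.

Lemma measurable_counting_eval (N : R -> E1 -> nat) (y : E2 -> R) :
  (forall t, 0 <= t -> measurable_fun setT (N t)) ->
  (forall w t, 0 <= t -> (N s w)%:R @[s --> t^'+] --> ((N t w)%:R : R)) ->
  measurable_fun setT y -> (forall w, 0 <= y w) ->
  measurable_fun setT (fun z : E1 * E2 => N (y z.2) z.1).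
Proof.
move=> mN cN my y0.
have h : measurable_fun setT (fun z : E1 * E2 => (N (y z.2) z.1)%:R : R).
  apply: (@measurable_eval R _ _ _ _ (fun t w => (N t w)%:R)) => // t t0.
  by apply: measurableT_comp => //; exact: mN.
move=> _ B mB; rewrite setTI.
rewrite [X in measurable X](_ : _ =
  (fun z : E1 * E2 => (N (y z.2) z.1)%:R : R) @^-1` ((fun k : nat => k%:R) @` B)).
  rewrite -[X in measurable X]setTI; apply: h => //.
  apply: countable_measurable => [x|]; first exact: measurable_set1.
  exact: (card_le_trans (card_image_le _ _) (countableP B)).
apply/seteqP; split => z /=; first by move=> Bz; exists (N (y z.2) z.1).
by move=> [k Bk /eqP]; rewrite eqr_nat => /eqP <-.
Qed.

End random_sums.

Section conditioning.
Local Open Scope ereal_scope.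
Context {d : measure_display} {T : measurableType d} {R : realType}.
Variable P : probability T R.
Variables (lam : R) (N : R -> T -> nat) (Y : R -> T -> R) (X : nat -> T -> R).
Hypothesis lam0 : (0 < lam)%R.
Hypothesis hN : poisson_process P lam N.
Hypothesis Y0 : forall t w, (0 <= Y t w)%R.
Hypothesis mY : forall t, (0 <= t)%R -> measurable_fun setT (Y t).
Hypothesis Y_mono : forall s t, (0 <= s)%R -> (s <= t)%R ->
  {ae P, forall w, (Y s w <= Y t w)%R}.
Hypothesis hNY : independent_classes P
  (process_events nonneg_times N) (process_events nonneg_times Y).
Hypothesis mX : forall i, measurable_fun setT (X i).
Hypothesis iidX : iid P X.
Variables (m v : R).
Hypothesis X0_2 : X 0%N \in Lfun P 2%:E.
Hypothesis EX0 : 'E_P[X 0%N] = m%:E.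
Hypothesis VX0 : 'V_P[X 0%N] = v%:E.
Hypothesis hX_indep : independent_classes P
  <<s process_events nonneg_times N `|` process_events nonneg_times Y >>
  (process_events setT X).

Let lN := poisson_levy hN.
Let mN t : (0 <= t)%R -> measurable_fun setT (N t) := poisson_measurable hN (t := t).
Let cN w t : (0 <= t)%R -> (N s w)%:R @[s --> t^'+] --> ((N t w)%:R : R).
Proof. exact: (levy_cadlag lN w).1. Qed.

Let evN : set_system T := process_events nonneg_times N.
Let evY : set_system T := process_events nonneg_times Y.
Let genN := \bigcup_(i in @nonneg_times R) rv_events (N i).
Let genY := \bigcup_(i in @nonneg_times R) rv_events (Y i).
Let genX := \bigcup_(i in @setT nat) rv_events (X i).
Let TN := g_sigma_algebraType genN.
Let TY := g_sigma_algebraType genY.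
Let TX := g_sigma_algebraType genX.
Let TNY := g_sigma_algebraType (evN `|` evY).

Let evN_meas A : evN A -> measurable A.
Proof. by apply: process_events_measurable => t; exact: mN. Qed.
Let evY_meas A : evY A -> measurable A.
Proof. by apply: process_events_measurable => t; exact: mY. Qed.
Let genN_meas A : genN A -> measurable A.
Proof. by move=> h; apply: evN_meas; exact: sub_sigma_algebra. Qed.
Let genY_meas A : genY A -> measurable A.
Proof. by move=> h; apply: evY_meas; exact: sub_sigma_algebra. Qed.
Let genX_meas A : genX A -> measurable A.
Proof.
move=> h; apply: (@process_events_measurable _ _ _ _ _ setT X (fun i _ => mX i)).
exact: sub_sigma_algebra.
Qed.
Let genNY_meas A : (evN `|` evY) A -> measurable A.
Proof. by case; [exact: evN_meas|exact: evY_meas]. Qed.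

Let mN_TN t : (0 <= t)%R -> measurable_fun setT (N t : TN -> nat).
Proof. exact: (@measurable_process_generated _ _ _ _ _ (@nonneg_times R) N genN). Qed.
Let mY_TY t : (0 <= t)%R -> measurable_fun setT (Y t : TY -> R).
Proof. exact: (@measurable_process_generated _ _ _ _ _ (@nonneg_times R) Y genY). Qed.
Let mX_TX i : measurable_fun setT (X i : TX -> R).
Proof. exact: (@measurable_process_generated _ _ _ _ _ setT X genX). Qed.
Let mN_TNY t : (0 <= t)%R -> measurable_fun setT (N t : TNY -> nat).
Proof.
move=> t0; apply: (@measurable_process_generated _ _ _ _ _ (@nonneg_times R)) => //.
by move=> A h; apply: sub_sigma_algebra; left.
Qed.
Let mY_TNY t : (0 <= t)%R -> measurable_fun setT (Y t : TNY -> R).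
Proof.
move=> t0; apply: (@measurable_process_generated _ _ _ _ _ (@nonneg_times R)) => //.
by move=> A h; apply: sub_sigma_algebra; right.
Qed.

Let K t : T -> nat := time_changed N Y t.

Let mK_TNY t : (0 <= t)%R -> measurable_fun setT (K t : TNY -> nat).
Proof.
move=> t0.
have h := @measurable_counting_eval R _ _ TNY TNY N (Y t) mN_TNY cN (mY_TNY t0) (Y0 t).
exact: (measurableT_comp h (measurable_fun_pair (@measurable_id _ TNY setT) (@measurable_id _ TNY setT))).
Qed.

Let mK_pair t : (0 <= t)%R -> measurable_fun setT (fun z : TY * TN => N (Y t z.1) z.2).
Proof.
move=> t0.
have h := @measurable_counting_eval R _ _ TN TY N (Y t) mN_TN cN (mY_TY t0) (Y0 t).
have sw : measurable_fun setT (@unstable.swap TY TN) by exact: measurable_swap.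
exact: (measurableT_comp h sw).
Qed.

Variables (c t1 t2 t3 t4 b e1 e2 : R).
Hypotheses (h1 : (0 <= t1)%R) (h2 : (t1 <= t2)%R) (h3 : (t2 <= t3)%R) (h4 : (t3 <= t4)%R).
Let t2p : (0 <= t2)%R. Proof. exact: le_trans h2. Qed.
Let t3p : (0 <= t3)%R. Proof. exact: le_trans h3. Qed.
Let t4p : (0 <= t4)%R. Proof. exact: le_trans h4. Qed.

(** Premiums minus claims over a time window. *)
Definition surplus s t w : R := (c * (Y t w - Y s w) -
  (\sum_(i < time_changed N Y t w) X i w - \sum_(i < time_changed N Y s w) X i w))%R.

Let surplus2 s t (z : T * T) : R := (c * (Y t z.1 - Y s z.1) -
  (\sum_(i < K t z.1) X i z.2 - \sum_(i < K s z.1) X i z.2))%R.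

Let meas_surplus2 s t : (0 <= s)%R -> (0 <= t)%R ->
  measurable_fun setT (surplus2 s t : TNY * TX -> R).
Proof.
move=> s0 t0; apply: measurable_funB.
  apply: measurable_funM => //; apply: measurable_funB.
    exact: (measurableT_comp (mY_TNY t0) measurable_fst).
  exact: (measurableT_comp (mY_TNY s0) measurable_fst).
apply: measurable_funB.
  exact: (@measurable_random_sum R _ _ TNY TX (K t) X (mK_TNY t0) mX_TX).
exact: (@measurable_random_sum R _ _ TNY TX (K s) X (mK_TNY s0) mX_TX).
Qed.

Let B w : R := (b + e1 * (c * (Y t2 w - Y t1 w)) + e2 * (c * (Y t4 w - Y t3 w)))%R.

Let good : {ae P, forall w, [/\ (Y t1 w <= Y t2 w)%R, (Y t2 w <= Y t3 w)%R & (Y t3 w <= Y t4 w)%R]}.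
Proof.
have g12 := Y_mono h1 h2; have g23 := Y_mono t2p h3; have g34 := Y_mono t3p h4.
by apply: filterS3 g12 g23 g34 => w ? ? ?.
Qed.

Let N_mono w s t : (0 <= s)%R -> (s <= t)%R -> (N s w <= N t w)%N.
Proof. exact: poisson_nondecreasing hN w s t. Qed.

Let sums_sub (w : T) k l : (k <= l)%N ->
  (\sum_(i < l) X i w - \sum_(i < k) X i w)%R = claims_sum X k l w.
Proof.
move=> kl; rewrite -!(big_mkord xpredT (fun i => X i w)).
by rewrite (@big_cat_nat _ _ _ k) //= addrAC subrr add0r.
Qed.

(* The quadratic form left after averaging over the claims.  Truncated subtraction
   keeps it nonnegative on the null event where the times are out of order. *)
Let quad (z : T * T) : R :=
  ((B z.1 + (- (m * e1)) * ((N (Y t2 z.1) z.2 - N (Y t1 z.1) z.2)%N%:R) +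
     (- (m * e2)) * ((N (Y t4 z.1) z.2 - N (Y t3 z.1) z.2)%N%:R)) ^+ 2 +
   v * (e1 ^+ 2 * (N (Y t2 z.1) z.2 - N (Y t1 z.1) z.2)%N%:R +
        e2 ^+ 2 * (N (Y t4 z.1) z.2 - N (Y t3 z.1) z.2)%N%:R))%R.

Let v0 : (0 <= v)%R.
Proof. by rewrite -lee_fin -VX0 variance_ge0. Qed.

Let quad_ge0 z : (0 <= quad z)%R.
Proof.
rewrite addr_ge0 ?sqr_ge0// mulr_ge0// addr_ge0// mulr_ge0 ?sqr_ge0//.
Qed.

(* For fixed times the claims of the two windows are disjoint blocks of the
   sequence, hence uncorrelated. *)
Let average_claims w : [/\ (Y t1 w <= Y t2 w)%R, (Y t2 w <= Y t3 w)%R & (Y t3 w <= Y t4 w)%R] ->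
  \int[P]_w2 ((b + e1 * surplus2 t1 t2 (w, w2) + e2 * surplus2 t3 t4 (w, w2)) ^+ 2)%:E =
  (quad (w, w))%:E.
Proof.
move=> [y12 y23 y34].
have k12 : (K t1 w <= K t2 w)%N by exact: N_mono.
have k23 : (K t2 w <= K t3 w)%N by exact: N_mono.
have k34 : (K t3 w <= K t4 w)%N by exact: N_mono.
transitivity (\int[P]_w2 ((B w + (- e1) * claims_sum X (K t1 w) (K t2 w) w2 +
    (- e2) * claims_sum X (K t3 w) (K t4 w) w2) ^+ 2)%:E).
  apply: eq_integral => w2 _; rewrite /surplus2 /= !sums_sub// /B; congr EFin.
  by congr (_ ^+ 2)%R; ring.
rewrite (second_moment_pair (B w) (- e1) (- e2)
  (claims_sum_L2 mX iidX X0_2 EX0 VX0 _ _) (claims_sum_L2 mX iidX X0_2 EX0 VX0 _ _)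
  (claims_sum_mean mX iidX X0_2 EX0 VX0 k12) (claims_sum_mean mX iidX X0_2 EX0 VX0 k34)
  (claims_sum_variance mX iidX X0_2 EX0 VX0 k12) (claims_sum_variance mX iidX X0_2 EX0 VX0 k34)
  (claims_sum_disjoint mX iidX X0_2 EX0 VX0 k12 k23 k34)).
congr EFin; rewrite /quad /K /time_changed /=.
move: (N _ _ - N _ _)%N%:R (N (Y t4 w) w - N _ _)%N%:R => x y; ring.
Qed.

(* For a fixed time change the two jump counts are uncorrelated Poisson variables. *)
Let average_jumps w : [/\ (Y t1 w <= Y t2 w)%R, (Y t2 w <= Y t3 w)%R & (Y t3 w <= Y t4 w)%R] ->
  \int[P]_w2 (quad (w, w2))%:E =
  ((b + (c - m * lam) * (e1 * (Y t2 w - Y t1 w) + e2 * (Y t4 w - Y t3 w))) ^+ 2 +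
    lam * (v + m ^+ 2) * (e1 ^+ 2 * (Y t2 w - Y t1 w) + e2 ^+ 2 * (Y t4 w - Y t3 w)))%:E.
Proof.
move=> [y12 y23 y34].
have [L12 E12 V12] := poisson_increment_moments lam0 hN (Y0 t1 w) y12.
have [L34 E34 V34] := poisson_increment_moments lam0 hN (Y0 t3 w) y34.
have c0 := poisson_increments_uncorrelated lam0 hN (Y0 t1 w) y12 y23 y34.
set k12 := (fun _ => _) in L12 E12 V12 c0; set k34 := (fun _ => _) in L34 E34 V34 c0.
have kE s t w2 : (Y s w <= Y t w)%R ->
    (N (Y t w) w2 - N (Y s w) w2)%N%:R = ((N (Y t w) w2)%:R - (N (Y s w) w2)%:R)%R :> R.
  by move=> st; rewrite natrB// N_mono.
have m12 := L2_measurable L12; have m34 := L2_measurable L34.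
have p12 w2 : (0 <= k12 w2)%R by rewrite /k12 -kE.
have p34 w2 : (0 <= k34 w2)%R by rewrite /k34 -kE.
pose S w2 : \bar R := ((B w + (- (m * e1)) * k12 w2 + (- (m * e2)) * k34 w2) ^+ 2)%:E.
pose V w2 : \bar R := (v * (e1 ^+ 2 * k12 w2 + e2 ^+ 2 * k34 w2))%:E.
transitivity (\int[P]_w2 (S w2 + V w2)).
  by apply: eq_integral => w2 _; rewrite /quad /= !kE.
rewrite ge0_integralD//; last 4 first.
- by move=> w2 _; rewrite lee_fin sqr_ge0.
- apply/measurable_EFinP; apply: measurable_funX.
  by apply: measurable_funD; [apply: measurable_funD => //|]; apply: measurable_funM.
- by move=> w2 _; rewrite lee_fin mulr_ge0// addr_ge0// mulr_ge0 ?sqr_ge0.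
- apply/measurable_EFinP; apply: measurable_funM => //.
  by apply: measurable_funD; apply: measurable_funM.
have -> : \int[P]_w2 V w2 = (v * (e1 ^+ 2 * (lam * (Y t2 w - Y t1 w)) +
    e2 ^+ 2 * (lam * (Y t4 w - Y t3 w))))%:E.
  have EE : 'E_P[v \o* ((e1 ^+ 2) \o* k12 \+ (e2 ^+ 2) \o* k34)]%R = \int[P]_w2 V w2.
    rewrite unlock; apply: eq_integral => w2 _; rewrite /V /=; congr EFin; ring.
  rewrite -EE expectationZl; last by rewrite L2_L1// L2_add// L2_scale.
  rewrite expectationD ?L2_L1 ?L2_scale// !expectationZl ?L2_L1//.
  by rewrite E12 E34 [RHS]EFinM EFinD (EFinM (e1 ^+ 2)) (EFinM (e2 ^+ 2)).
rewrite (second_moment_pair (B w) (- (m * e1)) (- (m * e2)) L12 L34 E12 E34 V12 V34 c0).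
by rewrite -EFinD; congr EFin; rewrite /B; ring.
Qed.

(** The claims are averaged given the pair ([N], [Y]), then the jumps given [Y].
    The first average adds the variance of a claim per jump, the second adds the
    squared mean, which together make [E X^2 = v + m^2]. *)
Lemma surplus_second_moment :
  \int[P]_w ((b + e1 * surplus t1 t2 w + e2 * surplus t3 t4 w) ^+ 2)%:E =
  \int[P]_w ((b + (c - m * lam) * (e1 * (Y t2 w - Y t1 w) + e2 * (Y t4 w - Y t3 w))) ^+ 2 +
    lam * (v + m ^+ 2) * (e1 ^+ 2 * (Y t2 w - Y t1 w) + e2 ^+ 2 * (Y t4 w - Y t3 w)))%:E.
Proof.
pose F (z : TNY * TX) : \bar R := ((b + e1 * surplus2 t1 t2 z + e2 * surplus2 t3 t4 z) ^+ 2)%:E.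
have mF : measurable_fun setT F.
  apply/measurable_EFinP; apply: measurable_funX.
  apply: measurable_funD; first apply: measurable_funD => //.
    by apply: measurable_funM => //; exact: meas_surplus2.
  by apply: measurable_funM => //; exact: meas_surplus2.
have F0 z : 0 <= F z by rewrite lee_fin sqr_ge0.
pose Q (z : TY * TN) : \bar R := (quad z)%:E.
have mQ : measurable_fun setT Q.
  have mK' s t : (0 <= s)%R -> (0 <= t)%R -> measurable_fun setT
      (fun z : TY * TN => (N (Y t z.1) z.2 - N (Y s z.1) z.2)%N%:R : R).
    move=> s0 t0.
    have ms : measurable_fun setT (fun k : nat => k%:R : R) by [].
    exact: (measurableT_comp ms (measurable_fun_subn (mK_pair t0) (mK_pair s0))).
  have mY' t : (0 <= t)%R -> measurable_fun setT (fun z : TY * TN => Y t z.1).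
    by move=> t0; exact: (measurableT_comp (mY_TY t0) measurable_fst).
  have mB : measurable_fun setT (fun z : TY * TN => B z.1).
    apply: measurable_funD; first apply: measurable_funD => //.
      by do 2! apply: measurable_funM => //; apply: measurable_funB; exact: mY'.
    by do 2! apply: measurable_funM => //; apply: measurable_funB; exact: mY'.
  apply/measurable_EFinP; apply: measurable_funD.
    apply: measurable_funX; apply: measurable_funD; first apply: measurable_funD => //.
      by apply: measurable_funM => //; exact: mK'.
    by apply: measurable_funM => //; exact: mK'.
  apply: measurable_funM => //; apply: measurable_funD; apply: measurable_funM => //; exact: mK'.
have Q0 z : 0 <= Q z by rewrite lee_fin quad_ge0.
have mid_N : measurable_fun setT (id : T -> TN) := measurable_id_generated genN_meas.
have mid_Y : measurable_fun setT (id : T -> TY) := measurable_id_generated genY_meas.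
have mid_X : measurable_fun setT (id : T -> TX) := measurable_id_generated genX_meas.
have mid_NY : measurable_fun setT (id : T -> TNY) := measurable_id_generated genNY_meas.
transitivity (\int[P]_w1 \int[P]_w2 F (w1, w2)).
  exact: (@indep_integral _ _ _ _ TNY TX R P id id mid_NY mid_X (fun A B => @hX_indep A B) F mF F0).
have mQd : measurable_fun setT (fun w : T => Q (w, w)).
  exact: (measurableT_comp mQ (measurable_fun_pair mid_Y mid_N)).
transitivity (\int[P]_w Q (w, w)).
  apply: ae_eq_integral => //.
  - have h := @measurable_fun_fubini_tonelli_F _ _ _ _ R P
      (fun z : T * T => F (z.1, z.2)).
    apply: h => // .
    apply: (measurableT_comp mF); apply: measurable_fun_pair.
      exact: (measurableT_comp mid_NY measurable_fst).
    exact: (measurableT_comp mid_X measurable_snd).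
  - by have := good; apply: filterS => w g _; exact: average_claims.
transitivity (\int[P]_w1 \int[P]_w2 Q (w1, w2)).
  apply: (@indep_integral _ _ _ _ TY TN R P id id mid_Y mid_N _ Q mQ Q0).
  by move=> A C mA mC; rewrite setIC muleC; exact: hNY.
apply: ae_eq_integral => //.
- have h := @measurable_fun_fubini_tonelli_F _ _ _ _ R P
      (fun z : T * T => Q (z.1, z.2)).
  apply: h => //.
  apply: (measurableT_comp mQ); apply: measurable_fun_pair.
    exact: (measurableT_comp mid_Y measurable_fst).
  exact: (measurableT_comp mid_N measurable_snd).
- have mD s t : (0 <= s)%R -> (0 <= t)%R -> measurable_fun setT (fun w => Y t w - Y s w)%R.
    by move=> s0 t0; apply: measurable_funB; exact: mY.
  apply/measurable_EFinP; apply: measurable_funD.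
    apply: measurable_funX; apply: measurable_funD => //; apply: measurable_funM => //.
    by apply: measurable_funD; apply: measurable_funM => //; exact: mD.
  apply: measurable_funM => //.
  by apply: measurable_funD; apply: measurable_funM => //; exact: mD.
- by have := good; apply: filterS => w g _; exact: average_jumps.
Qed.

End conditioning.

(** * Power decay at infinity *)

Section regular_decay.
Context {R : realType}.
Implicit Types (c k l t : R) (f g : R -> R).

Lemma powR_shift_cvg c k : t `^ c / (t + k) `^ c @[t --> +oo] --> (1 : R).
Proof.
have inv0 : (t + k)^-1 @[t --> +oo] --> (0 : R).
  apply/gtr0_cvgV0; last exact: cvg_addrr.
  by near=> t; rewrite -ltrBlDr; near: t; apply: nbhs_pinfty_gt; exact: num_real.
have q : 1 - k * (t + k)^-1 @[t --> +oo] --> (1 - k * 0 : R).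
  by apply: cvgB; [exact: cvg_cst|apply: cvgM => //; exact: cvg_cst].
rewrite mulr0 subr0 in q.
have lq : expR (c * ln (1 - k * (t + k)^-1)) @[t --> +oo] --> expR (c * ln (1 : R)).
  have cl : {for (1 : R), continuous (@ln R)} by apply: continuous_ln.
  have ch : {for (1 : R), continuous (fun x : R => expR (c * ln x))}.
    apply: (@continuous_comp _ _ _ (fun x : R => c * ln x) (@expR R)); last exact: continuous_expR.
    by apply: continuousM; [exact: cst_continuous|exact: cl].
  exact: (cvg_comp _ _ q ch).
rewrite ln1 mulr0 expR0 in lq.
apply: cvg_trans lq; apply: near_eq_cvg; near=> t.
have t0 : 0 < t by near: t; apply: nbhs_pinfty_gt; exact: num_real.
have tk0 : 0 < t + k by rewrite -ltrBlDr; near: t; apply: nbhs_pinfty_gt; exact: num_real.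
have -> : 1 - k * (t + k)^-1 = t / (t + k).
  by rewrite -[X in X - _](divff (lt0r_neq0 tk0)) -mulrBl addrK.
rewrite lnM ?posrE ?invr_gt0// lnV ?posrE// mulrBr expRD expRN /powR.
by rewrite !gt_eqF.
Unshelve. all: by end_near. Qed.

Lemma regular_shift c k l f : t `^ c * f t @[t --> +oo] --> l ->
  t `^ c * f (t + k) @[t --> +oo] --> l.
Proof.
move=> h.
have h' : (t + k) `^ c * f (t + k) @[t --> +oo] --> l.
  exact: (cvg_comp (fun t : R => t + k) (fun s : R => s `^ c * f s) (@cvg_addrr R k) h).
have hh : t `^ c / (t + k) `^ c * ((t + k) `^ c * f (t + k)) @[t --> +oo] --> 1 * l.
  exact: cvgM (powR_shift_cvg c k) h'.
rewrite mul1r in hh; apply: cvg_trans hh; apply: near_eq_cvg; near=> t.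
have tk0 : 0 < t + k by rewrite -ltrBlDr; near: t; apply: nbhs_pinfty_gt; exact: num_real.
have : (t + k) `^ c != 0 by rewrite gt_eqF// powR_gt0.
move: (f (t + k)) ((t + k) `^ c) (t `^ c) => x y z y0 /=.
by rewrite mulrA divfK.
Unshelve. all: by end_near. Qed.

Lemma powRN_cvg0 c : 0 < c -> t `^ (- c) @[t --> +oo] --> (0 : R).
Proof.
move=> c0; apply/cvgrPdist_le => e e0.
near=> t.
have t0 : 0 < t by near: t; apply: nbhs_pinfty_gt; exact: num_real.
rewrite sub0r normrN ger0_norm ?powR_ge0// powRN invf_ple ?posrE ?powR_gt0//.
have -> : e^-1 = ((e^-1) `^ c^-1) `^ c.
  by rewrite -powRrM mulVf ?gt_eqF// powRr1// invr_ge0 ltW.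
rewrite ge0_ler_powR ?(ltW c0)// ?nnegrE ?powR_ge0 ?(ltW t0)//.
Unshelve. all: by end_near. Qed.

Lemma regular_squeeze c k k' l f g :
  t `^ c * g t @[t --> +oo] --> l ->
  (\forall t \near +oo, g (t + k) <= f t <= g (t + k')) ->
  t `^ c * f t @[t --> +oo] --> l.
Proof.
move=> h b; apply: (squeeze_cvgr _ (regular_shift k h) (regular_shift k' h)).
by apply: filterS b => t /andP[h1 h2]; rewrite !ler_wpM2l ?powR_ge0.
Qed.

Lemma regular_scale c (a : R) l f : t `^ c * f t @[t --> +oo] --> l ->
  t `^ c * (a * f t) @[t --> +oo] --> a * l.
Proof.
move=> h; have hh : a * (t `^ c * f t) @[t --> +oo] --> a * l.
  by apply: cvgM => //; exact: cvg_cst.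
by apply: cvg_trans hh; apply: near_eq_cvg; near=> t; rewrite mulrCA.
Unshelve. all: by end_near. Qed.

(** For a nonzero constant a limit of the ratio is enough; equivalence to the zero
    function means vanishing near infinity. *)
Lemma regular_decay_equiv (nu l : R) f :
  t `^ nu * f t @[t --> +oo] --> l ->
  (l = 0 -> \forall t \near +oo, f t = 0) ->
  f ~_(at_infinity R) (fun t => l * t `^ (- nu)).
Proof.
move=> h z; apply/eqaddoP => e e0.
have [l0|l0] := eqVneq l 0.
  apply: filterS (z l0) => t ft; rewrite /= -[X in `|X| <= _]/(f t - l * t `^ (- nu)).
  by rewrite ft l0 !mul0r subr0 normr0 mulr0.
have el0 : 0 < e * `|l| by rewrite mulr_gt0 ?normr_gt0.
near=> t.
have t0 : 0 < t by near: t; apply: nbhs_pinfty_gt; exact: num_real.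
have tn0 : 0 < t `^ nu by rewrite powR_gt0.
have h2 : `|l - t `^ nu * f t| <= e * `|l|.
  by near: t; move/cvgrPdist_le : h; apply.
rewrite -[X in `|X| <= _]/(f t - l * t `^ (- nu)) powRN.
have -> : f t - l / t `^ nu = (t `^ nu * f t - l) / t `^ nu.
  by rewrite mulrBl mulrAC divff ?gt_eqF// mul1r.
rewrite !normrM mulrA ler_wpM2r// distrC; exact: h2.
Unshelve. all: by end_near. Qed.

End regular_decay.

(** * From second moments to covariances *)

Section covariance_transfer.
Local Open Scope ereal_scope.
Context {d : measure_display} {T : measurableType d} {R : realType}.
Variable P : probability T R.
Variables (Z1 Z2 D1 D2 : T -> R) (k L m1 m2 v1 v2 c : R).
Hypotheses (mZ1 : measurable_fun setT Z1) (mZ2 : measurable_fun setT Z2).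
Hypotheses (D1_2 : D1 \in Lfun P 2%:E) (D2_2 : D2 \in Lfun P 2%:E).
Hypotheses (E1 : 'E_P[D1] = m1%:E) (E2 : 'E_P[D2] = m2%:E).
Hypotheses (V1 : 'V_P[D1] = v1%:E) (V2 : 'V_P[D2] = v2%:E).
Hypothesis cov12 : covariance P D1 D2 = c%:E.
Hypothesis moments : forall b e1 e2 : R,
  \int[P]_w ((b + e1 * Z1 w + e2 * Z2 w) ^+ 2)%:E =
  \int[P]_w ((b + k * (e1 * D1 w + e2 * D2 w)) ^+ 2 +
    L * (e1 ^+ 2 * D1 w + e2 ^+ 2 * D2 w))%:E.

Let moments_formula (b e1 e2 : R) :
  \int[P]_w ((b + (e1 * Z1 w + e2 * Z2 w)) ^+ 2)%:E =
  ((b + k * (e1 * m1 + e2 * m2)) ^+ 2 +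
   (k ^+ 2 * (e1 ^+ 2 * v1 + e2 ^+ 2 * v2 + 2 * e1 * e2 * c) +
    L * (e1 ^+ 2 * m1 + e2 ^+ 2 * m2)))%:E.
Proof.
transitivity (\int[P]_w ((b + e1 * Z1 w + e2 * Z2 w) ^+ 2)%:E).
  by apply: eq_integral => w _; rewrite addrA.
rewrite moments.
have x1 := L2_scale (k * e1) D1_2; have x2 := L2_scale (k * e2) D2_2.
pose xi := ((k * e1) \o* D1 \+ (k * e2) \o* D2)%R.
have xi2 : xi \in Lfun P 2%:E by exact: L2_add.
have Exi : 'E_P[xi] = (k * (e1 * m1 + e2 * m2))%:E.
  rewrite (expectationD (L2_L1 x1) (L2_L1 x2)).
  rewrite (expectationZl _ (L2_L1 D1_2)) (expectationZl _ (L2_L1 D2_2)) E1 E2.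
  by rewrite -!EFinM -EFinD; congr EFin; ring.
have Vxi : 'V_P[xi] = (k ^+ 2 * (e1 ^+ 2 * v1 + e2 ^+ 2 * v2 + 2 * e1 * e2 * c))%:E.
  rewrite (varianceD x1 x2) (varianceZ _ D1_2) (varianceZ _ D2_2) V1 V2.
  rewrite (covarianceZl _ (L2_L1 D1_2) (L2_L1 x2) (Lfun2_mul_Lfun1 D1_2 x2)).
  rewrite (covarianceZr _ (L2_L1 D1_2) (L2_L1 D2_2) (Lfun2_mul_Lfun1 D1_2 D2_2)) cov12.
  by rewrite -!EFinM -!EFinD; congr EFin; ring.
pose S w : R := ((b + xi w) ^+ 2)%R.
pose V := ((L * e1 ^+ 2) \o* D1 \+ (L * e2 ^+ 2) \o* D2)%R.
have y1 := L2_scale (L * e1 ^+ 2) D1_2; have y2 := L2_scale (L * e2 ^+ 2) D2_2.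
have EV : 'E_P[V] = (L * (e1 ^+ 2 * m1 + e2 ^+ 2 * m2))%:E.
  rewrite (expectationD (L2_L1 y1) (L2_L1 y2)).
  rewrite (expectationZl _ (L2_L1 D1_2)) (expectationZl _ (L2_L1 D2_2)) E1 E2.
  by rewrite -!EFinM -EFinD; congr EFin; ring.
have V1' : V \in Lfun P 1 by rewrite L2_L1// L2_add.
have ES := second_moment b xi2 Exi Vxi.
have S1 : S \in Lfun P 1.
  have b2 : (cst b \+ xi)%R \in Lfun P 2%:E by rewrite L2_add// Lfun_cst.
  by apply/Lfun1_integrable; exact: (Lfun2_integrable_sqr b2).
have : 'E_P[S \+ V] = 'E_P[S] + 'E_P[V] by exact: expectationD.
have hS : 'E_P[S] = ((b + k * (e1 * m1 + e2 * m2)) ^+ 2 +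
    k ^+ 2 * (e1 ^+ 2 * v1 + e2 ^+ 2 * v2 + 2 * e1 * e2 * c))%:E.
  by rewrite unlock -ES.
rewrite EV hS unlock -EFinD.
move=> h; rewrite addrA -h; apply: eq_integral => w _; congr EFin.
by rewrite /S /V /xi /=; ring.
Qed.

Let mZ e1 e2 : measurable_fun setT (fun w => e1 * Z1 w + e2 * Z2 w)%R.
Proof. by apply: measurable_funD; exact: measurable_funM. Qed.

Lemma transfer_first :
  [/\ Z1 \in Lfun P 2%:E, 'E_P[Z1] = (k * m1)%:E &
      'V_P[Z1] = (k ^+ 2 * v1 + L * m1)%:E].
Proof.
have [h1 h2 h3] := moments_of_squares (mZ 1 0) (fun b => moments_formula b 1 0).
have e : (fun w => 1 * Z1 w + 0 * Z2 w)%R = Z1.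
  by apply/funext => w; rewrite mul1r mul0r addr0.
rewrite e in h1 h2 h3; rewrite h1 h2 h3; split => //; congr EFin; ring.
Qed.

Lemma transfer_second :
  [/\ Z2 \in Lfun P 2%:E, 'E_P[Z2] = (k * m2)%:E &
      'V_P[Z2] = (k ^+ 2 * v2 + L * m2)%:E].
Proof.
have [h1 h2 h3] := moments_of_squares (mZ 0 1) (fun b => moments_formula b 0 1).
have e : (fun w => 0 * Z1 w + 1 * Z2 w)%R = Z2.
  by apply/funext => w; rewrite mul1r mul0r add0r.
rewrite e in h1 h2 h3; rewrite h1 h2 h3; split => //; congr EFin; ring.
Qed.

(** Polarization: the variance of [Z1 + Z2] comes from the second moments with
    equal weights. *)
Lemma transfer_covariance : covariance P Z1 Z2 = (k ^+ 2 * c)%:E.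
Proof.
have [z1 _ W1] := transfer_first; have [z2 _ W2] := transfer_second.
have [_ _ W] := moments_of_squares (mZ 1 1) (fun b => moments_formula b 1 1).
have e : (fun w => 1 * Z1 w + 1 * Z2 w)%R = (Z1 \+ Z2)%R.
  by apply/funext => w; rewrite !mul1r.
have c_fin : covariance P Z1 Z2 \is a fin_num.
  exact: (covariance_fin_num (L2_L1 z1) (L2_L1 z2) (Lfun2_mul_Lfun1 z1 z2)).
have := varianceD z1 z2; rewrite -e W W1 W2 -(fineK c_fin) -!EFinM -!EFinD => -[h].
by congr EFin; move: h; rewrite !expr1n !mul1r !mulr1; lra.
Qed.

End covariance_transfer.

(** * Decay of the correlation of the noise *)

Section noise_decay.
Context {R : realType} {d : measure_display} {T : measurableType d}.
Variable P : probability T R.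
Variables (u0 rho lam mu dl : R).
Hypotheses (lam0 : 0 < lam) (mu0 : 0 < mu) (dl0 : 0 < dl).
Variables (D : R -> T -> R) (N : R -> T -> nat) (X : nat -> T -> R).
Notation Y := (inverse_subordinator D).
Hypothesis subD : subordinator P D.
Hypothesis hN : poisson_process P lam N.
Hypothesis hNY : independent_classes P
  (process_events nonneg_times N) (process_events nonneg_times Y).
Hypothesis mX : forall i, measurable_fun setT (X i).
Hypothesis iidX : iid P X.
Hypothesis EX0 : 'E_P[X 0%N]%E = mu%:E.
Hypothesis X0_2 : X 0%N \in Lfun P 2%:E.
Hypothesis hX_indep : independent_classes P
  <<s process_events nonneg_times N `|` process_events nonneg_times Y >>
  (process_events setT X).

Notation pot := (pot P D).

Variables u v : R -> R.
Hypothesis u_ge0 : forall t, 0 <= u t.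
Hypothesis u_gt0 : forall t, 0 < t -> 0 < u t.
Hypothesis measurable_u : measurable_fun setT
  (fun t => \1_(`]0, +oo[%classic : set R) t * u t).
Hypothesis u_le : forall s t, 0 < s -> s <= t -> u t <= u s.
Hypothesis v_le : forall s t, 0 < s -> s <= t -> v t <= v s.
Hypothesis v_ge0 : forall t, 0 < t -> 0 <= v t.
Hypothesis u_diff : forall x y, 0 <= x -> x < y ->
  x * v y <= u (y - x) - u y <= x * v (y - x).
Hypothesis cdf_pot : forall b, 0 <= b ->
  pot (leI b) = (\int[lebesgue_measure]_(t in `]0%R, b]) (u t)%:E)%E.
Hypothesis cdf_fin : forall b, 0 <= b -> (pot (leI b) < +oo)%E.

Variables (a A W : R).
Hypotheses (a0 : 0 < a) (a1 : a < 1) (A0 : 0 < A) (W0 : 0 < W).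
Hypothesis cvg_u : t `^ a * u t @[t --> +oo] --> A.
Hypothesis cvg_v : t `^ (a + 1) * v t @[t --> +oo] --> W.

Let Dl t w : R := Y (t + dl) w - Y t w.
Let m t : R := fine (pot (itvI t (t + dl))).
Let q t : R := fine (\int[P]_w (occ D (itvI t (t + dl)) w * occ D (itvI t (t + dl)) w))%E.
Let K : R := fine (pot_tent P D dl).
Let M s : R := fine (pot_mean P D s dl).
(* Mixed second moment of the two occupation times. *)
Let cross s t : R :=
  fine (\int[P]_w (occ D (itvI s (s + dl)) w * occ D (itvI t (t + dl)) w))%E.

Let dl_ge0 : 0 <= dl := ltW dl0.
Let le_dl t : t <= t + dl. Proof. by rewrite lerDl. Qed.
Let dl_pos t : 0 <= t -> 0 <= t + dl. Proof. by move=> t0; rewrite addr_ge0. Qed.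

Let mY t : 0 <= t -> measurable_fun setT (Y t).
Proof. exact: (measurable_inverse subD). Qed.

Let mDl t : 0 <= t -> measurable_fun setT (Dl t).
Proof. by move=> t0; apply: measurable_funB; apply: mY => //; exact: dl_pos. Qed.

Let potE t : 0 <= t -> pot (itvI t (t + dl)) = (m t)%:E.
Proof.
move=> t0; rewrite /m fineK// ge0_fin_numE; last by apply: pot_ge0; exact: itvI_ge0.
by rewrite (pot_itvI_fin subD cdf_fin)// dl_pos.
Qed.

Let m_bounds t : 0 < t -> dl * u (t + dl) <= m t <= dl * u t.
Proof.
move=> t0; have := pot_itv_bounds subD u_ge0 measurable_u u_le cdf_pot cdf_fin t0 (le_dl t).
by rewrite (potE (ltW t0)) !lee_fin addrAC subrr add0r.
Qed.

Let q_boundsE t : 0 < t ->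
  (\int[P]_w (occ D (itvI t (t + dl)) w * occ D (itvI t (t + dl)) w))%E = (q t)%:E /\
  2 * u (t + dl) * K <= q t <= 2 * u t * K.
Proof.
move=> t0; have := occ_square_bounds subD u_ge0 measurable_u u_le cdf_pot cdf_fin t0 dl_ge0.
rewrite -(fineK (pot_tent_fin subD cdf_fin dl_ge0)) -!EFinM -/K => /andP[h1 h2].
have i0 : (0 <= \int[P]_w (occ D (itvI t (t + dl)) w * occ D (itvI t (t + dl)) w))%E.
  by apply: integral_ge0 => w _; apply: mule_ge0; apply: occ_ge0; exact: itvI_ge0.
have f : (\int[P]_w (occ D (itvI t (t + dl)) w * occ D (itvI t (t + dl)) w))%E = (q t)%:E.
  by rewrite fineK// ge0_fin_numE// (le_lt_trans h2)// ltry.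
by split => //; move: h1 h2; rewrite f !lee_fin => -> ->.
Qed.

Let cross_boundsE s t : 0 <= s -> s + dl < t ->
  (\int[P]_w (occ D (itvI s (s + dl)) w * occ D (itvI t (t + dl)) w))%E = (cross s t)%:E /\
  dl * v (t + dl) * M s <= cross s t - m s * m t <= dl * v (t - (s + dl)) * M s.
Proof.
move=> s0 st; have t0 : 0 <= t by rewrite (le_trans _ (ltW st))// dl_pos.
have := occ_product_bounds subD u_ge0 measurable_u v_le v_ge0 u_diff cdf_pot cdf_fin s0 dl_ge0 st.
rewrite !potE// -(fineK (pot_mean_fin subD cdf_fin s0 dl_ge0)) -!EFinM -!EFinD -/(M s).
move=> /andP[h1 h2].
have i0 : (0 <= \int[P]_w (occ D (itvI s (s + dl)) w * occ D (itvI t (t + dl)) w))%E.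
  by apply: integral_ge0 => w _; apply: mule_ge0; apply: occ_ge0; exact: itvI_ge0.
have f : (\int[P]_w (occ D (itvI s (s + dl)) w * occ D (itvI t (t + dl)) w))%E = (cross s t)%:E.
  by rewrite fineK// ge0_fin_numE// (le_lt_trans h2)// ltry.
by split => //; move: h1 h2; rewrite f !lee_fin lerBrDl lerBlDl => -> ->.
Qed.

Let Dl_moments t : 0 < t ->
  [/\ Dl t \in Lfun P 2%:E, 'E_P[Dl t]%E = (m t)%:E & 'V_P[Dl t]%E = (q t - m t ^+ 2)%:E].
Proof.
move=> t0; have t0' := ltW t0.
have E2 : (\int[P]_w (Dl t w ^+ 2)%:E = (q t)%:E)%E.
  rewrite -(q_boundsE t0).1 -(expectation_inverse_product subD cdf_fin t0' (le_dl t) t0' (le_dl t)).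
  by apply: eq_integral => w _; rewrite expr2.
have L2 : Dl t \in Lfun P 2%:E.
  by apply: L2_intro; [exact: mDl|rewrite E2 ltry].
have E1 : 'E_P[Dl t]%E = (m t)%:E.
  by rewrite unlock -(potE t0') -(expectation_inverse_increment subD cdf_fin t0' (le_dl t)).
split => //; rewrite varianceE// E1.
have -> : 'E_P[Dl t ^+ 2]%E = (q t)%:E by rewrite unlock.
by rewrite -EFin_expe -EFinB.
Qed.

Let Dl_cov s t : 0 < s -> s + dl < t ->
  covariance P (Dl s) (Dl t) = (cross s t - m s * m t)%:E.
Proof.
move=> s0 st; have t0 : 0 < t by rewrite (le_lt_trans _ st)// dl_pos// ltW.
have [s2 Es _] := Dl_moments s0; have [t2 Et _] := Dl_moments t0.
rewrite (covarianceE (L2_L1 s2) (L2_L1 t2) (Lfun2_mul_Lfun1 s2 t2)) Es Et.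
have -> : 'E_P[Dl s * Dl t]%E = (cross s t)%:E.
  rewrite unlock -(cross_boundsE (ltW s0) st).1.
  rewrite -(expectation_inverse_product subD cdf_fin (ltW s0) (le_dl s) (ltW t0) (le_dl t)).
  by apply: eq_integral => w _.
by rewrite -EFinM -EFinB.
Qed.

Let Z : R -> T -> R :=
  noise_process dl (mixed_fractional_risk_process u0 mu rho lam Y N X).
Let c : R := mu * (1 + rho) * lam.
Let k : R := c - mu * lam.
Let sg : R := fine 'V_P[X 0%N]%E.
Let L : R := lam * (sg + mu ^+ 2).

Let ZE t : Z t = surplus N Y X c t (t + dl).
Proof.
apply/funext => w; rewrite /Z /noise_process /mixed_fractional_risk_process /surplus /c.
by ring.
Qed.

Let Vsg : 'V_P[X 0%N]%E = sg%:E.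
Proof. by rewrite fineK// variance_fin_num. Qed.

Let L0 : 0 < L.
Proof.
rewrite mulr_gt0// ltr_wpDl ?exprn_gt0//.
by rewrite -lee_fin -Vsg variance_ge0.
Qed.

Let Z_second s t : 0 <= s -> s + dl <= t -> forall b e1 e2 : R,
  (\int[P]_w ((b + e1 * Z s w + e2 * Z t w) ^+ 2)%:E =
  \int[P]_w ((b + k * (e1 * Dl s w + e2 * Dl t w)) ^+ 2 +
    L * (e1 ^+ 2 * Dl s w + e2 ^+ 2 * Dl t w))%:E)%E.
Proof.
move=> s0 st b e1 e2; rewrite !ZE.
exact: (surplus_second_moment lam0 hN (inverse_ge0 D) mY (inverse_increment_ge0 subD cdf_fin)
  hNY mX iidX X0_2 EX0 Vsg hX_indep c b e1 e2 s0 (le_dl s) st (le_dl t)).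
Qed.

Let mK t : 0 <= t -> measurable_fun setT (time_changed N Y t).
Proof.
move=> t0.
have h := measurable_counting_eval (poisson_measurable hN)
  (fun w t => (levy_cadlag (poisson_levy hN) w).1 t) (mY t0) (inverse_ge0 D t).
exact: (measurableT_comp h (measurable_fun_pair (@measurable_id _ T setT) (@measurable_id _ T setT))).
Qed.

Let mZ t : 0 <= t -> measurable_fun setT (Z t).
Proof.
have mS s : 0 <= s -> measurable_fun setT
    (fun w => \sum_(i < time_changed N Y s w) X i w).
  move=> s0; have h := measurable_random_sum (mK s0) mX.
  exact: (measurableT_comp h (measurable_fun_pair (@measurable_id _ T setT) (@measurable_id _ T setT))).
move=> t0; rewrite ZE; apply: measurable_funB.
  by apply: measurable_funM => //; exact: mDl.
by apply: measurable_funB; apply: mS => //; exact: dl_pos.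
Qed.

Let var t := k ^+ 2 * (q t - m t ^+ 2) + L * m t.

(* The pair of adjacent windows at [t] and [t + dl] serves to read off the moments
   of the first one. *)
Let Z_moments t : 0 < t -> Z t \in Lfun P 2%:E /\ 'V_P[Z t]%E = (var t)%:E.
Proof.
move=> t0; have t0' := ltW t0; have td0 : 0 < t + dl by rewrite addr_gt0.
have [t2 Et Vt] := Dl_moments t0; have [s2 Es Vs] := Dl_moments td0.
have [cv Ecv] : exists cv : R, covariance P (Dl t) (Dl (t + dl)) = cv%:E.
  exists (fine (covariance P (Dl t) (Dl (t + dl)))).
  by rewrite fineK// (covariance_fin_num (L2_L1 t2) (L2_L1 s2) (Lfun2_mul_Lfun1 t2 s2)).
have [? _ ?] := transfer_first (mZ t0') (mZ (ltW td0)) t2 s2 Et Es Vt Vs Ecv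
  (Z_second t0' (lexx _)).
by [].
Qed.

Let Z_cov s t : 0 < s -> s + dl < t ->
  covariance P (Z s) (Z t) = (k ^+ 2 * (cross s t - m s * m t))%:E.
Proof.
move=> s0 st; have t0 : 0 < t by rewrite (le_lt_trans _ st)// dl_pos// ltW.
have [t2 Et Vt] := Dl_moments t0; have [s2 Es Vs] := Dl_moments s0.
exact: (transfer_covariance (mZ (ltW s0)) (mZ (ltW t0)) s2 t2 Es Et Vs Vt (Dl_cov s0 st)
  (Z_second (ltW s0) (ltW st))).
Qed.

Let var_gt0 t : 0 < t -> 0 < var t.
Proof.
move=> t0; have [_ _ Vt] := Dl_moments t0.
have m0 : 0 < m t.
  have /andP[h _] := m_bounds t0; apply: lt_le_trans h.
  by rewrite mulr_gt0// u_gt0// addr_gt0.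
rewrite /var ltr_wpDl ?(mulr_gt0 L0)// mulr_ge0 ?sqr_ge0//.
by rewrite -lee_fin -Vt variance_ge0.
Qed.

Let cvg_m : t `^ a * m t @[t --> +oo] --> dl * A.
Proof.
apply: (@regular_squeeze R a dl 0 _ _ (fun t => dl * u t)); first exact: regular_scale.
by near=> t; rewrite addr0; apply: m_bounds; near: t; apply: nbhs_pinfty_gt; exact: num_real.
Unshelve. all: by end_near. Qed.

Let cvg_q : t `^ a * q t @[t --> +oo] --> 2 * K * A.
Proof.
apply: (@regular_squeeze R a dl 0 _ _ (fun t => 2 * K * u t)); first exact: regular_scale.
near=> t; rewrite addr0 ![2 * K * _]mulrAC; apply: (q_boundsE _).2.
by near: t; apply: nbhs_pinfty_gt; exact: num_real.
Unshelve. all: by end_near. Qed.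

Let cvg_cross s : 0 < s ->
  t `^ (a + 1) * (cross s t - m s * m t) @[t --> +oo] --> dl * M s * W.
Proof.
move=> s0.
apply: (@regular_squeeze R (a + 1) dl (- (s + dl)) _ _ (fun t => dl * M s * v t)).
  exact: regular_scale.
near=> t; rewrite ![dl * M s * _]mulrAC; apply: (cross_boundsE (ltW s0) _).2.
by near: t; apply: nbhs_pinfty_gt; exact: num_real.
Unshelve. all: by end_near. Qed.

Let vlim := k ^+ 2 * (2 * K * A) + L * (dl * A).

Let cvg_var : t `^ a * var t @[t --> +oo] --> vlim.
Proof.
have h0 : t `^ (- a) * (t `^ a * m t) @[t --> +oo] --> 0 * (dl * A).
  by apply: cvgM; [exact: powRN_cvg0|exact: cvg_m].
have hm : (t `^ a * m t) * (t `^ (- a) * (t `^ a * m t)) @[t --> +oo] --> dl * A * (0 * (dl * A)).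
  by apply: cvgM => //; exact: cvg_m.
have h : k ^+ 2 * (t `^ a * q t - (t `^ a * m t) * (t `^ (- a) * (t `^ a * m t))) +
    L * (t `^ a * m t) @[t --> +oo] --> k ^+ 2 * (2 * K * A - dl * A * (0 * (dl * A))) + L * (dl * A).
  apply: cvgD; last by apply: cvgM; [exact: cvg_cst|exact: cvg_m].
  by apply: cvgM; [exact: cvg_cst|apply: cvgB; [exact: cvg_q|exact: hm]].
rewrite mul0r mulr0 subr0 in h.
apply: cvg_trans h; apply: near_eq_cvg; near=> t.
have t0 : 0 < t by near: t; apply: nbhs_pinfty_gt; exact: num_real.
have p0 : t `^ a != 0 by rewrite gt_eqF// powR_gt0.
rewrite powRN /var.
have -> : (t `^ a)^-1 * (t `^ a * m t) = m t by rewrite mulrA mulVf// mul1r.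
by ring.
Unshelve. all: by end_near. Qed.

Let vlim_gt0 : 0 < vlim.
Proof.
have K0 : 0 <= K.
  by apply: fine_ge0; apply: pot_ge0 => y; rewrite lee_fin le_max lexx orbT.
apply: ltr_wpDl (mulr_gt0 L0 (mulr_gt0 dl0 A0)).
by apply: mulr_ge0; [exact: sqr_ge0|rewrite mulr_ge0 ?(ltW A0)// mulr_ge0].
Qed.

Let ratio (x y z p g h : R) : p != 0 -> g != 0 -> h != 0 ->
  x * (y * p * z) / (h * (p * g)) = y * (x * z / (h * g)).
Proof. by move=> p0 g0 h0; field; rewrite p0 g0 h0. Qed.

(** The variance decays with exponent [a] and the covariance with exponent [a + 1],
    so the correlation has exponent [a + 1 - a / 2]. *)
Lemma noise_short_range_dependent : short_range_dependent P Z.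
Proof.
split.
  by move=> t t0; have [h ->] := Z_moments t0; rewrite lte_fin var_gt0.
exists (1 + a / 2); first by apply/andP; split; move: a0 a1; lra.
exists (fun s => k ^+ 2 * (dl * M s * W) / (Num.sqrt (var s) * Num.sqrt vlim)) => s s0.
have corrE t : s + dl < t -> correlation P (Z s) (Z t) =
    k ^+ 2 * (cross s t - m s * m t) / (Num.sqrt (var s) * Num.sqrt (var t)).
  move=> st; have t0 : 0 < t by rewrite (le_lt_trans _ st)// dl_pos// ltW.
  by rewrite /correlation (Z_cov s0 st) (Z_moments s0).2 (Z_moments t0).2.
have vs0 : 0 < Num.sqrt (var s) by rewrite sqrtr_gt0 var_gt0.
have vl0 : 0 < Num.sqrt vlim by rewrite sqrtr_gt0.
apply: regular_decay_equiv.
  have hs : Num.sqrt (t `^ a * var t) @[t --> +oo] --> Num.sqrt vlim.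
    exact: (cvg_comp _ _ cvg_var (@sqrt_continuous R vlim)).
  have h : k ^+ 2 * (t `^ (a + 1) * (cross s t - m s * m t)) /
      (Num.sqrt (var s) * Num.sqrt (t `^ a * var t)) @[t --> +oo] -->
      k ^+ 2 * (dl * M s * W) / (Num.sqrt (var s) * Num.sqrt vlim).
    apply: cvgM; first by apply: cvgM; [exact: cvg_cst|exact: cvg_cross].
    apply: cvgV; first by rewrite gt_eqF// mulr_gt0.
    by apply: cvgM => //; exact: cvg_cst.
  apply: cvg_trans h; apply: near_eq_cvg; near=> t.
  have t0 : 0 < t by near: t; apply: nbhs_pinfty_gt; exact: num_real.
  have st : s + dl < t by near: t; apply: nbhs_pinfty_gt; exact: num_real.
  rewrite corrE//; set p := t `^ (a / 2).
  have p0 : 0 < p by rewrite powR_gt0.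
  have tn0 : t != 0 by rewrite gt_eqF.
  have e1 : t `^ a = p ^+ 2.
    by rewrite expr2 -powRD ?tn0 ?implybT// -splitr.
  have e2 : t `^ (a + 1) = t `^ (1 + a / 2) * p.
    by rewrite -powRD ?tn0 ?implybT//; congr (_ `^ _); rewrite [in LHS](splitr a); ring.
  rewrite e1 e2 sqrtrM ?sqr_ge0// sqrtr_sqr gtr0_norm//.
  have w0 : Num.sqrt (var t) != 0.
    by apply: lt0r_neq0; rewrite sqrtr_gt0; exact: var_gt0.
  exact: (ratio _ _ _ (lt0r_neq0 p0) w0 (lt0r_neq0 vs0)).
move=> /eqP; rewrite mulf_eq0 invr_eq0 (gt_eqF (mulr_gt0 vs0 vl0)) orbF.
rewrite !mulf_eq0 (gt_eqF W0) (gt_eqF dl0) orbb orbF /= => km.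
near=> t.
have st : s + dl < t by near: t; apply: nbhs_pinfty_gt; exact: num_real.
rewrite corrE//; case/orP: km => [/eqP ->|/eqP M0]; first by rewrite expr0n /= !mul0r.
have /andP[] := (cross_boundsE (ltW s0) st).2.
by rewrite M0 !mulr0 => h1 h2; rewrite (@le_anti _ _ (_ - _) 0) ?h1 ?h2// mulr0 mul0r.
Unshelve. all: by end_near. Qed.

End noise_decay.

(** * Mixed stable subordinators *)

Section stable_density.
Context {R : realType} {d : measure_display} {T : measurableType d}.
Variable P : probability T R.
Variables (C1 C2 a1 a2 : R).
Hypotheses (hC1 : 0 <= C1) (hC2 : 0 < C2).
Hypotheses (ha2 : 0 < a2) (ha21 : a2 < a1) (ha1 : a1 < 1).
Variable D : R -> T -> R.
Hypothesis hD : mixed_stable_subordinator P C1 C2 a1 a2 D.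

Let u := pot_density C1 C2 a1 a2.
Let v := spec_laplace (phi C1 C2 a1 a2) (2 - a2).

Let cphi := continuous_phi hC1 hC2 ha2 ha21 ha1.
Let phi_pos := phi_gt0 hC1 hC2 ha2 ha21 ha1.
Let phi_ub := phi_le hC1 hC2 ha2 ha21 ha1.

Let c1 : 0 < 1 - a2 <= 3.
Proof. by apply/andP; split; move: ha2 ha21 ha1; lra. Qed.
Let c2 : 0 < 2 - a2 <= 3.
Proof. by apply/andP; split; move: ha2 ha21 ha1; lra. Qed.

(** On [y <= b] the indicator is at most [e^b e^(- y)]. *)
Lemma potential_leI_fin b : 0 <= b -> (pot P D (leI b) < +oo)%E.
Proof.
move=> b0; have subD := hD.1.
have mE : measurable_fun setT (fun y : R => (expR (- (1 * y)))%:E).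
  apply/measurable_EFinP; apply: measurableT_comp => //.
  by apply: measurableT_comp => //; exact: measurable_funM.
have E0 y : (0 <= (expR (- (1 * y)) : R)%:E)%E by rewrite lee_fin expR_ge0.
apply: (@le_lt_trans _ _ (pot P D (fun y => (expR b)%:E * (expR (- (1 * y)))%:E)%E)).
  apply: (le_pot subD (measurable_leI b) _ (leI_ge0 b)).
  - exact: measurable_funeM.
  - move=> y _; rewrite leIE -EFinM -expRD; case: ifPn => yb.
      by rewrite lee_fin -[leLHS]expR0 ler_expR mul1r subr_ge0.
    by rewrite lee_fin expR_ge0.
  - by move=> y; rewrite mule_ge0// lee_fin expR_ge0.
rewrite (potZ subD mE E0 (expR_ge0 b)).
by rewrite (pot_expR hC1 hC2 hD.2)// -EFinM ltry.
Qed.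

Lemma noise_stable (u0 rho lam mu dl : R) (N : R -> T -> nat) (X : nat -> T -> R) :
  0 < lam -> 0 < mu -> 0 < dl ->
  poisson_process P lam N ->
  independent_classes P (process_events nonneg_times N)
    (process_events nonneg_times (inverse_subordinator D)) ->
  (forall i, measurable_fun setT (X i)) -> iid P X ->
  'E_P[X 0%N]%E = mu%:E -> X 0%N \in Lfun P 2%:E ->
  independent_classes P
    <<s process_events nonneg_times N `|`
        process_events nonneg_times (inverse_subordinator D) >>
    (process_events setT X) ->
  short_range_dependent P (noise_process dl
    (mixed_fractional_risk_process u0 mu rho lam (inverse_subordinator D) N X)).
Proof.
move=> lam0 mu0 dl0 hN hNY mX iidX EX0 X2 hXi.
have e : 1 - a2 + 1 = 2 - a2 by ring.
apply: (@noise_short_range_dependent R d T P u0 rho lam mu dl lam0 mu0 dl0 D N X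
  hD.1 hN hNY mX iidX EX0 X2 hXi u v _ _ _ _ _ _ _ _ _ (1 - a2) (phi0 C2 a2 * Gam (1 - a2))
  (phi0 C2 a2 * Gam (2 - a2))).
- exact: pot_density_ge0.
- by move=> t t0; exact: (spec_laplace_gt0 cphi phi_pos phi_ub c1 t0).
- exact: measurable_pot_density.
- by move=> s t; exact: (spec_laplace_le cphi phi_pos phi_ub c1).
- by move=> s t; exact: (spec_laplace_le cphi phi_pos phi_ub c2).
- by move=> t t0; exact: ltW (spec_laplace_gt0 cphi phi_pos phi_ub c2 t0).
- have c12 : 0 < 1 - a2 <= 2 by apply/andP; split; move: ha2 ha21 ha1; lra.
  by move=> x y; have := @spec_laplace_diff R _ _ cphi phi_pos phi_ub _ x y c12; rewrite e.
- by move=> b b0; exact: (potential_cdf hD.1 hC1 hC2 ha2 ha21 ha1 hD.2 b0).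
- exact: potential_leI_fin.
- by move: ha21 ha1; lra.
- by move: ha2; lra.
- by rewrite mulr_gt0 ?Gam_gt0// (phi0_gt0 hC2 ha2 ha21 ha1).
- by rewrite mulr_gt0 ?Gam_gt0// (phi0_gt0 hC2 ha2 ha21 ha1).
- exact: (cvg_spec_laplace cphi phi_pos phi_ub c1 (fun v vy => cvg_phi hC1 hC2 ha2 ha21 ha1 vy)).
- rewrite e.
  exact: (cvg_spec_laplace cphi phi_pos phi_ub c2 (fun v vy => cvg_phi hC1 hC2 ha2 ha21 ha1 vy)).
Qed.

End stable_density.

Theorem theorem4p3 (R : realType) (d : measure_display) (T : measurableType d)
    (P : probability T R)
    (a1 a2 C1 C2 : R) (ha2 : 0 < a2) (ha21 : a2 < a1) (ha1 : a1 < 1)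
    (hC1 : 0 <= C1) (hC2 : 0 <= C2) (hC : C1 + C2 = 1)
    (u rho lam mu delta : R) (hu : 0 < u) (hrho : 0 <= rho) (hlam : 0 < lam)
    (hmu : 0 < mu) (hdelta : 0 < delta)
    (D : R -> T -> R) (N : R -> T -> nat) (X : nat -> {RV P >-> R})
    (hD : mixed_stable_subordinator P C1 C2 a1 a2 D)
    (hN : poisson_process P lam N)
    (hNY : independent_classes P
       (process_events nonneg_times N)
       (process_events nonneg_times (inverse_subordinator D)))
    (hX : iid P (fun i => X i : T -> R))
    (hX_mean : 'E_P[X 0%N]%E = mu%:E)
    (hX_sq : (X 0%N : T -> R) \in Lfun P 2%:E)
    (hX_indep : independent_classes P
       <<s process_events nonneg_times N `|`
           process_events nonneg_times (inverse_subordinator D) >>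
       (process_events setT (fun i => X i : T -> R))) :
  short_range_dependent P
    (noise_process delta
       (mixed_fractional_risk_process u mu rho lam
          (inverse_subordinator D) N (fun i => X i : T -> R))).
Proof.
have mX i : measurable_fun setT (X i : T -> R) by [].
have [C20|C20] := leP C2 0; last first.
  exact: (noise_stable hC1 C20 ha2 ha21 ha1 hD u rho hlam hmu hdelta hN hNY mX hX
    hX_mean hX_sq hX_indep).
have C2E : C2 = 0 by apply/le_anti; rewrite C20 hC2.
have C1E : C1 = 1 by rewrite -hC C2E addr0.
have a10 : 0 < a1 by exact: lt_trans ha21.
have b1 : a1 < (1 + a1) / 2 by move: ha1; lra.
have b2 : (1 + a1) / 2 < 1 by move: ha1; lra.
have hD' : mixed_stable_subordinator P 0 1 ((1 + a1) / 2) a1 D.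
  split; first exact: hD.1.
  by move=> s t s0 t0; rewrite hD.2// C1E C2E !mul0r addr0 add0r.
exact: (noise_stable (lexx 0) ltr01 a10 b1 b2 hD' u rho hlam hmu hdelta hN hNY mX hX
  hX_mean hX_sq hX_indep).
Qed.
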